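(* Let $\mathsf{Lie\text{-}Rinehart}$ be the symmetric two-coloured operad (colours $S$, $L$) generated by a symmetric operation $\alpha:S\otimes S\to S$, a skew-symmetric operation $\beta:L\otimes L\to L$, and operations $d:S\otimes L\to S$, $m:S\otimes L\to L$ (no symmetry), subject to the relations $$\alpha(\alpha(x_1,x_2),x_3)-\alpha(x_1,\alpha(x_2,x_3))=0,$$ $$\beta(\beta(x_1,x_2),x_3)-\beta(\beta(x_1,x_3),x_2)-\beta(x_1,\beta(x_2,x_3))=0,$$ $$d(\alpha(x_1,x_2),x_3)=\alpha(x_1,d(x_2,x_3))+\alpha(d(x_1,x_3),x_2),$$ $$d(x_1,\beta(x_2,x_3))=d(d(x_1,x_3),x_2)-d(d(x_1,x_2),x_3),$$ $$m(\alpha(x_1,x_2),x_3)=m(x_1,m(x_2,x_3)),$$ $$d(x_1,m(x_2,x_3))=\alpha(d(x_1,x_3),x_2),$$ $$\beta(x_2,m(x_1,x_3))=m(x_1,\beta(x_2,x_3))+m(d(x_1,x_2),x_3).$$ Then: (1) The operad $\mathsf{Lie\text{-}Rinehart}$ admits a quadratic Gröbner basis (i.e. the ideal of relations of the associated shuffle two-coloured operad has a quadratic Gröbner basis for some admissible ordering of tree monomials). (2) The two-coloured symmetric collection $\mathsf{Lie\text{-}Rinehart}$ is isomorphic to the composition $N_m\circ(\mathsf{DCom}^1;\mathsf{Lie})$. Here $\mathsf{DCom}$ is the symmetric operad with colours $S,L$ generated by the symmetric operation $\alpha:S\otimes S\to S$ and the operation $d:S\otimes L\to S$ subject to the first and third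 relations above; $\mathsf{DCom}^1$ is the subset of $\mathsf{DCom}$ spanned by operations with output colour $S$; $\mathsf{Lie}$ is the Lie operad with all inputs and output of colour $L$; $(\mathsf{DCom}^1;\mathsf{Lie})$ is the collection whose component with output $S$ is $\mathsf{DCom}^1$ and whose component with output $L$ is $\mathsf{Lie}$; and $N_m$ is the nilpotent quadratic operad with colours $S,L$ generated by the single element $m:S\otimes L\to L$ subject to the relation $m(x_1,m(x_2,x_3))=0$.
   Context: Work over a field $\Bbbk$ of characteristic $0$. Let $I$ be a finite set of colours. A symmetric $I$-coloured collection $P$ consists of finite-dimensional spaces $P(n,\chi,c)$ for $n\ge 1$, $\chi:\{1,\dots,n\}\to I$ (input colours), $c\in I$ (output colour), with symmetric group actions $\sigma:P(n,\chi,c)\to P(n,\chi\sigma,c)$; equivalently $P$ is defined on all finite nonempty $I$-coloured sets. The composition of collections is $$(P\circ Q)(n,\chi,c)=\bigoplus_{(m,\chi')}P(m,\chi',c)\otimes_{\Bbbk\Sigma_m}\Big[\bigoplus_{f:\{1,\dots,n\}\twoheadrightarrow\{1,\dots,m\}}\bigotimes_{j=1}^m Q\big(f^{-1}(j),\chi|_{f^{-1}(j)},\chi'(j)\big)\Big],$$ where $\chi'$ runs over the colourings of $\{1,\dots,m\}$, and $\Sigma_m$ acts diagonally, permuting also $\chi'$. A symmetric coloured operad is a monoid for $\circ$; equivalently it has partial compositions, defined when the colours match, and identities $\mathrm{id}_c$, satisfying the usual operad axioms. Free shuffle coloured operad. Given generators, each with an arity, an ordered list of input colours and an output colour, the free shuffle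 $I$-coloured operad has as basis the tree monomials: planar rooted trees with vertices labelled by generators, edge colours matching the input/output colours of the generators, and leaves labelled bijectively by $1,\dots,n$ so that at every vertex the smallest leaf labels of the subtrees above its inputs increase from left to right. Shuffle compositions $\mu\circ_{l,\omega}\nu$ graft $\nu$ on the leaf $l$ of $\mu$ (colours matching) and relabel the leaves by $\omega$, preserving the relative orders of labels coming from $\mu$ and from $\nu$, so that the result is again a shuffle tree. An operadic ideal is a collection of subspaces, one for each arity, input colouring and output colour, closed under compositions with arbitrary elements on either side. A symmetric operad given by generators and relations yields a shuffle operad: its generators are all generators together with a basis of their symmetric group orbits (here $\alpha,\beta,d,e,m,n$ with $e(x_1,x_2)=d(x_2,x_1)$, $n(x_1,x_2)=m(x_2,x_1)$), and its relations are all elements of the symmetric group orbits of the relations, rewritten as combinations of shuffle tree monomials. A (total) ordering of tree monomials is admissible if monomials of smaller arity are smaller and $\mu\le\mu'$, $\nu\le\nu'$ (with $\mu,\mu'$ of the same arity and $\nu,\nu'$ of the same arity) imply $\mu\circ_{l,\omega}\nu\le\mu'\circ_{l,\omega}\nu'$ for all possible compositions. The leading term of an element is its largest tree monomial. For a subtree (containing all edges adjacent to its vertices) of a tree monomial, its leaves are relabelled according to the order of the smallest leaf labels above them; $\mu$ is divisible by $\nu$ if $\nu$ arises in this way from a subtree of $\mu$. A generating set $G$ of an operadic ideal $M$ is a Gröbner basis if the leading term of every nonzero $f\in M$ is divisible by the leading term of some element of $G$. It is quadratic if all its elements are combinations of tree monomials with two vertices. *)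

(* Defs.v *)
From HB Require Import structures.
From Stdlib Require List.
From mathcomp Require Import all_boot all_fingroup all_algebra.
From mathcomp Require Import boolp.
From mathcomp Require Import freeg.

Set Implicit Arguments.
Unset Strict Implicit.
Unset Printing Implicit Defensive.

Import GRing.Theory.
Local Open Scope ring_scope.

Section LinSpan.
Variables (k : fieldType) (V : lmodType k).

Definition subspace (M : V -> Prop) : Prop :=
  M 0 /\ forall (a : k) u v, M u -> M v -> M (a *: u + v).

Definition linspan (S : V -> Prop) (v : V) : Prop :=
  forall M : V -> Prop, subspace M -> (forall s, S s -> M s) -> M v.

Lemma linspan_subspace S : subspace (linspan S).
Proof.
split=> [M [] //|a u v hu hv M hM hS].
by case: (hM) => _; apply; [apply: hu | apply: hv].
Qed.

Lemma linspan_sub (S : V -> Prop) s : S s -> linspan S s.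
Proof. by move=> hs M _; apply. Qed.

Variable S : V -> Prop.

Definition linspan_pred : {pred V} := fun v => `[< linspan S v >].

Lemma linspan_zmod : zmod_closed linspan_pred.
Proof.
case: (linspan_subspace S) => h0 hl; split; first exact/asboolP.
move=> u v /asboolP hu /asboolP hv; apply/asboolP.
by rewrite addrC -scaleN1r; apply: hl.
Qed.

HB.instance Definition _ := GRing.isZmodClosed.Build V linspan_pred linspan_zmod.

Definition quot : Type := Quotient.quot (linspan_pred : zmodClosed V).
HB.instance Definition _ := GRing.Zmodule.on quot.

Definition quot_pi (v : V) : quot :=
  (\pi_(Quotient.quot (linspan_pred : zmodClosed V)) v)%qT.
Definition quot_repr (x : quot) : V :=
  generic_quotient.repr (x : Quotient.quot (linspan_pred : zmodClosed V)).

Lemma quot_reprK x : quot_pi (quot_repr x) = x.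
Proof. exact: reprK. Qed.

Lemma quot_piP u v : quot_pi u = quot_pi v <-> linspan S (u - v).
Proof.
rewrite /quot_pi; split.
  by move/eqP; rewrite -Quotient.idealrBE => /asboolP.
by move=> h; apply/eqP; rewrite -Quotient.idealrBE; apply/asboolP.
Qed.

Lemma quot_piD u v : quot_pi (u + v) = quot_pi u + quot_pi v.
Proof. exact: (Quotient.pi_add (linspan_pred : zmodClosed V) u v). Qed.

Definition quot_scale (a : k) (x : quot) : quot := quot_pi (a *: quot_repr x).

Lemma quot_piZ a v : quot_scale a (quot_pi v) = quot_pi (a *: v).
Proof.
apply/quot_piP; rewrite -scalerBr.
have /quot_piP h := quot_reprK (quot_pi v).
by case: (linspan_subspace S) => h0 hl; rewrite -[_ *: _]addr0; apply: hl.
Qed.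

Lemma quot_scaleA a b x : quot_scale a (quot_scale b x) = quot_scale (a * b) x.
Proof. by rewrite -[x]quot_reprK !quot_piZ scalerA. Qed.
Lemma quot_scale1 : left_id 1 quot_scale.
Proof. by move=> x; rewrite -[x]quot_reprK quot_piZ scale1r. Qed.
Lemma quot_scaleDr : right_distributive quot_scale +%R.
Proof.
move=> a x y; rewrite -[x]quot_reprK -[y]quot_reprK.
by rewrite -quot_piD !quot_piZ scalerDr quot_piD.
Qed.
Lemma quot_scaleDl x : {morph quot_scale^~ x : a b / a + b}.
Proof.
by move=> a b /=; rewrite -[x]quot_reprK !quot_piZ scalerDl quot_piD.
Qed.
HB.instance Definition _ := GRing.Zmodule_isLmodule.Build k quot
  quot_scaleA quot_scale1 quot_scaleDr quot_scaleDl.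

Lemma quot_pi_linear : linear quot_pi.
Proof. by move=> a u v; rewrite quot_piD -quot_piZ. Qed.

End LinSpan.

Section Free.
Variable k : fieldType.

Lemma fglift_linear (K : choiceType) (M : lmodType k) (f : K -> M) :
  linear (fglift f : {freeg K / k} -> M).
Proof.
have hB : {morph (fglift f : {freeg K / k} -> M) : x y / x - y}.
  exact: (lift_is_additive f).
have h0 : fglift f 0 = 0 by rewrite -[0 in LHS](subrr 0) hB subrr.
have hN x : fglift f (- x) = - fglift f x by rewrite -sub0r hB h0 sub0r.
have hD x y : fglift f (x + y) = fglift f x + fglift f y.
  by rewrite -{1}[y]opprK hB hN opprK.
have hS (r : seq K) (F : K -> {freeg K / k}) :
    fglift f (\sum_(i <- r) F i) = \sum_(i <- r) fglift f (F i).
  by elim: r => [|i r IH]; rewrite ?big_nil ?h0 // !big_cons hD IH.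
move=> a x y; rewrite hD; congr (_ + _).
rewrite -{1 2}[x]freeg_sumE scaler_sumr !hS scaler_sumr; apply: eq_bigr => i _.
have -> : a *: << coeff i x *g i >> = << a * coeff i x *g i >> :> {freeg K / k}.
  by apply/eqP/freeg_eqP => z; rewrite coeffZ !coeffU mulrA.
by rewrite !liftU scalerA.
Qed.

Definition fgmap (T T' : choiceType) (h : T -> T') (f : {freeg T / k}) :
  {freeg T' / k} := fglift (fun t => << h t >> : {freeg T' / k}) f.

Lemma fgmap_linear (T T' : choiceType) (h : T -> T') : linear (fgmap h).
Proof. exact: fglift_linear. Qed.

Lemma fgmapU (T T' : choiceType) (h : T -> T') t : fgmap h << t >> = << h t >>.
Proof. by rewrite /fgmap liftU scale1r. Qed.

Lemma lin0 (U V : lmodType k) (f : U -> V) : linear f -> f 0 = 0.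
Proof.
move=> h; have := h (-1) 0 0; rewrite scaler0 addr0 scaleN1r.
by rewrite addNr.
Qed.

Lemma linD (U V : lmodType k) (f : U -> V) :
  linear f -> {morph f : x y / x + y}.
Proof. by move=> h x y; have := h 1 x y; rewrite !scale1r. Qed.

Lemma linZ (U V : lmodType k) (f : U -> V) a x :
  linear f -> f (a *: x) = a *: f x.
Proof. by move=> h; have := h a x 0; rewrite (lin0 h) !addr0. Qed.

Lemma linB (U V : lmodType k) (f : U -> V) :
  linear f -> {morph f : x y / x - y}.
Proof. by move=> h x y; rewrite (linD h) -!scaleN1r (linZ _ _ h). Qed.

Lemma freeg_ext (T : choiceType) (V : lmodType k) (f g : {freeg T / k} -> V) :
  linear f -> linear g -> (forall t, f << t >> = g << t >>) -> f =1 g.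
Proof.
move=> hf hg h x; rewrite -[x]freeg_sumE.
elim: (dom x) => [|i r IH]; first by rewrite big_nil (lin0 hf) (lin0 hg).
rewrite big_cons (linD hf) (linD hg) IH; congr (_ + _).
have -> : << coeff i x *g i >> = coeff i x *: << i >> :> {freeg T / k}.
  by apply/eqP/freeg_eqP => z; rewrite coeffZ !coeffU mul1r.
by rewrite (linZ _ _ hf) (linZ _ _ hg) h.
Qed.

(* A map of generators induces a linear map of presented modules as soon as
   it sends relations to consequences of relations, see qmap_pi. *)
Definition qmap (T T' : choiceType) (S : {freeg T / k} -> Prop)
  (S' : {freeg T' / k} -> Prop) (h : T -> T') (x : quot S) : quot S' :=
  quot_pi S' (fgmap h (quot_repr x)).

Definition qcompat (T T' : choiceType) (S : {freeg T / k} -> Prop)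
  (S' : {freeg T' / k} -> Prop) (h : T -> T') : Prop :=
  forall f, S f -> linspan S' (fgmap h f).

Section QMap.
Variables (T T' : choiceType) (S : {freeg T / k} -> Prop).
Variables (S' : {freeg T' / k} -> Prop) (h : T -> T').
Hypothesis hS : qcompat S S' h.

Lemma qmap_pi f : qmap S' h (quot_pi S f) = quot_pi S' (fgmap h f).
Proof.
apply/quot_piP; rewrite -(linB (fgmap_linear h)).
have /quot_piP hsp := quot_reprK (quot_pi S f).
apply: (hsp (fun v => linspan S' (fgmap h v))) => //; split.
  by rewrite (lin0 (fgmap_linear h)); case: (linspan_subspace S').
move=> a u v hu hv; rewrite fgmap_linear.
by case: (linspan_subspace S') => _; apply.
Qed.

Lemma qmap_linear : linear (qmap (S := S) S' h).
Proof.
move=> a x y; rewrite -[x]quot_reprK -[y]quot_reprK.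
by rewrite -quot_pi_linear !qmap_pi fgmap_linear quot_pi_linear.
Qed.

Lemma qmap_gen t : qmap S' h (quot_pi S << t >>) = quot_pi S' << h t >>.
Proof. by rewrite qmap_pi fgmapU. Qed.
End QMap.

Lemma quot_ext (T : choiceType) (S : {freeg T / k} -> Prop) (V : lmodType k)
  (f g : quot S -> V) : linear f -> linear g ->
  (forall t, f (quot_pi S << t >>) = g (quot_pi S << t >>)) -> f =1 g.
Proof.
move=> hf hg h x; rewrite -[x]quot_reprK.
apply: (freeg_ext (f := f \o quot_pi S) (g := g \o quot_pi S)) => //.
- by move=> a u v /=; rewrite quot_pi_linear hf.
- by move=> a u v /=; rewrite quot_pi_linear hg.
Qed.

End Free.

(* Symmetric collections are functors on finite coloured sets and their colour
   preserving bijections. *)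
Record cbij (I : Type) (X Y : finType) (chi : X -> I) (psi : Y -> I) := Cbij {
  cbij_fun :> X -> Y;
  cbij_inv : Y -> X;
  cbij_funK : cancel cbij_fun cbij_inv;
  cbij_invK : cancel cbij_inv cbij_fun;
  cbij_col : forall x, psi (cbij_fun x) = chi x }.

Definition cbij_id (I : Type) (X : finType) (chi : X -> I) : cbij chi chi :=
  @Cbij I X X chi chi id id (fun=> erefl) (fun=> erefl) (fun=> erefl).

Definition cbij_comp (I : Type) (X Y Z : finType) (chi : X -> I)
  (psi : Y -> I) (xi : Z -> I) (g : cbij psi xi) (h : cbij chi psi) :
  cbij chi xi :=
  @Cbij I X Z chi xi (g \o h) (cbij_inv h \o cbij_inv g)
    (can_comp (cbij_funK g) (cbij_funK h))
    (can_comp (cbij_invK h) (cbij_invK g))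
    (fun x => etrans (cbij_col g (h x)) (cbij_col h x)).

(* Relabelling along a permutation s of {0, ..., m-1}: the new label s i gets
   the colour of i, so the new colouring is chi o s^-1. *)
Definition cbij_perm (I : Type) (m : nat) (chi : 'I_m -> I)
  (s : {perm 'I_m}) : cbij chi (fun i => chi ((s^-1)%g i)) :=
  @Cbij I _ _ chi (fun i => chi ((s^-1)%g i)) s (s^-1)%g (permK s) (permKV s)
    (fun i => congr1 chi (permK s i)).

Definition fibre (X : finType) (J : eqType) (f : X -> J) (j : J) : finType :=
  {x : X | f x == j}.

Section FibreBij.
Variables (I : Type) (X Y : finType) (chi : X -> I) (psi : Y -> I).
Variables (J K : eqType) (h : cbij chi psi) (f : X -> J) (g : Y -> K).
Variables (j : J) (l : K).
Hypothesis e : forall x, (g (h x) == l) = (f x == j).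

Lemma fibre_fwd (x : fibre f j) : g (h (val x)) == l.
Proof. by rewrite e; apply: (valP x). Qed.
Lemma fibre_bwd (y : fibre g l) : f (cbij_inv h (val y)) == j.
Proof. by rewrite -e cbij_invK; apply: (valP y). Qed.

Definition fibre_fun (x : fibre f j) : fibre g l := Sub (h (val x)) (fibre_fwd x).
Definition fibre_inv (y : fibre g l) : fibre f j :=
  Sub (cbij_inv h (val y)) (fibre_bwd y).

Lemma fibre_funK : cancel fibre_fun fibre_inv.
Proof. by move=> x; apply: val_inj; rewrite !SubK cbij_funK. Qed.
Lemma fibre_invK : cancel fibre_inv fibre_fun.
Proof. by move=> x; apply: val_inj; rewrite !SubK cbij_invK. Qed.

Definition fibre_cbij :
  cbij (fun x : fibre f j => chi (val x)) (fun y : fibre g l => psi (val y)) :=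
  Cbij fibre_funK fibre_invK (fun x => cbij_col h (val x)).
End FibreBij.

Record collection (k : fieldType) (I : Type) := Collection {
  csp :> forall X : finType, (X -> I) -> I -> lmodType k;
  cmap : forall (X Y : finType) (chi : X -> I) (psi : Y -> I) (c : I),
    cbij chi psi -> csp chi c -> csp psi c;
  cmap_linear : forall (X Y : finType) (chi : X -> I) (psi : Y -> I) (c : I)
    (h : cbij chi psi), linear (@cmap X Y chi psi c h);
  cmap_id : forall (X : finType) (chi : X -> I) (c : I) (h : cbij chi chi)
    (p : csp chi c), h =1 id -> cmap h p = p;
  cmap_comp : forall (X Y Z : finType) (chi : X -> I) (psi : Y -> I)
    (xi : Z -> I) (c : I) (h : cbij chi psi) (g : cbij psi xi)
    (gh : cbij chi xi) (p : csp chi c),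
    gh =1 g \o h -> cmap gh p = cmap g (cmap h p) }.

(* Collections are only looked at on nonempty sets (arities n >= 1). *)
Definition isomorphic (k : fieldType) (I : Type) (P Q : collection k I) : Prop :=
  exists phi : forall (X : finType) (chi : X -> I) (c : I), P X chi c -> Q X chi c,
  [/\ forall (X : finType) (chi : X -> I) (c : I),
        (0 < #|X|)%N -> linear (@phi X chi c),
      forall (X : finType) (chi : X -> I) (c : I),
        (0 < #|X|)%N -> bijective (@phi X chi c)
    & forall (X Y : finType) (chi : X -> I) (psi : Y -> I) (c : I)
        (h : cbij chi psi) (p : P X chi c),
        (0 < #|X|)%N -> phi Y psi c (cmap h p) = cmap h (phi X chi c p)].

(* The collection whose component with output colour c is that of P c. *)
Definition glue_outputs (k : fieldType) (I : Type) (P : I -> collection k I) :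
  collection k I :=
  @Collection k I (fun X chi c => P c X chi c)
    (fun X Y chi psi c h => @cmap k I (P c) X Y chi psi c h)
    (fun X Y chi psi c => @cmap_linear k I (P c) X Y chi psi c)
    (fun X chi c => @cmap_id k I (P c) X chi c)
    (fun X Y Z chi psi xi c => @cmap_comp k I (P c) X Y Z chi psi xi c).

Section Composition.
Variables (k : fieldType) (I : Type) (P Q : collection k I).

(* (P o Q)(X, chi, c) is presented by generators and relations: a generator is
   a colouring of {0, ..., m-1}, a surjection f from X onto {0, ..., m-1}, and
   a decomposable tensor p (x) q_0 (x) ... (x) q_(m-1); the relations are
   multilinearity of the tensor product and the diagonal action of the
   symmetric group. *)
Record comp_term (X : finType) (chi : X -> I) (c : I) := CompTerm {
  ct_m : nat;
  ct_col : 'I_ct_m -> I;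
  ct_f : X -> 'I_ct_m;
  ct_surj : forall j, exists x, ct_f x = j;
  ct_p : P _ ct_col c;
  ct_q : forall j, Q (fibre ct_f j) (fun x => chi (val x)) (ct_col j) }.

Arguments ct_m {X chi c} t : rename.
Arguments ct_col {X chi c} t j : rename.
Arguments ct_f {X chi c} t x : rename.
Arguments ct_surj {X chi c} t j : rename.
Arguments ct_p {X chi c} t : rename.
Arguments ct_q {X chi c} t j : rename.

Definition comp_free (X : finType) (chi : X -> I) (c : I) : lmodType k :=
  {freeg {classic comp_term chi c} / k}.

Definition comp_gen (X : finType) (chi : X -> I) (c : I)
  (t : {classic comp_term chi c}) : comp_free chi c := << t >>.

Lemma perm_fibre_eq (X : finType) (chi : X -> I) (m : nat) (s : {perm 'I_m})
  (f : X -> 'I_m) (j : 'I_m) (x : X) :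
  (s (f (cbij_id chi x)) == j) = (f x == (s^-1)%g j).
Proof. by rewrite -{1}[j](permKV s) (inj_eq perm_inj). Qed.

Inductive comp_rel (X : finType) (chi : X -> I) (c : I) :
  comp_free chi c -> Prop :=
| comp_rel_linl (m : nat) (col : 'I_m -> I) (f : X -> 'I_m)
    (hf : forall j, exists x, f x = j) (a : k) (p1 p2 : P _ col c)
    (q : forall j, Q (fibre f j) (fun x => chi (val x)) (col j)) :
    comp_rel (comp_gen (CompTerm hf (a *: p1 + p2) q)
              - (a *: comp_gen (CompTerm hf p1 q) + comp_gen (CompTerm hf p2 q)))
| comp_rel_linr (m : nat) (col : 'I_m -> I) (f : X -> 'I_m)
    (hf : forall j, exists x, f x = j) (p : P _ col c) (j : 'I_m) (a : k)
    (q q1 q2 : forall j, Q (fibre f j) (fun x => chi (val x)) (col j)) :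
    (forall i, i != j -> q i = q1 i /\ q i = q2 i) ->
    q j = a *: q1 j + q2 j ->
    comp_rel (comp_gen (CompTerm hf p q)
              - (a *: comp_gen (CompTerm hf p q1) + comp_gen (CompTerm hf p q2)))
| comp_rel_perm (m : nat) (col : 'I_m -> I) (f : X -> 'I_m)
    (hf : forall j, exists x, f x = j) (p : P _ col c)
    (q : forall j, Q (fibre f j) (fun x => chi (val x)) (col j))
    (s : {perm 'I_m}) (hsf : forall j, exists x, s (f x) = j) :
    comp_rel (comp_gen (CompTerm hf p q)
      - comp_gen (@CompTerm X chi c m (fun j => col ((s^-1)%g j))
          (fun x => s (f x)) hsf (cmap (cbij_perm col s) p)
          (fun j => cmap (fibre_cbij (perm_fibre_eq chi s f j)) (q ((s^-1)%g j))))).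

Section Map.
Variables (X Y : finType) (chi : X -> I) (psi : Y -> I) (c : I).
Variable (h : cbij chi psi).

Lemma comp_map_surj m (f : X -> 'I_m) :
  (forall j, exists x, f x = j) -> forall j, exists y, f (cbij_inv h y) = j.
Proof. by move=> hf j; case: (hf j) => x <-; exists (h x); rewrite cbij_funK. Qed.

Lemma comp_map_fibre m (f : X -> 'I_m) j x :
  (f (cbij_inv h (h x)) == j) = (f x == j).
Proof. by rewrite cbij_funK. Qed.

Definition comp_map_term (t : {classic comp_term chi c}) :
  {classic comp_term psi c} :=
  @CompTerm Y psi c (ct_m t) (ct_col t)
    (fun y => ct_f t (cbij_inv h y)) (comp_map_surj (ct_surj t)) (ct_p t)
    (fun j => cmap (fibre_cbij (comp_map_fibre (ct_f t) j)) (ct_q t j)).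
End Map.

Lemma cmap_square (R : collection k I) (X Y Y' Z : finType) (chi : X -> I)
  (psi : Y -> I) (psi' : Y' -> I) (xi : Z -> I) (c : I)
  (h : cbij chi psi) (g : cbij psi xi) (h' : cbij chi psi') (g' : cbij psi' xi)
  (p : R X chi c) :
  g \o h =1 g' \o h' -> cmap g (cmap h p) = cmap g' (cmap h' p).
Proof.
move=> e; rewrite -(@cmap_comp k I R _ _ _ _ _ _ _ h g (cbij_comp g h)) //.
by rewrite -(@cmap_comp k I R _ _ _ _ _ _ _ h' g' (cbij_comp g h)).
Qed.

Lemma comp_term_eq (X : finType) (chi : X -> I) (c : I) (m : nat)
  (col : 'I_m -> I) (f f' : X -> 'I_m) (hf : forall j, exists x, f x = j)
  (hf' : forall j, exists x, f' x = j) (p : P _ col c)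
  (q : forall j, Q (fibre f j) (fun x => chi (val x)) (col j))
  (q' : forall j, Q (fibre f' j) (fun x => chi (val x)) (col j)) :
  f =1 f' ->
  (forall j, exists2 b : cbij (fun x : fibre f j => chi (val x))
                              (fun x : fibre f' j => chi (val x)),
     (forall x, val (b x) = val x) & cmap b (q j) = q' j) ->
  CompTerm hf p q = CompTerm hf' p q'.
Proof.
move=> /funext e; case: _ / e in hf' q' * => hq.
have -> : hf' = hf by exact: Prop_irrelevance.
congr (CompTerm _ _ _); apply: functional_extensionality_dep => j.
by case: (hq j) => b hb <-; rewrite cmap_id // => x; apply: val_inj.
Qed.

Lemma comp_map_compat (X Y : finType) (chi : X -> I) (psi : Y -> I) (c : I)
  (h : cbij chi psi) :
  qcompat (@comp_rel X chi c) (@comp_rel Y psi c) (comp_map_term (c := c) h).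
Proof.
have L := fgmap_linear (k := k) (comp_map_term (c := c) h).
move=> r [m col f hf a p1 p2 q|m col f hf p j a q q1 q2 hq hqj|
          m col f hf p q s hsf]; apply: linspan_sub;
  rewrite /comp_gen (linB L) ?(linD L) ?(linZ _ _ L) !fgmapU.
- exact: comp_rel_linl.
- apply: (@comp_rel_linr _ _ _ _ _ _ _ _ j) => /= [i ij|].
    by case: (hq i ij) => <- <-.
  by rewrite hqj cmap_linear.
- have hsf' j : exists y, s (f (cbij_inv h y)) = j.
    by case: (hsf j) => x <-; exists (h x); rewrite cbij_funK.
  set u := comp_map_term h _; set v := comp_map_term h _.
  suff -> : v = @CompTerm Y psi c m (fun j => col ((s^-1)%g j))
          (fun x => s (f (cbij_inv h x))) hsf' (cmap (cbij_perm col s) p)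
          (fun j => cmap (fibre_cbij
             (perm_fibre_eq psi s (fun x => f (cbij_inv h x)) j))
                       (ct_q u ((s^-1)%g j))) by exact: comp_rel_perm.
  apply: comp_term_eq => // j; exists (cbij_id _) => //.
  rewrite cmap_id //=; apply: cmap_square => x /=; exact: val_inj.
Qed.

Definition comp_sp (X : finType) (chi : X -> I) (c : I) : lmodType k :=
  quot (@comp_rel X chi c).

Definition comp_map (X Y : finType) (chi : X -> I) (psi : Y -> I) (c : I)
  (h : cbij chi psi) : comp_sp chi c -> comp_sp psi c :=
  qmap (@comp_rel Y psi c) (comp_map_term (c := c) h).

Lemma comp_map_linear (X Y : finType) (chi : X -> I) (psi : Y -> I) (c : I)
  (h : cbij chi psi) : linear (comp_map (c := c) h).
Proof. exact: qmap_linear (comp_map_compat _). Qed.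

Lemma comp_map_id (X : finType) (chi : X -> I) (c : I) (h : cbij chi chi)
  (p : comp_sp chi c) : h =1 id -> comp_map h p = p.
Proof.
move=> hid; move: p; apply: quot_ext; [exact: comp_map_linear|by []|].
move=> [m col f hf p q]; rewrite /comp_map qmap_gen; last exact: comp_map_compat.
congr (quot_pi _ << _ >>).
have hinv x : cbij_inv h x = x by rewrite -{1}[x]hid cbij_funK.
symmetry; apply: comp_term_eq => [x|j] /=; first by rewrite hinv.
by eexists; last reflexivity; move=> x /=; rewrite hid.
Qed.

Lemma comp_map_comp (X Y Z : finType) (chi : X -> I) (psi : Y -> I)
  (xi : Z -> I) (c : I) (h : cbij chi psi) (g : cbij psi xi)
  (gh : cbij chi xi) (p : comp_sp chi c) :
  gh =1 g \o h -> comp_map gh p = comp_map g (comp_map h p).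
Proof.
move=> e; move: p; apply: (quot_ext (g := comp_map g \o comp_map h)).
- exact: comp_map_linear.
- by move=> a u v /=; rewrite !comp_map_linear.
move=> [m col f hf p q] /=.
rewrite /comp_map !qmap_gen; try exact: comp_map_compat.
congr (quot_pi _ << _ >>).
have hinv z : cbij_inv gh z = cbij_inv h (cbij_inv g z).
  apply: (can_inj (cbij_funK gh)).
  by rewrite cbij_invK e /= !cbij_invK.
apply: comp_term_eq => [x|j] /=; first by rewrite hinv.
have E x : (f (cbij_inv h (cbij_inv g (cbij_id xi x))) == j)
         = (f (cbij_inv gh x) == j) by rewrite hinv.
exists (fibre_cbij (f := fun y => f (cbij_inv gh y))
                   (g := fun y => f (cbij_inv h (cbij_inv g y))) E) => //.
by apply: cmap_square => x; apply: val_inj; rewrite /= e.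
Qed.

Definition composition : collection k I :=
  Collection comp_map_linear comp_map_id comp_map_comp.

End Composition.

(* All generators being binary, tree monomials are binary trees. *)
Inductive tree (G X : Type) : Type :=
| Leaf of X
| Node of G & tree G X & tree G X.
Arguments Leaf {G X} x.
Arguments Node {G X} g a b.

Section TreeChoice.
Variables G X : Type.

Fixpoint tree_encode (t : tree G X) : GenTree.tree (G + X) :=
  match t with
  | Leaf x => GenTree.Leaf (inr x)
  | Node g a b =>
      GenTree.Node 0 [:: GenTree.Leaf (inl g); tree_encode a; tree_encode b]
  end.

Fixpoint tree_decode (t : GenTree.tree (G + X)) : option (tree G X) :=
  match t with
  | GenTree.Leaf (inr x) => Some (Leaf x)
  | GenTree.Node _ [:: GenTree.Leaf (inl g); a; b] =>
      if tree_decode a is Some a' then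
        if tree_decode b is Some b' then Some (Node g a' b') else None
      else None
  | _ => None
  end.

Lemma tree_encodeK : pcancel tree_encode tree_decode.
Proof. by elim=> //= g a -> b ->. Qed.
End TreeChoice.

HB.instance Definition _ (G X : choiceType) :=
  Choice.copy (tree G X) (pcan_type (@tree_encodeK G X)).

Section TreeOps.
Variable G : Type.

Fixpoint leaves (X : Type) (t : tree G X) : seq X :=
  match t with Leaf x => [:: x] | Node _ a b => leaves a ++ leaves b end.

Fixpoint nvertices (X : Type) (t : tree G X) : nat :=
  match t with Leaf _ => 0 | Node _ a b => (nvertices a + nvertices b).+1 end.

Fixpoint bind (X Y : Type) (t : tree G X) (s : X -> tree G Y) : tree G Y :=
  match t with
  | Leaf x => s x
  | Node g a b => Node g (bind a s) (bind b s)
  end.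

Definition tmap (X Y : Type) (h : X -> Y) (t : tree G X) : tree G Y :=
  bind t (fun x => Leaf (h x)).

(* Grafting of t' on the leaf l of t; the remaining leaves of t are relabelled
   by u, and those of t' by v. *)
Definition graft (X : eqType) (Y Z : Type) (l : X) (u : X -> Z) (v : Y -> Z)
  (t : tree G X) (t' : tree G Y) : tree G Z :=
  bind t (fun x => if x == l then tmap v t' else Leaf (u x)).

End TreeOps.

(* u on X minus l and v on Y are injective, with images partitioning Z *)
Definition grafting (X Y Z : finType) (l : X) (u : X -> Z) (v : Y -> Z) : bool :=
  [forall z, #|[pred x | (x != l) && (u x == z)]| + #|[pred y | v y == z]| == 1]%N.

Definition graft_colours (I : Type) (X Y Z : finType) (chi : X -> I)
  (psi : Y -> I) (xi : Z -> I) (l : X) (u : X -> Z) (v : Y -> Z) : Prop :=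
  (forall x, x <> l -> xi (u x) = chi x) /\ (forall y, xi (v y) = psi y).

(* The generators are the elements of the set gens: the operad generated by
   some of the operations of a larger signature is obtained by shrinking it. *)
Record signature (I : Type) := Signature {
  sym :> choiceType;
  gens : pred sym;
  src1 : sym -> I;
  src2 : sym -> I;
  tgt : sym -> I }.

Record relation (k : fieldType) (I : Type) (G : choiceType) := Relation {
  rel_arity : nat;
  rel_col : 'I_rel_arity -> I;
  rel_out : I;
  rel_elt : {freeg (tree G 'I_rel_arity) / k} }.

Section FreeOperad.
Variables (k : fieldType) (I : eqType) (Sig : signature I).

Section Component.
Variables (X : finType) (chi : X -> I) (c : I).

Fixpoint typed (d : I) (t : tree Sig X) : bool :=
  match t with
  | Leaf x => chi x == d
  | Node g a b =>
      [&& gens g, tgt g == d, typed (src1 g) a & typed (src2 g) b]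
  end.

Definition monomial (t : tree Sig X) : bool :=
  typed c t && [forall x, count_mem x (leaves t) == 1%N].

Definition homogeneous (f : {freeg (tree Sig X) / k}) : bool :=
  all monomial (dom f).
End Component.

Definition graft_lin (X Y Z : finType) (l : X) (u : X -> Z) (v : Y -> Z)
  (f : {freeg (tree Sig X) / k}) (g : {freeg (tree Sig Y) / k}) :
  {freeg (tree Sig Z) / k} :=
  fglift (fun t => fglift (fun t' =>
    << graft l u v t t' >> : {freeg (tree Sig Z) / k}) g) f.

Definition relabel (X Y : finType) (h : X -> Y) (f : {freeg (tree Sig X) / k}) :
  {freeg (tree Sig Y) / k} := fgmap (tmap h) f.

Definition sym_family := forall X : finType, (X -> I) -> I ->
  {freeg (tree Sig X) / k} -> Prop.

Record sym_ideal (M : sym_family) : Prop := {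
  symi_hom : forall (X : finType) (chi : X -> I) (c : I) f,
    M X chi c f -> homogeneous chi c f;
  symi_subspace : forall (X : finType) (chi : X -> I) (c : I),
    subspace (M X chi c);
  symi_relabel : forall (X Y : finType) (chi : X -> I) (psi : Y -> I) (c : I)
    (h : cbij chi psi) f, M X chi c f -> M Y psi c (relabel h f);
  symi_graftl : forall (X Y Z : finType) (chi : X -> I) (psi : Y -> I)
    (xi : Z -> I) (c : I) (l : X) (u : X -> Z) (v : Y -> Z) f g,
    grafting l u v -> graft_colours chi psi xi l u v ->
    M X chi c f -> homogeneous psi (chi l) g -> M Z xi c (graft_lin l u v f g);
  symi_graftr : forall (X Y Z : finType) (chi : X -> I) (psi : Y -> I)
    (xi : Z -> I) (c : I) (l : X) (u : X -> Z) (v : Y -> Z) f g,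
    grafting l u v -> graft_colours chi psi xi l u v ->
    homogeneous chi c f -> M Y psi (chi l) g -> M Z xi c (graft_lin l u v f g) }.

Definition sym_ideal_gen (rels : seq (relation k I Sig)) : sym_family := fun X chi c f =>
  forall M : sym_family, sym_ideal M ->
  (forall r, List.In r rels -> M _ (@rel_col _ _ _ r) (rel_out r) (rel_elt r)) ->
  M X chi c f.

(* The free symmetric operad on generators without symmetries modulo the ideal
   generated by rels, as a collection; symmetries of generators are relations. *)
Section Presented.
Variable rels : seq (relation k I Sig).

Definition mon (X : finType) (chi : X -> I) (c : I) : choiceType :=
  {t : tree Sig X | monomial chi c t}.

Definition mon_val (X : finType) (chi : X -> I) (c : I)
  (f : {freeg (mon chi c) / k}) : {freeg (tree Sig X) / k} :=
  fgmap (fun t : mon chi c => val t) f.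

Definition op_rel (X : finType) (chi : X -> I) (c : I)
  (f : {freeg (mon chi c) / k}) : Prop := sym_ideal_gen rels chi c (mon_val f).

Definition op_sp (X : finType) (chi : X -> I) (c : I) : lmodType k :=
  quot (@op_rel X chi c).

Lemma typed_tmap (X Y : finType) (chi : X -> I) (psi : Y -> I)
  (h : cbij chi psi) d t : typed psi d (tmap h t) = typed chi d t.
Proof.
elim: t d => [x|g a IHa b IHb] d /=; first by rewrite cbij_col.
by rewrite /tmap in IHa IHb *; rewrite IHa IHb.
Qed.

Lemma leaves_tmap (X Y : Type) (h : X -> Y) (t : tree Sig X) :
  leaves (tmap h t) = map h (leaves t).
Proof. by elim: t => //= g a IHa b IHb; rewrite map_cat -IHa -IHb. Qed.

Lemma monomial_tmap (X Y : finType) (chi : X -> I) (psi : Y -> I)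
  (h : cbij chi psi) c t : monomial chi c t -> monomial psi c (tmap h t).
Proof.
case/andP=> ht /forallP hl; rewrite /monomial typed_tmap ht; apply/forallP => y.
rewrite leaves_tmap count_map -(eqP (hl (cbij_inv h y))); apply/eqP.
by apply: eq_count => x /=; rewrite (can2_eq (cbij_funK h) (cbij_invK h)).
Qed.

Definition mon_map (X Y : finType) (chi : X -> I) (psi : Y -> I) (c : I)
  (h : cbij chi psi) (t : mon chi c) : mon psi c :=
  Sub (tmap h (val t)) (monomial_tmap h (valP t)).

Lemma tmap_id (X : Type) (h : X -> X) (t : tree Sig X) : h =1 id -> tmap h t = t.
Proof.
by move=> e; elim: t => [x|g a IHa b IHb]; rewrite /tmap /= ?e //; congr Node.
Qed.

Lemma tmap_comp (X Y Z : Type) (h : X -> Y) (g : Y -> Z) (gh : X -> Z)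
  (t : tree Sig X) : gh =1 g \o h -> tmap gh t = tmap g (tmap h t).
Proof.
by move=> e; elim: t => [x|i a IHa b IHb]; rewrite /tmap /= ?e //; congr Node.
Qed.

Lemma op_compat (X Y : finType) (chi : X -> I) (psi : Y -> I) (c : I)
  (h : cbij chi psi) :
  qcompat (@op_rel X chi c) (@op_rel Y psi c) (mon_map (c := c) h).
Proof.
move=> f hf; apply: linspan_sub => M hM hR.
have -> : mon_val (fgmap (mon_map (c := c) h) f) = relabel h (mon_val f).
  move: f {hf}; apply: (freeg_ext
    (f := @mon_val _ _ _ \o _) (g := @relabel _ _ _ \o _)) => [a u v|a u v|t] /=.
  - by rewrite /mon_val !fgmap_linear.
  - by rewrite /mon_val /relabel !fgmap_linear.
  - by rewrite /mon_val /relabel !fgmapU SubK.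
by apply: (symi_relabel hM); apply: hf.
Qed.

Definition op_map (X Y : finType) (chi : X -> I) (psi : Y -> I) (c : I)
  (h : cbij chi psi) : op_sp chi c -> op_sp psi c :=
  qmap (@op_rel Y psi c) (mon_map (c := c) h).

Lemma op_map_linear (X Y : finType) (chi : X -> I) (psi : Y -> I) (c : I)
  (h : cbij chi psi) : linear (op_map (c := c) h).
Proof. exact: qmap_linear (op_compat _). Qed.

Lemma op_map_id (X : finType) (chi : X -> I) (c : I) (h : cbij chi chi)
  (p : op_sp chi c) : h =1 id -> op_map h p = p.
Proof.
move=> hid; move: p; apply: quot_ext; [exact: op_map_linear|by []|].
move=> t; rewrite /op_map qmap_gen; last exact: op_compat.
by congr (quot_pi _ << _ >>); apply: val_inj; rewrite SubK tmap_id.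
Qed.

Lemma op_map_comp (X Y Z : finType) (chi : X -> I) (psi : Y -> I)
  (xi : Z -> I) (c : I) (h : cbij chi psi) (g : cbij psi xi)
  (gh : cbij chi xi) (p : op_sp chi c) :
  gh =1 g \o h -> op_map gh p = op_map g (op_map h p).
Proof.
move=> e; move: p; apply: (quot_ext (g := op_map g \o op_map h)).
- exact: op_map_linear.
- by move=> a u v /=; rewrite !op_map_linear.
move=> t /=; rewrite /op_map !qmap_gen; try exact: op_compat.
by congr (quot_pi _ << _ >>); apply: val_inj; rewrite !SubK (tmap_comp _ e).
Qed.

Definition presented_operad : collection k I :=
  Collection op_map_linear op_map_id op_map_comp.
End Presented.

(* Leaves of shuffle trees are labelled by 0, ..., n-1. *)
Definition smallest_leaf (G : Type) (n : nat) : tree G 'I_n -> nat :=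
  fix min_ t := match t with
  | Leaf i => i : nat
  | Node _ a b => minn (min_ a) (min_ b)
  end.

Fixpoint is_shuffle (n : nat) (t : tree Sig 'I_n) : bool :=
  match t with
  | Leaf _ => true
  | Node _ a b =>
      [&& (smallest_leaf a < smallest_leaf b)%N, is_shuffle a & is_shuffle b]
  end.

Definition sh_monomial (n : nat) (chi : 'I_n -> I) (c : I) (t : tree Sig 'I_n) :
  bool := monomial chi c t && is_shuffle t.

Definition sh_homogeneous (n : nat) (chi : 'I_n -> I) (c : I)
  (f : {freeg (tree Sig 'I_n) / k}) : bool := all (sh_monomial chi c) (dom f).

(* The relabelling omega, given by u on the labels of mu and v on those of nu.
   Here u l, a dummy value as far as graft is concerned, is the smallest label
   of the grafted tree: that tree takes the place of l in the order of the
   labels of mu, and so grafting gives shuffle trees. *)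
Definition shuffle_grafting (n m p : nat) (l : 'I_n) (u : 'I_n -> 'I_p)
  (v : 'I_m -> 'I_p) : Prop :=
  [/\ grafting l u v,
      {homo u : i j / (i < j)%N}, {homo v : i j / (i < j)%N}
    & forall j : 'I_m, val j = 0%N -> v j = u l].

Definition sh_family := forall n : nat, ('I_n -> I) -> I ->
  {freeg (tree Sig 'I_n) / k} -> Prop.

Record sh_ideal (M : sh_family) : Prop := {
  shi_hom : forall n (chi : 'I_n -> I) c f, M n chi c f -> sh_homogeneous chi c f;
  shi_subspace : forall n (chi : 'I_n -> I) c, subspace (M n chi c);
  shi_graftl : forall n m p (chi : 'I_n -> I) (psi : 'I_m -> I) (xi : 'I_p -> I)
    c l (u : 'I_n -> 'I_p) (v : 'I_m -> 'I_p) f g,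
    shuffle_grafting l u v -> graft_colours chi psi xi l u v ->
    M n chi c f -> sh_homogeneous psi (chi l) g ->
    M p xi c (graft_lin l u v f g);
  shi_graftr : forall n m p (chi : 'I_n -> I) (psi : 'I_m -> I) (xi : 'I_p -> I)
    c l (u : 'I_n -> 'I_p) (v : 'I_m -> 'I_p) f g,
    shuffle_grafting l u v -> graft_colours chi psi xi l u v ->
    sh_homogeneous chi c f -> M m psi (chi l) g ->
    M p xi c (graft_lin l u v f g) }.

Definition sh_ideal_gen (R : sh_family) : sh_family := fun n chi c f =>
  forall M : sh_family, sh_ideal M ->
  (forall m (psi : 'I_m -> I) d g, R m psi d g -> M m psi d g) -> M n chi c f.

Definition any_tree : Type := {n : nat & tree Sig 'I_n}.
Definition any {n : nat} (t : tree Sig 'I_n) : any_tree :=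
  existT (fun n => tree Sig 'I_n) n t.
Definition any_monomial (x : any_tree) : Prop :=
  exists chi c, sh_monomial chi c (projT2 x).

Definition total_ordering (le : rel any_tree) : Prop :=
  [/\ forall x, any_monomial x -> le x x,
      forall x y, any_monomial x -> any_monomial y -> le x y -> le y x -> x = y,
      forall x y z, any_monomial x -> any_monomial y -> any_monomial z ->
        le x y -> le y z -> le x z
    & forall x y, any_monomial x -> any_monomial y -> le x y || le y x].

Definition composable (n m : nat) (l : 'I_n) (t : tree Sig 'I_n)
  (s : tree Sig 'I_m) : Prop :=
  exists chi c psi, sh_monomial chi c t /\ sh_monomial psi (chi l) s.

Definition admissible (le : rel any_tree) : Prop :=
  [/\ total_ordering le,
      forall x y, any_monomial x -> any_monomial y ->
        (projT1 x < projT1 y)%N -> le x y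
    & forall n m p (l : 'I_n) (u : 'I_n -> 'I_p) (v : 'I_m -> 'I_p)
        (t t' : tree Sig 'I_n) (s s' : tree Sig 'I_m),
        shuffle_grafting l u v -> composable l t s -> composable l t' s' ->
        le (any t) (any t') -> le (any s) (any s') ->
        le (any (graft l u v t s)) (any (graft l u v t' s'))].

Definition leading_term (le : rel any_tree) (n : nat)
  (f : {freeg (tree Sig 'I_n) / k}) (t : tree Sig 'I_n) : Prop :=
  t \in dom f /\ forall s, s \in dom f -> le (any s) (any t).

Fixpoint branch (n : nat) (s t : tree Sig 'I_n) : bool :=
  (s == t) ||
  (if t is Node _ a b then branch s a || branch s b else false).

(* t is divisible by s: a subtree of t is s with labels replaced by the
   branches b i above its leaves, which are ordered by their smallest leaves *)
Definition divisible (n m : nat) (t : tree Sig 'I_n) (s : tree Sig 'I_m) : Prop :=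
  exists b : 'I_m -> tree Sig 'I_n,
    branch (bind s b) t /\
    forall i j : 'I_m, (i < j)%N -> (smallest_leaf (b i) < smallest_leaf (b j))%N.

Definition groebner_basis (le : rel any_tree) (M G : sh_family) : Prop :=
  (forall n (chi : 'I_n -> I) c f, M n chi c f <-> sh_ideal_gen G chi c f) /\
  (forall n (chi : 'I_n -> I) c f t, M n chi c f -> f != 0 ->
    leading_term le f t ->
    exists m (psi : 'I_m -> I) d g s,
      [/\ G m psi d g, leading_term le g s & divisible t s]).

Definition quadratic (G : sh_family) : Prop :=
  forall n (chi : 'I_n -> I) c g, G n chi c g ->
  forall t, t \in dom g -> nvertices t = 2%N.

End FreeOperad.

Inductive colour := colS | colL.

Definition colour_code (c : colour) : bool := if c is colS then true else false.
Lemma colour_codeK :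
  cancel colour_code (fun b : bool => if b then colS else colL).
Proof. by case. Qed.
HB.instance Definition _ := Choice.copy colour (can_type colour_codeK).

Inductive lr_op := alpha | beta | opd | opm.

Definition lr_code (g : lr_op) : nat :=
  match g with alpha => 0 | beta => 1 | opd => 2 | opm => 3 end.
Lemma lr_codeK :
  pcancel lr_code (fun i => onth [:: alpha; beta; opd; opm] i).
Proof. by case. Qed.
HB.instance Definition _ := Choice.copy lr_op (pcan_type lr_codeK).

Definition lr_src1 (g : lr_op) : colour := if g is beta then colL else colS.
Definition lr_src2 (g : lr_op) : colour := if g is alpha then colS else colL.
Definition lr_tgt (g : lr_op) : colour :=
  match g with alpha | opd => colS | beta | opm => colL end.

Definition lr_sig (s : seq lr_op) : signature colour :=
  @Signature colour lr_op (fun g => g \in s) lr_src1 lr_src2 lr_tgt.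

Section Presentations.
Variable k : fieldType.
Local Notation y1 := (Leaf (@Ordinal 2 0 isT)).
Local Notation y2 := (Leaf (@Ordinal 2 1 isT)).
Local Notation x1 := (Leaf (@Ordinal 3 0 isT)).
Local Notation x2 := (Leaf (@Ordinal 3 1 isT)).
Local Notation x3 := (Leaf (@Ordinal 3 2 isT)).
Local Notation a := (Node alpha).
Local Notation b := (Node beta).
Local Notation d := (Node opd).
Local Notation m := (Node opm).

(* The relation f = 0 between operations with input colours s and output c *)
Definition lr_rel (s : seq colour) (c : colour)
  (f : {freeg (tree lr_op 'I_(size s)) / k}) : relation k colour lr_op :=
  Relation (fun i => nth colS s i) c f.

Local Notation SS := [:: colS; colS].
Local Notation LL := [:: colL; colL].
Local Notation SSS := [:: colS; colS; colS].
Local Notation LLL := [:: colL; colL; colL].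
Local Notation SSL := [:: colS; colS; colL].
Local Notation SLL := [:: colS; colL; colL].

Definition alpha_sym := @lr_rel SS colS (<< a y1 y2 >> - << a y2 y1 >>).
Definition beta_skew := @lr_rel LL colL (<< b y1 y2 >> + << b y2 y1 >>).
Definition alpha_assoc := @lr_rel SSS colS
  (<< a (a x1 x2) x3 >> - << a x1 (a x2 x3) >>).
Definition beta_jacobi := @lr_rel LLL colL
  (<< b (b x1 x2) x3 >> - << b (b x1 x3) x2 >> - << b x1 (b x2 x3) >>).
Definition d_leibniz := @lr_rel SSL colS
  (<< d (a x1 x2) x3 >> - (<< a x1 (d x2 x3) >> + << a (d x1 x3) x2 >>)).
Definition d_action := @lr_rel SLL colS
  (<< d x1 (b x2 x3) >> - (<< d (d x1 x3) x2 >> - << d (d x1 x2) x3 >>)).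
Definition m_module := @lr_rel SSL colL
  (<< m (a x1 x2) x3 >> - << m x1 (m x2 x3) >>).
Definition d_anchor := @lr_rel SSL colS
  (<< d x1 (m x2 x3) >> - << a (d x1 x3) x2 >>).
Definition beta_leibniz := @lr_rel SLL colL
  (<< b x2 (m x1 x3) >> - (<< m x1 (b x2 x3) >> + << m (d x1 x2) x3 >>)).
Definition m_nilpotent := @lr_rel SSL colL << m x1 (m x2 x3) >>.

Definition lr_relations : seq (relation k colour lr_op) :=
  [:: alpha_assoc; beta_jacobi; d_leibniz; d_action; m_module; d_anchor;
      beta_leibniz].

Definition lr_sig_full : signature colour := lr_sig [:: alpha; beta; opd; opm].
Definition lr_rels_full : seq (relation k colour lr_op) :=
  [:: alpha_sym, beta_skew & lr_relations].
Definition LieRinehart : collection k colour :=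
  @presented_operad k colour lr_sig_full lr_rels_full.

Definition dcom_sig : signature colour := lr_sig [:: alpha; opd].
Definition dcom_rels : seq (relation k colour lr_op) :=
  [:: alpha_sym; alpha_assoc; d_leibniz].
Definition DCom : collection k colour :=
  @presented_operad k colour dcom_sig dcom_rels.

(* The component of Lie with output S, spanned by the identity, is dropped in
   DCom1_Lie. *)
Definition lie_sig : signature colour := lr_sig [:: beta].
Definition lie_rels : seq (relation k colour lr_op) := [:: beta_skew; beta_jacobi].
Definition Lie : collection k colour :=
  @presented_operad k colour lie_sig lie_rels.

Definition nm_sig : signature colour := lr_sig [:: opm].
Definition nm_rels : seq (relation k colour lr_op) := [:: m_nilpotent].
Definition Nm : collection k colour := @presented_operad k colour nm_sig nm_rels.

Definition DCom1_Lie : collection k colour :=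
  glue_outputs (fun c => if c is colS then DCom else Lie).

(* The relations lie in the respective free operads, so that there are ideals
   containing them. *)
Section Homogeneity.
Variables (s : seq lr_op) (n : nat) (chi : 'I_n -> colour) (c : colour).
Local Notation hom := (@homogeneous k _ (lr_sig s) 'I_n chi c).

Lemma homD f g : hom f -> hom g -> hom (f + g).
Proof.
move=> /allP hf /allP hg; apply/allP => t /domD_subset.
by rewrite mem_cat => /orP[/hf|/hg].
Qed.

Lemma homB f g : hom f -> hom g -> hom (f - g).
Proof.
move=> /allP hf /allP hg; apply/allP => t /domB.
by rewrite mem_cat => /orP[/hf|/hg].
Qed.

Lemma homU t : @monomial _ (lr_sig s) _ chi c t -> hom << t >>.
Proof. by move=> ht; rewrite /homogeneous domU1 /= ht. Qed.
End Homogeneity.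

Definition rel_hom (Sig : signature colour) (r : relation k colour Sig) : bool :=
  @homogeneous k _ Sig _ (@rel_col _ _ _ r) (rel_out r) (rel_elt r).

Local Ltac hom_tac :=
  rewrite /rel_hom /=;
  repeat first [apply: homB | apply: homD];
  apply: homU; apply/andP; (split; first by []);
  by apply/forallP => -[[|[|[|]]] ?].

Lemma lr_rels_hom r : List.In r lr_rels_full -> @rel_hom lr_sig_full r.
Proof. by do 9![case=> [<-|]; first by hom_tac]. Qed.
Lemma dcom_rels_hom r : List.In r dcom_rels -> @rel_hom dcom_sig r.
Proof. by do 3![case=> [<-|]; first by hom_tac]. Qed.
Lemma lie_rels_hom r : List.In r lie_rels -> @rel_hom lie_sig r.
Proof. by do 2![case=> [<-|]; first by hom_tac]. Qed.
Lemma nm_rels_hom r : List.In r nm_rels -> @rel_hom nm_sig r.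
Proof. by case=> [<-|//]; hom_tac. Qed.

End Presentations.

(* sh_e and sh_n are opd and opm with exchanged arguments. *)
Inductive sh_op := sh_alpha | sh_beta | sh_d | sh_e | sh_m | sh_n.

Definition sh_code (g : sh_op) : nat :=
  match g with
  | sh_alpha => 0 | sh_beta => 1 | sh_d => 2 | sh_e => 3 | sh_m => 4 | sh_n => 5
  end.
Lemma sh_codeK : pcancel sh_code
  (fun i => onth [:: sh_alpha; sh_beta; sh_d; sh_e; sh_m; sh_n] i).
Proof. by case. Qed.
HB.instance Definition _ := Choice.copy sh_op (pcan_type sh_codeK).

Definition sh_src1 (g : sh_op) : colour :=
  match g with sh_alpha | sh_d | sh_m => colS | sh_beta | sh_e | sh_n => colL end.
Definition sh_src2 (g : sh_op) : colour :=
  match g with sh_alpha | sh_e | sh_n => colS | sh_beta | sh_d | sh_m => colL end.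
Definition sh_tgt (g : sh_op) : colour :=
  match g with sh_alpha | sh_d | sh_e => colS | sh_beta | sh_m | sh_n => colL end.

Definition sh_sig : signature colour :=
  @Signature colour sh_op predT sh_src1 sh_src2 sh_tgt.

(* g(a, b) is sh_keep g (a, b), and is sh_swap g (b, a) up to the sign
   of g, which is -1 for g = beta only. *)
Definition sh_keep (g : lr_op) : sh_op :=
  match g with
  | alpha => sh_alpha | beta => sh_beta | opd => sh_d | opm => sh_m
  end.
Definition sh_swap (g : lr_op) : sh_op :=
  match g with
  | alpha => sh_alpha | beta => sh_beta | opd => sh_e | opm => sh_n
  end.

Fixpoint sh_tree (n : nat) (t : tree lr_op 'I_n) : tree sh_op 'I_n :=
  match t with
  | Leaf i => Leaf i
  | Node g a b =>
      if (smallest_leaf a < smallest_leaf b)%N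
      then Node (sh_keep g) (sh_tree a) (sh_tree b)
      else Node (sh_swap g) (sh_tree b) (sh_tree a)
  end.

Section ShuffleLieRinehart.
Variable k : fieldType.

Fixpoint sh_sign (n : nat) (t : tree lr_op 'I_n) : k :=
  match t with
  | Leaf _ => 1
  | Node g a b =>
      (if (g == beta) && ~~ (smallest_leaf a < smallest_leaf b)%N then -1 else 1)
      * sh_sign a * sh_sign b
  end.

Definition to_shuffle (n : nat) (f : {freeg (tree lr_op 'I_n) / k}) :
  {freeg (tree sh_op 'I_n) / k} :=
  fglift (fun t =>
    << sh_sign t *g sh_tree t >> : {freeg (tree sh_op 'I_n) / k}) f.

(* The symmetric group orbits of the relations; the relations alpha_sym and
   beta_skew are accounted for by the choice of the generators. *)
Inductive lr_sh_relations : sh_family k sh_sig :=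
| LrShRelation (r : relation k colour lr_op) (s : {perm 'I_(rel_arity r)}) :
    List.In r (lr_relations k) ->
    lr_sh_relations (fun i => rel_col ((s^-1)%g i)) (rel_out r)
                    (to_shuffle (fgmap (tmap s) (rel_elt r))).

Definition lr_sh_ideal : sh_family k sh_sig := sh_ideal_gen lr_sh_relations.
End ShuffleLieRinehart.

(* Main.v *)
(* Order the shuffle tree monomials by comparing, leaf by leaf, the paths from
   the root to the leaves: first a weight of the path, then the path as a word.
   For this order the relations of two vertices have as leading terms the
   patterns called bad below, and the normal monomials, those avoiding all bad
   patterns, are products (with output S) of generators x with derivations
   d(d(x, l), ...) applied to them, left-normed Lie words (with output L), or
   m(p, w) with p of the first and w of the second kind.

   Since the derivations of a commutative algebra A act as Lie-Rinehart
   algebra over A, operations can be evaluated in A = k[Y(x, w)], where the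
   generator l of colour L acts by Y(x, w) |-> Y(x, l w).  Distinct normal
   monomials have linearly independent values.  Hence no normal monomial is the
   leading term of an element of the ideal, so that its elements with two
   vertices form a Groebner basis.

   Substitution of operations of DCom and Lie into id and m, and of 0 into
   the trees of N_m with at least two vertices, defines a natural map from the
   composition to Lie-Rinehart.  The composition is spanned by the elements
   corresponding to normal monomials, which the map sends to a basis. *)

From HB Require Import structures.
From mathcomp Require Import all_boot all_order all_fingroup all_algebra.
From mathcomp Require Import boolp freeg mpoly zify ring.
Require Import Defs.

Set Implicit Arguments.
Unset Strict Implicit.
Unset Printing Implicit Defensive.

Import Order.TTheory GRing.Theory Num.Theory.
Local Open Scope ring_scope.

(** * Trees labelled by natural numbers *)

(** Confluence of the rewriting rules is never checked: the rules show that normal monomials span,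
    and the polynomial model that they are independent. Pulling a symmetric ideal back along
    [from_sh] gives a shuffle ideal, so that one reduction procedure serves the shuffle ideal of (1)
    and the symmetric presentations of Lie-Rinehart, DCom and Lie in (2).

    Independence with output L is delicate. A Lie word is an operator, so it is seen only through
    its value on an extra variable, and this value is a sum of many words. The word read off a
    normal Lie word begins with its smallest letter and is the only word of the sum that begins with
    this letter; hence the coefficients of these words separate normal monomials.

    Shuffle compositions relabel leaves, which obscures comparisons of monomials. If the leaves are
    labelled by natural numbers from a given increasing list, a composition becomes a substitution
    that changes no label; order, ideals and colourings are therefore transported to such labels. *)

Section TreeTheory.
Variable G : Type.

Lemma eq_in_bind (X : eqType) Y (f g : X -> tree G Y) (t : tree G X) :
  {in leaves t, f =1 g} -> bind t f = bind t g.
Proof.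
elim: t => [x|h a IHa b IHb] /= H; first by apply: H; rewrite inE.
by rewrite IHa ?IHb // => x xt; apply: H; rewrite mem_cat xt ?orbT.
Qed.

Lemma bind_bind X Y Z (f : X -> tree G Y) (g : Y -> tree G Z) (t : tree G X) :
  bind (bind t f) g = bind t (fun x => bind (f x) g).
Proof. by elim: t => //= h a -> b ->. Qed.

Lemma bind_Leaf X (t : tree G X) : bind t (@Leaf G X) = t.
Proof. by elim: t => //= h a -> b ->. Qed.

Lemma leaves_bind X Y (f : X -> tree G Y) (t : tree G X) :
  leaves (bind t f) = flatten [seq leaves (f x) | x <- leaves t].
Proof. by elim: t => [x|h a IHa b IHb] /=; rewrite ?cats0 // map_cat flatten_cat IHa IHb. Qed.

Lemma leaves_tmap' X Y (f : X -> Y) (t : tree G X) :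
  leaves (tmap f t) = map f (leaves t).
Proof. by rewrite leaves_bind; elim: (leaves t) => //= x s ->. Qed.

Lemma eq_in_tmap (X : eqType) Y (f g : X -> Y) (t : tree G X) :
  {in leaves t, f =1 g} -> tmap f t = tmap g t.
Proof. by move=> H; apply: eq_in_bind => x xt; rewrite H. Qed.

Lemma tmap_tmap X Y Z (f : X -> Y) (g : Y -> Z) (t : tree G X) :
  tmap g (tmap f t) = tmap (g \o f) t.
Proof. by rewrite /tmap bind_bind. Qed.

Lemma bind_tmap X Y Z (f : X -> Y) (g : Y -> tree G Z) (t : tree G X) :
  bind (tmap f t) g = bind t (g \o f).
Proof. by rewrite /tmap bind_bind. Qed.

Lemma tmap_bind X Y Z (f : X -> tree G Y) (g : Y -> Z) (t : tree G X) :
  tmap g (bind t f) = bind t (fun x => tmap g (f x)).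
Proof. by rewrite /tmap bind_bind. Qed.

Lemma eq_in_tmap_id (X : eqType) (f : X -> X) (t : tree G X) :
  {in leaves t, f =1 id} -> tmap f t = t.
Proof. by move=> H; rewrite -[RHS]bind_Leaf; apply: eq_in_bind => x /H /= ->. Qed.

Lemma size_leaves X (t : tree G X) : size (leaves t) = (nvertices t).+1.
Proof. by elim: t => //= g a IHa b IHb; rewrite size_cat IHa IHb; lia. Qed.

Lemma nvertices_tmap X Y (f : X -> Y) (t : tree G X) :
  nvertices (tmap f t) = nvertices t.
Proof. by elim: t => //= g a IHa b IHb; rewrite -IHa -IHb. Qed.

Lemma tmap_inj X Y (f : X -> Y) : injective f -> injective (@tmap G X Y f).
Proof.
move=> fi; elim=> [x|g a IHa b IHb] [y|h c d] //= [].
  by move=> /fi ->.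
by move=> -> /IHa -> /IHb ->.
Qed.

Fixpoint minl (t : tree G nat) : nat :=
  match t with Leaf i => i | Node _ a b => minn (minl a) (minl b) end.

Lemma minl_tmap n (t : tree G 'I_n) : minl (tmap val t) = smallest_leaf t.
Proof. by elim: t => //= g a IHa b IHb; rewrite -IHa -IHb. Qed.

Lemma minl_in t : minl t \in leaves t.
Proof.
elim: t => [x|g a IHa b IHb] /=; first by rewrite inE.
by rewrite mem_cat /minn; case: ifP => _; rewrite ?IHa ?IHb ?orbT.
Qed.

Lemma minl_le t x : x \in leaves t -> (minl t <= x)%N.
Proof.
elim: t => [y|g a IHa b IHb] /=; first by rewrite inE => /eqP->.
by rewrite mem_cat => /orP[/IHa|/IHb]; lia.
Qed.

Lemma minl_eq t x : x \in leaves t -> {in leaves t, forall y, (x <= y)%N} -> minl t = x.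
Proof.
by move=> xt H; have := minl_le xt; have := H _ (minl_in t); lia.
Qed.

Lemma minl_mono (f : nat -> nat) t :
  {in leaves t &, {homo f : i j / (i < j)%N}} -> minl (tmap f t) = f (minl t).
Proof.
move=> H; apply: minl_eq; first by rewrite leaves_tmap' map_f ?minl_in.
move=> y; rewrite leaves_tmap' => /mapP[x xt ->].
have := minl_le xt; rewrite leq_eqVlt => /orP[/eqP->//|lt].
by apply/ltnW/H => //; apply: minl_in.
Qed.

Fixpoint shuf (t : tree G nat) : bool :=
  match t with
  | Leaf _ => true
  | Node _ a b => [&& (minl a < minl b)%N, shuf a & shuf b]
  end.

(* Grafting without relabelling: shuffle trees result when a is the smallest leaf of s. *)
Definition gr (a : nat) (t s : tree G nat) : tree G nat :=
  bind t (fun x => if x == a then s else Leaf x).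

Lemma gr_notin a t s : a \notin leaves t -> gr a t s = t.
Proof.
move=> na; rewrite -[RHS]bind_Leaf; apply: eq_in_bind => x xt.
by move=> /=; have [e|//] := eqVneq x a; rewrite -e xt in na.
Qed.

Lemma minl_gr a t s : minl s = a -> minl (gr a t s) = minl t.
Proof.
move=> e; elim: t => [x|g b IHb c IHc] /=; last by rewrite -/(gr a b s) -/(gr a c s) IHb IHc.
by rewrite /gr /=; have [->|_] := eqVneq x a; rewrite /= ?e.
Qed.

Lemma shuf_gr a t s : minl s = a -> shuf t -> shuf s -> shuf (gr a t s).
Proof.
move=> e; elim: t => [x|g b IHb c IHc] /=; first by rewrite /gr /=; case: (x == a).
rewrite -/(gr a b s) -/(gr a c s) !minl_gr // => /and3P[-> /IHb H1 /IHc H2] hs.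
by rewrite H1 // H2.
Qed.

Lemma shuf_tmap (f : nat -> nat) t :
  {in leaves t &, {homo f : i j / (i < j)%N}} -> shuf (tmap f t) = shuf t.
Proof.
elim: t => //= g a IHa b IHb H; rewrite -!/(tmap _ _).
have Ha : {in leaves a &, {homo f : i j / (i < j)%N}}.
  by move=> x y xa ya; apply: H; rewrite mem_cat ?xa ?ya.
have Hb : {in leaves b &, {homo f : i j / (i < j)%N}}.
  by move=> x y xa ya; apply: H; rewrite mem_cat ?xa ?ya ?orbT.
rewrite IHa // IHb // !minl_mono //; congr (_ && _).
have mono x y : x \in leaves a ++ leaves b -> y \in leaves a ++ leaves b ->
  (f x < f y)%N = (x < y)%N.
  move=> xt yt; case: (ltngtP x y) => [|lt|->]; [exact: H| |exact: ltnn].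
  by have := H _ _ yt xt lt; lia.
by apply: mono; rewrite mem_cat minl_in ?orbT.
Qed.

End TreeTheory.

(** * The order of tree monomials *)

Section LeafKeys.
Variable G : Type.
Local Notation letter := (G * bool)%type.

Implicit Types (t s : tree G nat) (i : nat).

(* the edges from the root to the leaf i, false and true being the left and
   right inputs of a vertex *)
Fixpoint path_to (t : tree G nat) (i : nat) : seq letter :=
  match t with
  | Leaf _ => [::]
  | Node g a b => if i \in leaves a then (g, false) :: path_to a i
                  else (g, true) :: path_to b i
  end.

Lemma path_to_gr_notin a t s i :
  i \in leaves t -> i != a -> i \notin leaves s -> path_to (gr a t s) i = path_to t i.
Proof.
move=> it ia nis; elim: t it => [x|g b IHb c IHc].
  by rewrite inE => /eqP<-; rewrite /gr /= (negPf ia).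
rewrite /= -!/(gr _ _ _) mem_cat.
have -> : (i \in leaves (gr a b s)) = (i \in leaves b).
  rewrite leaves_bind; apply/flattenP/idP => [[l /mapP[x xb ->]]|ib].
    by case: (x == a); rewrite ?(negPf nis) //= inE => /eqP->.
  exists [:: i]; last by rewrite inE.
  by apply/mapP; exists i; rewrite ?(negPf ia).
by case: ifP => // ib; [move=> _; rewrite IHb // ib|move=> /= ic; rewrite IHc].
Qed.

Lemma mem_leaves_gr a t s i : a \in leaves t ->
  (i \in leaves (gr a t s)) = (i \in leaves s) || (i \in leaves t) && (i != a).
Proof.
move=> at_; rewrite leaves_bind; apply/flattenP/idP.
  move=> [l /mapP[x xt ->]]; have [_ ->//|xa] := eqVneq x a.
  by rewrite inE => /eqP->; rewrite xt xa orbT.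
case/orP => [is_|/andP[it ia]].
  by exists (leaves s) => //; apply/mapP; exists a; rewrite ?eqxx.
by exists [:: i]; rewrite ?inE //; apply/mapP; exists i; rewrite ?(negPf ia).
Qed.

Lemma path_to_gr_in a t s i :
  a \in leaves t -> uniq (leaves t) -> i \in leaves s ->
  {in leaves t, forall j, j \in leaves s -> j = a} ->
  path_to (gr a t s) i = path_to t a ++ path_to s i.
Proof.
move=> at_ + is_; elim: t at_ => [x|g b IHb c IHc].
  by rewrite inE => /eqP->; rewrite /gr /= eqxx.
rewrite /= -!/(gr _ _ _) mem_cat cat_uniq => /orP[ab|ac] /and3P[ub /hasPn nbc uc] H.
  rewrite mem_leaves_gr // is_ ab IHb // => j jb.
  by apply: H; rewrite mem_cat jb.
have ab : a \notin leaves b by apply: nbc.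
rewrite gr_notin // (negPf ab) IHc // => [|j jc].
  by case: ifP => // ib; move: ab; rewrite -(H _ _ is_) ?ib // mem_cat ib.
by apply: H; rewrite mem_cat jc orbT.
Qed.

Lemma path_to_mono (f : nat -> nat) t i :
  {in i :: leaves t &, injective f} -> path_to (tmap f t) (f i) = path_to t i.
Proof.
elim: t => //= g a IHa b IHb H; rewrite -!/(tmap _ _) leaves_tmap'.
have mem_f : (f i \in map f (leaves a)) = (i \in leaves a).
  apply/mapP/idP => [[j ja e]|ia]; last by exists i.
  by rewrite (H i j) // !inE ?eqxx ?mem_cat ?ja ?orbT.
rewrite mem_f IHa ?IHb // => x y; rewrite !inE => hx hy; apply: H;
  rewrite !inE mem_cat; by [case/orP: hx => ->; rewrite ?orbT|case/orP: hy => ->; rewrite ?orbT].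
Qed.

(** The labels whose paths start with a left edge are those of the left branch. So the leaf sets of
    both branches are recovered from the paths, and then the branches by recursion. *)
Lemma path_to_inj (A : seq nat) t s : uniq (leaves t) -> uniq (leaves s) ->
  leaves t =i A -> leaves s =i A ->
  {in A, path_to t =1 path_to s} -> t = s.
Proof.
have pt g (a b : tree G nat) i : uniq (leaves (Node g a b)) -> i \in leaves b ->
    (i \in leaves a) = false.
  rewrite /= cat_uniq => /and3P[_ /hasPn H _] /H; exact: negPf.
elim: t s A => [x|g a IHa b IHb] [y|h c d] A ut us tA sA H.
- by have := sA y; rewrite -tA !inE eqxx => /esym/eqP->.
- have ic := minl_in c; have := H (minl c).
  by rewrite -sA /= mem_cat ic => /(_ isT).
- have ia := minl_in a; have := H (minl a).
  by rewrite -tA /= mem_cat ia => /(_ isT).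
have gh : g = h.
  have := H (minl a); rewrite -tA /= mem_cat minl_in => /(_ isT).
  by case: ifP => _ [].
have ac : leaves c =i leaves a.
  move=> i; case ia : (i \in leaves a).
    by have := H i; rewrite -tA /= mem_cat ia => /(_ isT); case: ifP.
  apply/negP => ic; have := H i; rewrite -sA /= mem_cat ic ia => /(_ isT).
  by case.
have bd : leaves d =i leaves b.
  move=> i; case ib : (i \in leaves b).
    have := H i; rewrite -tA /= mem_cat ib orbT (pt _ _ _ _ ut ib) => /(_ isT).
    case: ifP => // ic _; have : i \in A by rewrite -tA /= mem_cat ib orbT.
    by rewrite -sA /= mem_cat ic.
  apply/negP => id; have := sA i; rewrite -tA /= !mem_cat id orbT ib orbF => /esym.
  by rewrite -ac (pt _ _ _ _ us id).
move: (ut) (us); rewrite /= !cat_uniq => /and3P[ua _ ub] /and3P[uc _ ud].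
rewrite gh; congr Node.
  apply: (IHa c (leaves a)) => // i ii.
  by have := H i; rewrite -tA /= mem_cat ac ii => /(_ isT) [].
apply: (IHb d (leaves b)) => // i ii.
have := H i; rewrite -tA /= mem_cat ii orbT ac (pt _ _ _ _ ut ii) => /(_ isT).
by case.
Qed.
End LeafKeys.

(** * Lexicographic comparison of keys and its behaviour under grafting *)

Section FirstDifference.
Variables (d : Order.disp_t) (K : orderType d).
Implicit Types (f g : nat -> K) (A : seq nat).

(** For increasing [A] this is the lexicographic comparison of the lists of keys, with labels in
    place of positions: labels do not move when the list is enlarged by grafting. *)
Definition first_diff A f g :=
  exists2 i, i \in A & (f i < g i)%O /\ {in A, forall j, (j < i)%N -> f j = g j}.

Lemma seqlexi_first_diff A f g : sorted ltn A ->
  (([seq f i | i <- A] : seqlexi K) < [seq g i | i <- A])%O <-> first_diff A f g.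
Proof.
elim: A => [|a A IH] /=; first by split=> [|[i]//]; rewrite ltxx.
move=> sA; have sA' := path_sorted sA; rewrite ltxi_cons.
have lta : {in A, forall j, (a < j)%N} by apply/allP/(order_path_min ltn_trans).
split=> [/andP[le H]|[i]].
  case: (Order.TotalTheory.ltgtP (f a) (g a)) le => // [lt|e] _.
    exists a; rewrite ?inE ?eqxx //; split=> // j; rewrite inE => /orP[/eqP->|/lta].
      by rewrite ltnn.
    by move=> h1 h2; lia.
  move: H; rewrite e lexx /= => /(proj1 (IH sA'))[i iA [lt H]].
  exists i; first by rewrite inE iA orbT.
  by split=> // j; rewrite inE => /orP[/eqP->//|jA]; apply: H.
rewrite inE => /orP[/eqP->|iA] [lt H]; first by rewrite (ltW lt) leNgt lt.
have e : f a = g a by apply: H; rewrite ?inE ?eqxx ?lta.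
rewrite e lexx /=; apply/(IH sA'); exists i => //; split=> // j jA.
by apply: H; rewrite inE jA orbT.
Qed.
End FirstDifference.

Section KeysOfCompositions.
Variables (G : Type) (d : Order.disp_t) (K : orderType d).
Variable val : seq (G * bool) -> K.
Hypothesis val_cat : forall p p' q q', val p = val p' -> val q = val q' ->
  val (p ++ q) = val (p' ++ q').
Hypothesis val_catl : forall p p' q, (val p < val p')%O -> (val (p ++ q) < val (p' ++ q))%O.
Hypothesis val_catr : forall p q q', (val q < val q')%O -> (val (p ++ q) < val (p ++ q'))%O.

Variables (A B C : seq nat) (a : nat).
Hypothesis aA : a \in A.
Hypothesis aB : a \in B.
Hypothesis minB : {in B, forall j, (a <= j)%N}.
Hypothesis AB : {in A, forall j, j \in B -> j = a}.
Hypothesis CAB : forall j, (j \in C) = (j \in A) || (j \in B).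

Local Notation key t := (fun i => val (path_to t i)).
Local Notation labels A t := (perm_eq (leaves t) A).
Hypothesis uA : uniq A.

Lemma key_gr (t s : tree G nat) i : labels A t -> labels B s -> i \in C ->
  path_to (gr a t s) i = if i \in B then path_to t a ++ path_to s i else path_to t i.
Proof.
move=> tA sB; rewrite CAB => iAB.
have mt := perm_mem tA; have ms := perm_mem sB.
case: ifP => iB.
  apply: path_to_gr_in; rewrite ?mt ?ms ?(perm_uniq tA) // => j.
  by rewrite mt ms; apply: AB.
have iA : i \in A by rewrite iB orbF in iAB.
apply: path_to_gr_notin; rewrite ?mt ?ms ?iB //.
by apply: contraFneq iB => ->.
Qed.

Lemma eq_key_gr t t' s s' : labels A t -> labels A t' -> labels B s -> labels B s' ->
  {in A, key t =1 key t'} -> {in B, key s =1 key s'} ->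
  {in C, key (gr a t s) =1 key (gr a t' s')}.
Proof.
move=> tA tA' sB sB' Ht Hs i iC; rewrite !key_gr //.
case: ifP => iB; first by apply: val_cat; [apply: Ht|apply: Hs].
by apply: Ht; move: iC; rewrite CAB iB orbF.
Qed.

(** Every grafted label j satisfies a <= j, and its path runs through the place of a in t. So if j
    lies before the first difference i, then so does a, and the keys at j agree. If i itself is a
    label of s then i = a, and [val_catl] applies. *)
Lemma first_diff_grl t t' s : labels A t -> labels A t' -> labels B s ->
  first_diff A (key t) (key t') -> first_diff C (key (gr a t s)) (key (gr a t' s)).
Proof.
move=> tA tA' sB [i iA [lt H]].
have iC : i \in C by rewrite CAB iA.
exists i => //; split=> [|j jC ji]; rewrite !key_gr //.
  by case: ifP => iB //; have ia := AB iA iB; rewrite ia in lt *; apply: val_catl.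
case: ifP => jB; last by apply: H => //; move: jC; rewrite CAB jB orbF.
by apply: val_cat => //; apply: H => //; apply: leq_ltn_trans ji; apply: minB.
Qed.

Lemma first_diff_grr t s s' : labels A t -> labels B s -> labels B s' ->
  first_diff B (key s) (key s') -> first_diff C (key (gr a t s)) (key (gr a t s')).
Proof.
move=> tA sB sB' [i iB [lt H]].
have iC : i \in C by rewrite CAB iB orbT.
exists i => //; split=> [|j jC ji]; rewrite !key_gr //.
  by rewrite iB; apply: val_catr.
by case: ifP => jB //; apply: val_cat => //; apply: H.
Qed.
End KeysOfCompositions.

(* The weights are chosen so that, with ties broken by comparing words, every
   defining relation of Lie-Rinehart algebras has the leading term that is
   absent from the expected normal forms: here the S-inputs of alpha and of m
   count negatively, and the right input of beta counts positively. *)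
Definition weight (l : sh_op * bool) : int :=
  match l with
  | (sh_alpha, _) | (sh_m, false) | (sh_n, true) => -1
  | (sh_beta, true) => 1
  | _ => 0
  end.

(** The priorities of letters of paths. In the defining relations the leading term ties in weight
    only when it is beta(m(x, l), l') with l < l', tied with m(x, beta(l, l')), where n replaces m
    if l < x. For x < l the longer path to x then decides, for l < x the priority of beta over n.
    Digits start at 1, so that words of different lengths have different numbers. *)
Definition digit (l : sh_op * bool) : nat :=
  match l with
  | (sh_beta, b) => 12 - b | (sh_alpha, b) => 10 - b | (sh_d, b) => 8 - b
  | (sh_e, b) => 6 - b | (sh_m, b) => 4 - b | (sh_n, b) => 2 - b
  end.

Fixpoint wsum (p : seq (sh_op * bool)) : int :=
  if p is l :: q then weight l + wsum q else 0.

(* bijective numeration, so that it amounts to the degree lexicographic order *)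
Fixpoint wnum (p : seq (sh_op * bool)) : nat :=
  if p is l :: q then (digit l * 12 ^ size q + wnum q)%N else 0%N.

Lemma wsum_cat p q : wsum (p ++ q) = wsum p + wsum q.
Proof. by elim: p => [|l p IH] /=; rewrite ?add0r // IH addrA. Qed.

Lemma wnum_cat p q : wnum (p ++ q) = (wnum p * 12 ^ size q + wnum q)%N.
Proof. by elim: p => //= l p ->; rewrite size_cat expnD; nia. Qed.

Lemma digit_bounds l : (0 < digit l <= 12)%N.
Proof. by case: l => -[] []. Qed.

Lemma digit_inj : injective digit.
Proof. by case=> -[] [] [[] []]. Qed.

Lemma wnum_bounds p :
  (12 ^ size p <= 11 * wnum p + 1)%N /\ (11 * wnum p + 12 <= 12 * 12 ^ size p)%N.
Proof.
elim: p => //= l p [IH1 IH2]; have /andP[h1 h2] := digit_bounds l.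
by rewrite expnS; split; nia.
Qed.

Lemma size_le_wnum p q : (wnum p <= wnum q)%N -> (size p <= size q)%N.
Proof.
move=> le; rewrite leqNgt; apply/negP => lt.
have [h1 _] := wnum_bounds p; have [_ h2] := wnum_bounds q.
have : (12 ^ (size q).+1 <= 12 ^ size p)%N by rewrite leq_exp2l.
by rewrite expnS; nia.
Qed.

Lemma wnum_inj : injective wnum.
Proof.
move=> p q e.
have es : size p = size q by apply/eqP; rewrite eqn_leq !size_le_wnum ?e.
elim: p q es e => [|l p IH] [|l' q] //= [es] e.
have [_ h1] := wnum_bounds p; have [_ h2] := wnum_bounds q.
have [g1 _] := wnum_bounds p; have [g2 _] := wnum_bounds q.
have el : digit l = digit l'.
  rewrite es in e h1 g1.
  have [lt|lt|//] := ltngtP (digit l) (digit l').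
    have : ((digit l).+1 * 12 ^ size q <= digit l' * 12 ^ size q)%N.
      by rewrite leq_mul2r lt orbT.
    by rewrite mulSn; lia.
  have : ((digit l').+1 * 12 ^ size q <= digit l * 12 ^ size q)%N.
    by rewrite leq_mul2r lt orbT.
  by rewrite mulSn; lia.
rewrite (digit_inj el) (IH q) //.
by move: e; rewrite el es => /addnI.
Qed.

(** The length of a word counts first for the sake of this monotonicity: in the plain lexicographic
    order a word precedes its extensions, and appending letters can reverse such a comparison. *)
Lemma wnum_catl p p' q : (wnum p < wnum p')%N -> (wnum (p ++ q) < wnum (p' ++ q))%N.
Proof. by move=> lt; rewrite !wnum_cat ltn_add2r ltn_mul2r lt expn_gt0. Qed.

Lemma wnum_catr p q q' : (wnum q < wnum q')%N -> (wnum (p ++ q) < wnum (p ++ q'))%N.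
Proof.
move=> lt; rewrite !wnum_cat.
have : (wnum p * 12 ^ size q <= wnum p * 12 ^ size q')%N.
  by rewrite leq_mul2l leq_exp2l // (size_le_wnum (ltnW lt)) orbT.
by lia.
Qed.

Lemma wsum_catl p p' q : wsum p < wsum p' -> wsum (p ++ q) < wsum (p' ++ q).
Proof. by rewrite !wsum_cat ltrD2r. Qed.

Lemma wsum_catr p q q' : wsum q < wsum q' -> wsum (p ++ q) < wsum (p ++ q').
Proof. by rewrite !wsum_cat ltrD2l. Qed.

Section MonomialOrder.
Implicit Types (A : seq nat) (t s : tree sh_op nat).

Definition wkey A t : seqlexi int := [seq wsum (path_to t i) | i <- A].
Definition nkey A t : seqlexi nat := [seq wnum (path_to t i) | i <- A].

(** The weights at all leaves are compared before the words at any leaf. Putting [size A] first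
    makes monomials of smaller arity smaller. *)
Definition tkey A t : (nat *l (seqlexi int *l seqlexi nat))%type :=
  (size A, (wkey A t, nkey A t)).

Definition tlt A t s : bool := (tkey A t < tkey A s)%O.

Lemma tltE A t s :
  tlt A t s = (wkey A t < wkey A s)%O || (wkey A t == wkey A s) && (nkey A t < nkey A s)%O.
Proof.
rewrite /tlt ltxi_pair /= lexx /= ltxi_pair /=.
case: (Order.TotalTheory.ltgtP (wkey A t) (wkey A s)) => //=.
Qed.

Lemma wkeyP A t s : sorted ltn A -> (wkey A t < wkey A s)%O <->
  first_diff A (fun i => wsum (path_to t i)) (fun i => wsum (path_to s i)).
Proof. exact: seqlexi_first_diff. Qed.

Lemma nkeyP A t s : sorted ltn A -> (nkey A t < nkey A s)%O <->
  first_diff A (fun i => wnum (path_to t i)) (fun i => wnum (path_to s i)).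
Proof. exact: seqlexi_first_diff. Qed.

Lemma tlt_irr A t : tlt A t t = false.
Proof. exact: ltxx. Qed.

Lemma tlt_trans A t s r : tlt A t s -> tlt A s r -> tlt A t r.
Proof. exact: lt_trans. Qed.

Lemma eq_map_in (K : eqType) (f g : nat -> K) A :
  [seq f i | i <- A] == [seq g i | i <- A] -> {in A, f =1 g}.
Proof. by move/eqP/eq_in_map. Qed.

Section Composition.
Variables (A B C : seq nat) (a : nat).
Hypotheses (aA : a \in A) (aB : a \in B).
Hypothesis minB : {in B, forall j, (a <= j)%N}.
Hypothesis AB : {in A, forall j, j \in B -> j = a}.
Hypothesis CAB : forall j, (j \in C) = (j \in A) || (j \in B).
Hypotheses (sA : sorted ltn A) (sB : sorted ltn B) (sC : sorted ltn C).

Let uA : uniq A := sorted_uniq ltn_trans ltnn sA.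

Let wsumC p p' q q' : wsum p = wsum p' -> wsum q = wsum q' -> wsum (p ++ q) = wsum (p' ++ q').
Proof. by rewrite !wsum_cat => -> ->. Qed.
Let wnumC p p' q q' : wnum p = wnum p' -> wnum q = wnum q' -> wnum (p ++ q) = wnum (p' ++ q').
Proof. by move=> /wnum_inj-> /wnum_inj->. Qed.

Lemma tlt_grl t t' s :
  perm_eq (leaves t) A -> perm_eq (leaves t') A -> perm_eq (leaves s) B ->
  tlt A t t' -> tlt C (gr a t s) (gr a t' s).
Proof.
move=> tA tA' sB'; rewrite !tltE => /orP[lt|/andP[e lt]]; apply/orP; [left|right].
  apply/(wkeyP _ _ sC).
  apply: (first_diff_grl wsumC wsum_catl aA aB minB AB CAB uA tA tA' sB').
  exact/(wkeyP _ _ sA).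
apply/andP; split.
  apply/eqP/eq_in_map; apply: (eq_key_gr wsumC aA aB AB CAB uA tA tA' sB' sB') => //.
  exact: eq_map_in.
apply/(nkeyP _ _ sC).
apply: (first_diff_grl wnumC wnum_catl aA aB minB AB CAB uA tA tA' sB').
exact/(nkeyP _ _ sA).
Qed.

Lemma tlt_grr t s s' :
  perm_eq (leaves t) A -> perm_eq (leaves s) B -> perm_eq (leaves s') B ->
  tlt B s s' -> tlt C (gr a t s) (gr a t s').
Proof.
move=> tA sB' sB''; rewrite !tltE => /orP[lt|/andP[e lt]]; apply/orP; [left|right].
  apply/(wkeyP _ _ sC).
  apply: (first_diff_grr wsumC wsum_catr aA aB AB CAB uA tA sB' sB'').
  exact/(wkeyP _ _ sB).
apply/andP; split.
  apply/eqP/eq_in_map; apply: (eq_key_gr wsumC aA aB AB CAB uA tA tA sB' sB'') => //.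
  exact: eq_map_in.
apply/(nkeyP _ _ sC).
apply: (first_diff_grr wnumC wnum_catr aA aB AB CAB uA tA sB' sB'').
exact/(nkeyP _ _ sB).
Qed.
End Composition.

Lemma tkey_inj A t s : perm_eq (leaves t) A -> perm_eq (leaves s) A -> uniq A ->
  tkey A t = tkey A s -> t = s.
Proof.
move=> tA sA uA [_ e]; apply: (@path_to_inj _ A).
- by rewrite (perm_uniq tA).
- by rewrite (perm_uniq sA).
- exact: perm_mem.
- exact: perm_mem.
by move=> i iA; apply: wnum_inj; move: i iA; apply/eq_in_map.
Qed.

Lemma tkey_tmap (f : nat -> nat) A t :
  {in leaves t ++ A &, injective f} -> tkey (map f A) (tmap f t) = tkey A t.
Proof.
move=> H.
have P i : i \in A -> path_to (tmap f t) (f i) = path_to t i.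
  move=> iA; apply: path_to_mono; apply: sub_in2 H => x.
  by rewrite inE mem_cat => /orP[/eqP->|->]; rewrite ?iA ?orbT.
rewrite /tkey size_map; congr (_, (_, _)); rewrite /wkey /nkey -map_comp;
  by apply/eq_in_map => i iA /=; rewrite P.
Qed.
End MonomialOrder.

(** * Shuffle monomials and shuffle ideals with leaves labelled by increasing lists *)

Definition shs (sg : pred sh_op) : signature colour :=
  @Signature colour sh_op sg sh_src1 sh_src2 sh_tgt.

Lemma sub_sorted_ltn (A : seq nat) : sorted ltn A -> uniq A.
Proof. exact: (sorted_uniq ltn_trans ltnn). Qed.

Lemma index_mono (A : seq nat) x y : sorted ltn A -> x \in A -> y \in A ->
  (x < y)%N -> (index x A < index y A)%N.
Proof.
move=> sA xA yA lt; rewrite ltnNge leq_eqVlt; apply/negP => /orP[/eqP e|lt'].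
  by have := nth_index 0%N xA; rewrite -e nth_index // => e'; rewrite e' ltnn in lt.
by have := sorted_ltn_index ltn_trans sA y x yA xA lt'; lia.
Qed.

Section Labels.
Variable A : seq nat.

Definition lab (i : 'I_(size A)) : nat := nth 0%N A i.

Lemma lab_in i : lab i \in A.
Proof. exact: mem_nth. Qed.

Lemma lab_inj : uniq A -> injective lab.
Proof. by move=> uA i j /eqP; rewrite nth_uniq // => /eqP /val_inj. Qed.

Lemma lab_ex x : x \in A -> exists i, lab i = x.
Proof.
move=> xA; have lt : (index x A < size A)%N by rewrite index_mem.
by exists (Ordinal lt); apply: nth_index.
Qed.

Lemma lab_mono : sorted ltn A -> {homo lab : i j / (i < j)%N}.
Proof.
move=> sA i j lt; have := sorted_ltn_nth ltn_trans 0%N sA.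
by move/(_ i j (ltn_ord i) (ltn_ord j)); apply.
Qed.

Lemma tree_lab G (t : tree G nat) : {subset leaves t <= A} ->
  exists t' : tree G 'I_(size A), tmap lab t' = t.
Proof.
elim: t => [x|g a IHa b IHb] /= H.
  by have [i <-] := lab_ex (H x (mem_head _ _)); exists (Leaf i).
have [|a' <-] := IHa; first by move=> x xa; apply: H; rewrite mem_cat xa.
have [|b' <-] := IHb; first by move=> x xb; apply: H; rewrite mem_cat xb orbT.
by exists (Node g a' b').
Qed.
End Labels.

Section NatLabels.
Variable sg : pred sh_op.
Implicit Types (t s : tree sh_op nat) (A B C : seq nat) (chi : nat -> colour).

Fixpoint ntyped chi (d : colour) t : bool :=
  match t with
  | Leaf x => chi x == d
  | Node g a b =>
      [&& sg g, sh_tgt g == d, ntyped chi (sh_src1 g) a & ntyped chi (sh_src2 g) b]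
  end.

Definition okm chi c A t := [&& ntyped chi c t, perm_eq (leaves t) A & shuf t].

Lemma typed_lab (X : finType) (f : X -> nat) chi d (t : tree sh_op X) :
  @typed colour (shs sg) X (chi \o f) d t = ntyped chi d (tmap f t).
Proof. by elim: t d => //= g a IHa b IHb d; rewrite IHa IHb. Qed.

Lemma monomial_perm (X : finType) (t : tree sh_op X) (f : X -> nat) A :
  injective f -> uniq A -> (forall y, reflect (exists x, f x = y) (y \in A)) ->
  [forall x, count_mem x (leaves t) == 1%N] = perm_eq (leaves (tmap f t)) A.
Proof.
move=> fi uA fA; rewrite leaves_tmap'.
apply/forallP/idP => [H|p x].
  apply: uniq_perm => //.
    rewrite map_inj_uniq //; apply: count_mem_uniq => x.
    by rewrite -has_pred1 has_count (eqP (H x)).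
  move=> y; apply/mapP/fA => [[x _ ->]|[x <-]]; first by exists x.
  by exists x; rewrite // -has_pred1 has_count (eqP (H x)).
have : uniq (leaves t) by rewrite -(map_inj_uniq fi) (perm_uniq p).
move=> ul; rewrite count_uniq_mem //.
by rewrite -(mem_map fi) (perm_mem p); case: fA => // -[]; exists x.
Qed.

Lemma labP A : uniq A -> forall y, reflect (exists x, @lab A x = y) (y \in A).
Proof.
by move=> uA y; apply: (iffP idP) => [/lab_ex|[x <-]] //; apply: lab_in.
Qed.

Lemma okm_lab chi c A (t : tree sh_op 'I_(size A)) : sorted ltn A ->
  @sh_monomial colour (shs sg) _ (chi \o @lab A) c t = okm chi c A (tmap (@lab A) t).
Proof.
move=> sA; have uA := sub_sorted_ltn sA.
rewrite /sh_monomial /monomial /okm typed_lab -andbA; congr (_ && (_ && _)).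
  exact: monomial_perm (lab_inj uA) uA (labP uA).
have -> : is_shuffle (Sig := shs sg) t = shuf (tmap val t).
  by elim: t => //= g a -> b ->; rewrite -!/(tmap _ _) !minl_tmap.
have -> : tmap (@lab A) t = tmap (nth 0%N A) (tmap val t) by rewrite tmap_tmap.
rewrite shuf_tmap // leaves_tmap' => x y /mapP[i _ ->] /mapP[j _ ->].
exact: (lab_mono sA).
Qed.

Lemma okm_ex chi c A t : sorted ltn A -> okm chi c A t ->
  exists2 t', tmap (@lab A) t' = t & @sh_monomial colour (shs sg) _ (chi \o @lab A) c t'.
Proof.
move=> sA h; have /and3P[_ p _] := h.
have [x|t' e] := @tree_lab A _ t; first by rewrite (perm_mem p).
by exists t' => //; rewrite okm_lab // e.
Qed.

Lemma ntyped_gr chi' chi c t s a : {in leaves t, forall j, j != a -> chi j = chi' j} ->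
  ntyped chi' c t -> ntyped chi (chi' a) s -> ntyped chi c (gr a t s).
Proof.
move=> + + hs; elim: t c => [x|g b IHb d IHd] c H.
  rewrite /gr /=; have [->|xa] := eqVneq x a; first by move=> /eqP <-.
  by rewrite /= H ?inE.
by case/and4P=> h1 h2 /IHb h3 /IHd h4; apply/and4P; split=> //;
  [apply: h3|apply: h4] => j hj; apply: H; rewrite /= mem_cat hj ?orbT.
Qed.
End NatLabels.

Section IdealClosure.
Variables (k : fieldType) (sg : pred sh_op) (F : sh_family k (shs sg)).
Hypothesis idF : sh_ideal F.
Local Notation ftree := {freeg (tree sh_op nat) / k}.
Implicit Types (t s : tree sh_op nat) (A B C : seq nat) (chi : nat -> colour).
Implicit Types (f : ftree).

(* F, with leaves labelled by the increasing list A instead of 0, ..., size A - 1 *)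
Definition Fh chi c A (f : ftree) : Prop :=
  exists2 f' : {freeg (tree sh_op 'I_(size A)) / k},
    fgmap (tmap (@lab A)) f' = f & F (chi \o @lab A) c f'.

Section Grafting.
Variables (A B C : seq nat) (a : nat).
Hypotheses (aA : a \in A) (aB : a \in B).
Hypothesis minB : {in B, forall j, (a <= j)%N}.
Hypothesis AB : {in A, forall j, j \in B -> j = a}.
Hypothesis CAB : forall j, (j \in C) = (j \in A) || (j \in B).
Hypotheses (sA : sorted ltn A) (sB : sorted ltn B) (sC : sorted ltn C).

Variables chi' chi : nat -> colour.
Hypothesis chiA : {in A, forall j, j != a -> chi j = chi' j}.

Let uA := sub_sorted_ltn sA.
Let uB := sub_sorted_ltn sB.
Let uC := sub_sorted_ltn sC.

Let u_lt (i : 'I_(size A)) : (index (lab i) C < size C)%N.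
Proof. by rewrite index_mem CAB lab_in. Qed.
Let v_lt (i : 'I_(size B)) : (index (lab i) C < size C)%N.
Proof. by rewrite index_mem CAB lab_in orbT. Qed.
Let l_lt : (index a A < size A)%N.
Proof. by rewrite index_mem. Qed.

Let u i := Ordinal (u_lt i).
Let v i := Ordinal (v_lt i).
Let l := Ordinal l_lt.

Let lab_u i : lab (u i) = lab i.
Proof. by rewrite /lab /= nth_index // CAB lab_in. Qed.
Let lab_v i : lab (v i) = lab i.
Proof. by rewrite /lab /= nth_index // CAB lab_in orbT. Qed.
Let lab_l : lab l = a.
Proof. exact: nth_index. Qed.

Let lab_eq_l i : (lab i == a) = (i == l).
Proof. by rewrite -lab_l (inj_eq (lab_inj uA)). Qed.

(** [u] and [v] send a label to its rank in [C]. The dummy value [u l] is the rank of a, and a is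
    the smallest label of [B]: this is the last condition of [shuffle_grafting]. *)
Let sgr : shuffle_grafting l u v.
Proof.
split.
- apply/forallP => z; apply/eqP.
  have := lab_in z; rewrite CAB.
  have [zB _|zB /= zA] := boolP (lab z \in B).
    have -> : #|[pred y | v y == z]| = 1%N.
      have [y ey] := lab_ex zB.
      rewrite (@eq_card1 _ y) // => y' /=; rewrite !inE.
      by rewrite -(inj_eq (lab_inj uC)) lab_v -ey (inj_eq (lab_inj uB)).
    rewrite eq_card0 // => x; rewrite !inE; apply/negP => /andP[xl /eqP e].
    have := AB (lab_in x); rewrite -lab_u e zB => /(_ isT)/eqP.
    by rewrite -e lab_u lab_eq_l (negPf xl).
  rewrite orbF in zA.
  have -> : #|[pred y | v y == z]| = 0%N.
    rewrite eq_card0 // => y; rewrite !inE; apply/negP => /eqP e.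
    by rewrite -e lab_v lab_in in zB.
  have [x ex] := lab_ex zA.
  rewrite (@eq_card1 _ x) // => x' /=; rewrite !inE.
  rewrite -(inj_eq (lab_inj uC)) lab_u -ex (inj_eq (lab_inj uA)).
  have [->|_] := eqVneq x' x; rewrite ?andbF // andbT -lab_eq_l.
  by apply: contraNneq zB => e; rewrite -ex e.
- move=> i j lt; apply: index_mono => //; rewrite ?CAB ?lab_in //.
  exact: lab_mono.
- move=> i j lt; apply: index_mono => //; rewrite ?CAB ?lab_in ?orbT //.
  exact: lab_mono.
move=> j j0; apply: (lab_inj uC); rewrite lab_u lab_v lab_l.
have [i ei] := lab_ex aB; have := minB (lab_in j).
rewrite leq_eqVlt => /orP[/eqP->//|]; rewrite -ei => lt.
have [lt'|lt'|/val_inj e] := ltngtP i j; first by rewrite j0 in lt'.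
  by have := lab_mono sB lt'; lia.
by rewrite e ltnn in lt.
Qed.

Let gc : graft_colours (chi' \o @lab A) (chi \o @lab B) (chi \o @lab C) l u v.
Proof.
split=> [x xl|y] /=; rewrite ?lab_u ?lab_v // chiA ?lab_in // lab_eq_l.
exact/eqP.
Qed.

Let lab_graft (t : tree sh_op 'I_(size A)) (s : tree sh_op 'I_(size B)) :
  tmap (@lab C) (graft l u v t s) = gr a (tmap (@lab A) t) (tmap (@lab B) s).
Proof.
rewrite /graft /gr tmap_bind bind_tmap; apply: eq_in_bind => x _ /=.
rewrite lab_eq_l; case: ifP => _ /=; last by rewrite /tmap /= lab_u.
by rewrite tmap_tmap; apply: eq_in_tmap => y _ /=; rewrite lab_v.
Qed.

Lemma Fh_grl c f s : Fh chi' c A f -> okm sg chi (chi' a) B s ->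
  Fh chi c C (fgmap (fun t => gr a t s) f).
Proof.
move=> [f' <- Ff'] /(okm_ex sB)[s' <- oks'].
exists (@graft_lin k colour (shs sg) _ _ _ l u v f' << s' >>).
  move: f' {Ff'}; apply: (freeg_ext (f := fgmap _ \o (fun x => @graft_lin k colour (shs sg) _ _ _ l u v x _))
    (g := fgmap _ \o fgmap _)) => [x f1 f2|x f1 f2|t] /=; rewrite ?/graft_lin.
  - by rewrite fglift_linear fgmap_linear.
  - by rewrite !fgmap_linear.
  by rewrite !liftU !scale1r !fgmapU lab_graft.
apply: (shi_graftl idF sgr gc) => //.
by rewrite /sh_homogeneous domU1 /= andbT lab_l.
Qed.

Lemma Fh_grr c t f : okm sg chi' c A t -> Fh chi (chi' a) B f ->
  Fh chi c C (fgmap (fun s => gr a t s) f).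
Proof.
move=> /(okm_ex sA)[t' <- okt'] [f' <- Ff'].
exists (@graft_lin k colour (shs sg) _ _ _ l u v << t' >> f').
  rewrite /graft_lin liftU scale1r.
  move: f' {Ff'}; apply: (freeg_ext (f := fgmap _ \o fglift _)
    (g := fgmap _ \o fgmap _)) => [x f1 f2|x f1 f2|s] /=.
  - by rewrite fglift_linear fgmap_linear.
  - by rewrite !fgmap_linear.
  by rewrite liftU scale1r !fgmapU lab_graft.
apply: (shi_graftr idF sgr gc); last by rewrite /= lab_l.
by rewrite /sh_homogeneous domU1 /= andbT.
Qed.
End Grafting.
End IdealClosure.

(** * Leading terms and normal monomials *)

Section FreeModule.
Variables (k : fieldType) (T T' : choiceType).

Lemma freegE (f : {freeg T / k}) : f = \sum_(t <- dom f) coeff t f *: << t >>.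
Proof.
rewrite -{1}[f]freeg_sumE; apply: eq_bigr => t _.
by apply/eqP/freeg_eqP => z; rewrite coeffZ !coeffU mul1r.
Qed.

Lemma lin_sum (V W : lmodType k) (h : V -> W) (I : Type) (r : seq I) (F : I -> V) :
  linear h -> h (\sum_(i <- r) F i) = \sum_(i <- r) h (F i).
Proof.
by move=> hl; elim: r => [|i r IH]; rewrite ?big_nil ?(lin0 hl) // !big_cons (linD hl) IH.
Qed.

Lemma coeff_sum (I : Type) (r : seq I) (F : I -> {freeg T / k}) s :
  coeff s (\sum_(i <- r) F i) = \sum_(i <- r) coeff s (F i).
Proof. by elim: r => [|i r IH]; rewrite ?big_nil ?coeff0 // !big_cons coeffD IH. Qed.

Lemma fgliftE (V : lmodType k) (h : T -> V) (f : {freeg T / k}) :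
  fglift h f = \sum_(t <- dom f) coeff t f *: h t.
Proof.
have L := fglift_linear h.
rewrite {1}[f]freegE (lin_sum _ _ L); apply: eq_bigr => t _.
by rewrite (linZ _ _ L) liftU scale1r.
Qed.

End FreeModule.

Section FreeModule2.
Variables (k : fieldType) (T T' : choiceType).

Lemma fgmapE (h : T -> T') (f : {freeg T / k}) :
  fgmap h f = \sum_(t <- dom f) coeff t f *: << h t >>.
Proof. exact: fgliftE. Qed.

Lemma dom_fgmap (h : T -> T') (f : {freeg T / k}) s :
  s \in dom (fgmap h f) -> exists2 t, t \in dom f & s = h t.
Proof.
rewrite fgmapE => /dom_sum_subset /flattenP[l /mapP[t]].
rewrite filter_predT => tf -> hs; exists t => //.
move: hs; rewrite mem_dom coeffZ coeffU.
by have [->//|_] := eqVneq (h t) s; rewrite mulr0 mulr0 eqxx.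
Qed.

Lemma coeff_fgmap (h : T -> T') (f : {freeg T / k}) t :
  {in dom f, forall s, h s = h t -> s = t} -> coeff (h t) (fgmap h f) = coeff t f.
Proof.
move=> H; rewrite fgmapE coeff_sum [in RHS](freegE f) coeff_sum.
apply: eq_big_seq => s sf /=; rewrite !coeffZ !coeffU.
by congr (_ * (_ * (nat_of_bool _)%:R)); apply/eqP/eqP => [/H->//|->].
Qed.

Lemma fgmap_comp (T'' : choiceType) (h : T -> T') (g : T' -> T'') (f : {freeg T / k}) :
  fgmap g (fgmap h f) = fgmap (g \o h) f.
Proof.
move: f; apply: (freeg_ext (f := fgmap g \o fgmap h)) => [a x y|a x y|t] /=.
- by rewrite !fgmap_linear.
- by rewrite fgmap_linear.
by rewrite !fgmapU.
Qed.
End FreeModule2.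

Section SortedLeaves.
Variable G : Type.
Implicit Types t s : tree G nat.

Definition sl t := sort leq (leaves t).

Lemma mem_sl t : sl t =i leaves t.
Proof. exact: mem_sort. Qed.

Lemma sl_sorted t : uniq (leaves t) -> sorted ltn (sl t).
Proof.
by move=> ut; rewrite ltn_sorted_uniq_leq sort_uniq ut sort_sorted //; apply: leq_total.
Qed.

Lemma perm_sl t : perm_eq (leaves t) (sl t).
Proof. by rewrite perm_sym; apply/permPl/perm_sort. Qed.

Lemma sl_perm A t : sorted ltn A -> perm_eq (leaves t) A -> sl t = A.
Proof.
rewrite ltn_sorted_uniq_leq => /andP[_ sA] p.
apply: (sorted_eq leq_trans anti_leq) => //; first by apply: sort_sorted leq_total _.
by rewrite -(permPl (perm_sl t)).
Qed.

Lemma uniq_leaves_gr a t s : uniq (leaves t) -> uniq (leaves s) -> a \in leaves t ->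
  {in leaves t, forall j, j \in leaves s -> j = a} -> uniq (leaves (gr a t s)).
Proof.
move=> + us; elim: t => [x|g b IHb c IHc] /=.
  by rewrite inE => _ /eqP->; rewrite /gr /= eqxx.
rewrite -!/(gr _ _ _) cat_uniq => /and3P[ub nbc uc].
have dis j : j \in leaves b -> j \in leaves c -> False.
  by move=> jb jc; move/hasPn: nbc => /(_ j jc) /=; rewrite jb.
rewrite mem_cat => /orP[ab|ac] H; rewrite cat_uniq.
  have ac : a \notin leaves c by apply/negP => /(dis a ab).
  rewrite IHb ?(gr_notin _ ac) ?uc ?andbT //=; last first.
    by move=> j jb; apply: H; rewrite mem_cat jb.
  apply/hasPn => j jc; rewrite mem_leaves_gr //; apply/negP => /orP[js|/andP[jb _]].
    by move: ac; rewrite -(H j) ?jc // mem_cat jc orbT.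
  exact: dis jb jc.
have ab : a \notin leaves b by apply/negP => /dis/(_ ac).
rewrite IHc ?(gr_notin _ ab) ?ub ?andbT //=; last first.
  by move=> j jc; apply: H; rewrite mem_cat jc orbT.
apply/hasPn => j; rewrite mem_leaves_gr // => /orP[js|/andP[jc _]]; apply/negP => jb.
  by move: ab; rewrite -(H j) ?jb // mem_cat jb.
exact: dis jb jc.
Qed.
End SortedLeaves.

Section LeadingTerms.
Variables (k : fieldType) (sg : pred sh_op) (F : sh_family k (shs sg)).
Hypothesis idF : sh_ideal F.
Implicit Types (t s : tree sh_op nat) (A B C : seq nat) (chi : nat -> colour).
Implicit Types (f : {freeg (tree sh_op nat) / k}).

Definition wf chi c t := [&& ntyped sg chi c t, uniq (leaves t) & shuf t].

Lemma wf_okm chi c t : wf chi c t -> okm sg chi c (sl t) t.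
Proof. by case/and3P=> h _ hs; rewrite /okm h perm_sl. Qed.

Lemma okm_wf chi c A t : sorted ltn A -> okm sg chi c A t -> wf chi c t.
Proof.
by move=> sA /and3P[h p hs]; rewrite /wf h hs (perm_uniq p) (sub_sorted_ltn sA).
Qed.

Lemma Fh_okm chi c A f s : sorted ltn A -> Fh F chi c A f -> s \in dom f ->
  okm sg chi c A s.
Proof.
move=> sA [f' <- Ff'] /dom_fgmap[s' sf' ->]; rewrite -okm_lab //.
exact: (allP (shi_hom idF Ff')).
Qed.

(* t is a leading term of F *)
Definition Lead chi c t := exists f,
  [/\ Fh F chi c (sl t) f, coeff t f != 0 &
      forall s, s \in dom f -> s != t -> tlt (sl t) s t].

Section Grafting.
Variables (chi' chi : nat -> colour) (c : colour) (t s : tree sh_op nat).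
Local Notation a := (minl s).
Hypothesis wt : wf chi' c t.
Hypothesis ws : wf chi (chi' a) s.
Hypothesis at_ : a \in leaves t.
Hypothesis dis : {in leaves t, forall j, j \in leaves s -> j = a}.
Hypothesis chiE : {in leaves t, forall j, j != a -> chi j = chi' j}.

Let ut : uniq (leaves t). Proof. by case/and3P: wt. Qed.
Let us : uniq (leaves s). Proof. by case/and3P: ws. Qed.
Let aA : a \in sl t. Proof. by rewrite mem_sl. Qed.
Let aB : a \in sl s. Proof. by rewrite mem_sl minl_in. Qed.
Let minB : {in sl s, forall j, (a <= j)%N}.
Proof. by move=> j; rewrite mem_sl; apply: minl_le. Qed.
Let AB : {in sl t, forall j, j \in sl s -> j = a}.
Proof. by move=> j; rewrite !mem_sl; apply: dis. Qed.
Let CAB j : (j \in sl (gr a t s)) = (j \in sl t) || (j \in sl s).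
Proof.
rewrite !mem_sl mem_leaves_gr // orbC.
have [->|_] := eqVneq j a; last by rewrite andbT.
by rewrite minl_in !orbT.
Qed.
Let sA : sorted ltn (sl t). Proof. exact: sl_sorted. Qed.
Let sB : sorted ltn (sl s). Proof. exact: sl_sorted. Qed.
Let ug : uniq (leaves (gr a t s)). Proof. exact: uniq_leaves_gr. Qed.
Let sC : sorted ltn (sl (gr a t s)). Proof. exact: sl_sorted. Qed.
Let chiA : {in sl t, forall j, j != a -> chi j = chi' j}.
Proof. by move=> j; rewrite mem_sl; apply: chiE. Qed.

Lemma wf_gr : wf chi c (gr a t s).
Proof.
case/and3P: (wt) (ws) => ht _ st /and3P[hs _ ss].
by rewrite /wf ug (ntyped_gr chiE ht hs) shuf_gr.
Qed.

(** The monomials of f below t stay below after grafting s. In particular none of them collides with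
    the graft of t, so its coefficient survives. The label [minl s] has the output colour of s in
    [chi'], and the colour of the smallest leaf of s in [chi]. *)
Lemma Lead_grl : Lead chi' c t -> Lead chi c (gr a t s).
Proof.
case=> f [Ff cf lf]; have H := Fh_okm sA Ff.
have tlt_gr t' : t' \in dom f -> t' != t -> tlt (sl (gr a t s)) (gr a t' s) (gr a t s).
  move=> tf' ne; apply: (tlt_grl aA aB minB AB CAB sA sC _ _ _ (lf _ tf' ne)).
  - by case/and3P: (H _ tf').
  - exact: perm_sl.
  exact: perm_sl.
exists (fgmap (fun t => gr a t s) f); split.
- exact: (Fh_grl idF aA aB minB AB CAB sA sB sC chiA Ff (wf_okm ws)).
- rewrite (coeff_fgmap (h := fun t => gr a t s)) // => t' tf' e; apply/eqP/negP => /negP ne.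
  by have := tlt_gr _ tf' ne; rewrite e tlt_irr.
move=> r /dom_fgmap[t' tf' ->] ne; apply: tlt_gr => //.
by apply: contraNneq ne => ->.
Qed.

Lemma Lead_grr : Lead chi (chi' a) s -> Lead chi c (gr a t s).
Proof.
case=> f [Ff cf lf]; have H := Fh_okm sB Ff.
have tlt_gr s' : s' \in dom f -> s' != s -> tlt (sl (gr a t s)) (gr a t s') (gr a t s).
  move=> sf' ne; apply: (tlt_grr aA aB AB CAB sA sB sC _ _ _ (lf _ sf' ne)).
  - exact: perm_sl.
  - by case/and3P: (H _ sf').
  exact: perm_sl.
exists (fgmap (fun s => gr a t s) f); split.
- exact: (Fh_grr idF aA aB minB AB CAB sA sB sC chiA (wf_okm wt) Ff).
- rewrite (coeff_fgmap (h := fun s => gr a t s)) // => s' sf' e; apply/eqP/negP => /negP ne.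
  by have := tlt_gr _ sf' ne; rewrite e tlt_irr.
move=> r /dom_fgmap[s' sf' ->] ne; apply: tlt_gr => //.
by apply: contraNneq ne => ->.
Qed.
End Grafting.
End LeadingTerms.

(* [lt] tells how the second leaf of the lower vertex compares with the leaf of
   the upper one. *)
Definition bad_left (g h : sh_op) (lt : bool) : bool :=
  match g, h with
  | sh_alpha, sh_alpha => ~~ lt
  | sh_d, sh_alpha | sh_e, (sh_beta | sh_m | sh_n)
  | sh_n, (sh_m | sh_n) | sh_beta, (sh_m | sh_n) => true
  | _, _ => false
  end.

Definition bad_right (g h : sh_op) : bool :=
  match g, h with
  | sh_alpha, sh_alpha | sh_beta, (sh_beta | sh_m | sh_n)
  | sh_d, (sh_beta | sh_m | sh_n) | sh_e, sh_alpha | sh_m, (sh_m | sh_n) => true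
  | _, _ => false
  end.

Definition bad (t : tree sh_op nat) : bool :=
  if t is Node g a b then
    (if a is Node h _ y then bad_left g h (minl y < minl b)%N else false)
    || (if b is Node h _ _ then bad_right g h else false)
  else false.

Fixpoint normal (t : tree sh_op nat) : bool :=
  ~~ bad t && (if t is Node _ a b then normal a && normal b else true).

Lemma mono3 (f : nat -> nat) : (f 0 < f 1 -> f 1 < f 2 ->
  forall i j : 'I_3, i < j -> f i < f j)%N.
Proof.
move=> h1 h2 i j lt; have := ltn_ord j; move: (i : nat) (j : nat) lt => p q lt q3.
have [e|[e|[e e']]] : (p = 0 /\ q = 1 \/ p = 0 /\ q = 2 \/ p = 1 /\ q = 2)%N by lia.
- by case: e => -> ->.
- by case: e => -> ->; apply: ltn_trans h2.
by rewrite e e'.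
Qed.

(** * Bad patterns and leading terms of nonnormal monomials *)

Section Split.
Variables (X : Type) (r : X -> nat).
Local Notation min t := (minl (tmap r t)).

(** The root and its offending child form a pattern with three leaves, numbered by the smallest
    labels of the branches above them. If the child is on the left, its second branch may come
    before or after the right branch of the root; this is the bit that [bad_left] sees. *)
Lemma bad_split (u : tree sh_op X) :
  bad (tmap r u) -> shuf (tmap r u) -> uniq (leaves (tmap r u)) ->
  exists (P : tree sh_op 'I_3) (b : 'I_3 -> tree sh_op X),
  [/\ u = bind P b, forall i j : 'I_3, (i < j)%N -> (min (b i) < min (b j))%N,
      bad (tmap val P), shuf (tmap val P) /\ perm_eq (leaves (tmap val P)) (iota 0 3)
    & forall sg chi c, ntyped sg chi c (tmap r u) ->
      exists psi, @typed colour (shs sg) _ psi c P /\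
        forall i, ntyped sg chi (psi i) (tmap r (b i))].
Proof.
pose o i (h : (i < 3)%N) : tree sh_op 'I_3 := Leaf (Ordinal h).
case: u => [//|g a b] /=; rewrite -!/(tmap _ _) => /orP[].
  case: a => [//|h x y] /=; rewrite -!/(tmap _ _) => B.
  case/and3P=> lt /and3P[lxy sx sy] sb; rewrite !cat_uniq => /and3P[_ dis _].
  have ne : min y != min b.
    apply: contraNneq dis => e; apply/hasP; exists (min b); first exact: minl_in.
    by rewrite /= mem_cat -e minl_in orbT.
  have [lyb|lby|e] := ltngtP (min y) (min b); last by rewrite e eqxx in ne.
    exists (Node g (Node h (@o 0 isT) (@o 1 isT)) (@o 2 isT)).
    exists (fun i => nth x [:: x; y; b] i); split=> //.
    - by apply: (mono3 (f := fun i => min (nth x [:: x; y; b] i))) => /=; lia.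
    - by move: B; rewrite /= lyb => ->.
    move=> sg chi c /and4P[h1 h2 /and4P[h3 h4 h5 h6] h7].
    exists (fun i : 'I_3 => nth colS [:: sh_src1 h; sh_src2 h; sh_src2 g] i).
    by split; rewrite /= ?h1 ?h2 ?h3 ?h4 ?eqxx //= => -[[|[|[|]]] ?].
  exists (Node g (Node h (@o 0 isT) (@o 2 isT)) (@o 1 isT)).
  exists (fun i => nth x [:: x; b; y] i); split=> //.
  - by apply: (mono3 (f := fun i => min (nth x [:: x; b; y] i))) => /=; lia.
  - by move: B; rewrite /= ltnNge (ltnW lby) => ->.
  move=> sg chi c /and4P[h1 h2 /and4P[h3 h4 h5 h6] h7].
  exists (fun i : 'I_3 => nth colS [:: sh_src1 h; sh_src2 g; sh_src2 h] i).
  by split; rewrite /= ?h1 ?h2 ?h3 ?h4 ?eqxx //= => -[[|[|[|]]] ?].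
case: b => [//|h y z] /=; rewrite -!/(tmap _ _) => B.
case/and3P=> lt sa /and3P[lyz sy sz] _.
exists (Node g (@o 0 isT) (Node h (@o 1 isT) (@o 2 isT))).
exists (fun i => nth a [:: a; y; z] i); split=> //.
- by apply: (mono3 (f := fun i => min (nth a [:: a; y; z] i))) => /=; lia.
move=> sg chi c /and4P[h1 h2 h7 /and4P[h3 h4 h5 h6]].
exists (fun i : 'I_3 => nth colS [:: sh_src1 g; sh_src1 h; sh_src2 h] i).
by split; rewrite /= ?h1 ?h2 ?h3 ?h4 ?eqxx //= => -[[|[|[|]]] ?].
Qed.
End Split.

Lemma eq_in_ntyped sg chi chi' c t : {in leaves t, chi =1 chi'} ->
  ntyped sg chi c t = ntyped sg chi' c t.
Proof.
elim: t c => [x|g a IHa b IHb] c H /=; first by rewrite H ?inE.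
by rewrite IHa ?IHb // => x hx; apply: H; rewrite mem_cat hx ?orbT.
Qed.

Section Rewriting.
Variables (k : fieldType) (sg : pred sh_op) (F : sh_family k (shs sg)).
Hypothesis idF : sh_ideal F.
Implicit Types (t s : tree sh_op nat) (A B C : seq nat) (chi : nat -> colour).

(** The set [sg] of generators is left open because the same reduction is applied to Lie-Rinehart,
    to DCom and to Lie. *)
Definition has_rules := forall (psi : 'I_3 -> colour) c (P : tree sh_op 'I_3),
  @sh_monomial colour (shs sg) 3 psi c P -> bad (tmap val P) ->
  exists f, [/\ F psi c f, coeff P f != 0
    & forall s : tree sh_op 'I_3, s \in dom f -> s != P ->
        tlt (iota 0 3) (tmap val s) (tmap val P)].

Hypothesis rules : has_rules.

Lemma wf_Node chi c g a b : wf sg chi c (Node g a b) =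
  [&& sg g, sh_tgt g == c, wf sg chi (sh_src1 g) a, wf sg chi (sh_src2 g) b,
      ~~ has (mem (leaves a)) (leaves b) & (minl a < minl b)%N].
Proof.
rewrite /wf /= cat_uniq; apply/idP/idP.
  by case/and3P=> /and4P[-> -> -> ->] /and3P[-> -> ->] /and3P[-> -> ->].
case/and5P=> -> -> /and3P[-> -> ->] /and3P[-> -> ->] /andP[-> ->] //.
Qed.

Section Node.
Variables (chi : nat -> colour) (c : colour) (g : sh_op) (a b : tree sh_op nat).
Hypothesis w : wf sg chi c (Node g a b).
Let x := minl a.
Let y := minl b.
(** The node is built from the corolla [t0] on the smallest labels x and y by grafting a at x and
    then b at y. In [chi2] and [chi1] those of the labels x, y at which nothing has been grafted yet
    have the colours of the inner edges. *)
Let chi1 j := if j == y then sh_src2 g else chi j.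
Let chi2 j := if j == x then sh_src1 g else chi1 j.
Let t0 := Node g (Leaf x) (Leaf y).

Let lt : (x < y)%N.
Proof. by move: w; rewrite wf_Node => /and5P[_ _ _ _ /andP[]]. Qed.
Let ltF : (x == y) = false. Proof. by rewrite ltn_eqF. Qed.
Let dis j : j \in leaves a -> j \in leaves b -> False.
Proof.
move=> ja jb; move: w; rewrite wf_Node => /and5P[_ _ _ _ /andP[/hasPn/(_ j jb)]].
by rewrite /= ja.
Qed.
Let wa : wf sg chi (sh_src1 g) a.
Proof. by move: w; rewrite wf_Node => /and5P[]. Qed.
Let wb : wf sg chi (sh_src2 g) b.
Proof. by move: w; rewrite wf_Node => /and5P[_ _ _ ? _]. Qed.

Let w0 : wf sg chi2 c t0.
Proof.
move: w; rewrite !wf_Node => /and5P[-> -> _ _ _].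
rewrite /wf /= -/x -/y lt /chi2 /chi1 !eqxx ![y == x]eq_sym ltF !eqxx /= !inE.
by rewrite ?[y == x]eq_sym ltF.
Qed.

Let wa1 : wf sg chi1 (chi2 x) a.
Proof.
rewrite /chi2 eqxx; move: wa; rewrite /wf (@eq_in_ntyped _ chi1 chi) //.
move=> j ja; rewrite /chi1; case: eqP => // e.
by case: (dis ja); rewrite e minl_in.
Qed.

Let x_t0 : x \in leaves t0. Proof. by rewrite !inE eqxx. Qed.
Let d1 : {in leaves t0, forall j, j \in leaves a -> j = x}.
Proof.
move=> j; rewrite !inE => /orP[/eqP->//|/eqP-> ya].
by case: (dis ya); apply: minl_in.
Qed.
Let c1 : {in leaves t0, forall j, j != x -> chi1 j = chi2 j}.
Proof. by move=> j _ /negPf ne; rewrite /chi2 ne. Qed.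

Let t1 := gr x t0 a.
Let t1E : t1 = Node g a (Leaf y).
Proof. by rewrite /t1 /gr /= eqxx eq_sym ltF. Qed.
Let w1 : wf sg chi1 c t1. Proof. exact: wf_gr w0 wa1 x_t0 d1 c1. Qed.

Let wb1 : wf sg chi (chi1 y) b. Proof. by rewrite /chi1 eqxx. Qed.
Let y_t1 : y \in leaves t1. Proof. by rewrite t1E /= mem_cat inE eqxx orbT. Qed.
Let d2 : {in leaves t1, forall j, j \in leaves b -> j = y}.
Proof.
move=> j; rewrite t1E /= mem_cat inE => /orP[ja jb|/eqP->//].
by case: (dis ja jb).
Qed.
Let c2 : {in leaves t1, forall j, j != y -> chi j = chi1 j}.
Proof. by move=> j _ /negPf ne; rewrite /chi1 ne. Qed.
Let t2E : Node g a b = gr y t1 b.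
Proof.
rewrite t1E /gr /= eqxx -/(gr y a b) gr_notin //.
by apply/negP => ya; apply: (dis ya); apply: minl_in.
Qed.

Lemma Lead_Node_left : Lead F chi (sh_src1 g) a -> Lead F chi c (Node g a b).
Proof.
move=> La; rewrite t2E; apply: (Lead_grl idF w1 wb1 y_t1 d2 c2).
apply: (Lead_grr idF w0 wa1 x_t0 d1 c1); rewrite /chi2 eqxx.
case: La => f [[f' e Ff'] cf lf]; exists f; split=> //; exists f' => //.
suff -> : chi1 \o @lab (sl a) = chi \o @lab (sl a) by [].
apply: funext => i /=; rewrite /chi1; case: eqP => // e'.
have : lab i \in leaves a by rewrite -mem_sl lab_in.
by rewrite e' => ya; case: (dis ya); apply: minl_in.
Qed.

Lemma Lead_Node_right : Lead F chi (sh_src2 g) b -> Lead F chi c (Node g a b).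
Proof.
move=> Lb; rewrite t2E; apply: (Lead_grr idF w1 wb1 y_t1 d2 c2).
by rewrite /chi1 eqxx.
Qed.
End Node.
End Rewriting.

Lemma uniq_flatten_disjoint (I T : eqType) (f : I -> seq T) (s : seq I) i i' j :
  uniq (flatten (map f s)) -> i \in s -> i' \in s -> j \in f i -> j \in f i' -> i = i'.
Proof.
elim: s => //= a s IH; rewrite cat_uniq => /and3P[_ /hasPn dis us].
have D h x : h \in s -> x \in f h -> x \in f a -> False.
  move=> hs xh xa; have /dis : x \in flatten (map f s).
    by apply/flattenP; exists (f h) => //; apply: map_f.
  by rewrite /= xa.
rewrite !inE => /orP[/eqP->|is_] /orP[/eqP->|is'] // ji ji'.
- by case: (D i' j).
- by case: (D i j).
exact: IH.
Qed.

Lemma uniq_flatten_uniq (I T : eqType) (f : I -> seq T) (s : seq I) i :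
  uniq (flatten (map f s)) -> i \in s -> uniq (f i).
Proof.
elim: s => //= a s IH; rewrite cat_uniq inE => /and3P[ua _ us] /orP[/eqP->//|].
exact: IH.
Qed.

Section Patterns.
Variables (k : fieldType) (sg : pred sh_op) (F : sh_family k (shs sg)).
Hypothesis idF : sh_ideal F.
Hypothesis rules : has_rules F.
Variables (chi : nat -> colour) (psi : 'I_3 -> colour) (c : colour).
Variables (P : tree sh_op 'I_3) (b : 'I_3 -> tree sh_op nat).
Local Notation x i := (minl (b i)).
Hypothesis w : wf sg chi c (bind P b).
Hypothesis incr : forall i j : 'I_3, (i < j)%N -> (x i < x j)%N.
Hypothesis badP : bad (tmap val P).
Hypothesis shufP : shuf (tmap val P).
Hypothesis permP : perm_eq (leaves (tmap val P)) (iota 0 3).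
Hypothesis typP : @typed colour (shs sg) _ psi c P.
Hypothesis typb : forall i, ntyped sg chi (psi i) (b i).

Let inP i : i \in leaves P.
Proof.
by rewrite -(mem_map val_inj) -leaves_tmap' (perm_mem permP) mem_iota ltn_ord.
Qed.

Let ub : uniq (flatten [seq leaves (b i) | i <- leaves P]).
Proof. by rewrite -leaves_bind; case/and3P: w. Qed.

Let dis i i' j : j \in leaves (b i) -> j \in leaves (b i') -> i = i'.
Proof. exact: uniq_flatten_disjoint ub (inP i) (inP i'). Qed.

Let x_inj : injective (fun i => x i).
Proof.
by move=> i j e; apply: (@dis i j (x i)); rewrite ?minl_in // e minl_in.
Qed.

Let shb i : shuf (b i).
Proof.
case/and3P: w => _ _; have := inP i; elim: P => [j|g a IHa d IHd] /=.
  by rewrite inE => /eqP->.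
by rewrite mem_cat => /orP[/IHa H|/IHd H] /and3P[_ sa sd]; apply: H.
Qed.

(** At stage n the branches [b i] with i < n have been grafted; the remaining labels [x i] still
    stand for inner edges and have the colours [psi i]. *)
Let chin (n : nat) j :=
  if [pick i : 'I_3 | (n <= i)%N && (x i == j)] is Some i then psi i else chi j.
Let g (n : nat) (i : 'I_3) := if (i < n)%N then b i else Leaf (x i).
Let t n := bind P (g n).

Let chin_x n (i : 'I_3) : (n <= i)%N -> chin n (x i) = psi i.
Proof.
move=> le; rewrite /chin; case: pickP => [j /andP[_ /eqP/x_inj->//]|/(_ i)].
by rewrite le eqxx.
Qed.

Let mem_t n j : (j \in leaves (t n)) =
  [exists i : 'I_3, j \in leaves (g n i)].
Proof.
rewrite leaves_bind; apply/flattenP/existsP => [[l /mapP[i _ ->] h]|[i h]].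
  by exists i.
by exists (leaves (g n i)) => //; apply: map_f.
Qed.

Let tS (n : 'I_3) : t n.+1 = gr (x n) (t n) (b n).
Proof.
rewrite /t /gr bind_bind; apply: eq_in_bind => i _; rewrite -/(gr _ _ _) /g ltnS.
have [lt|lt|/val_inj ->] := ltngtP i n; last by rewrite /gr /= eqxx.
  rewrite gr_notin //; apply/negP => h; move: lt.
  by rewrite (dis h (minl_in (b n))) ltnn.
rewrite /gr /=; case: eqP => // /x_inj e; by rewrite e ltnn in lt.
Qed.

Let wb (n : 'I_3) : wf sg (chin n.+1) (chin n (x n)) (b n).
Proof.
rewrite chin_x // /wf shb (uniq_flatten_uniq ub (inP n)) !andbT.
rewrite (@eq_in_ntyped _ _ chi) // => j jn; rewrite /chin.
case: pickP => // i /andP[lt /eqP e]; move: lt.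
by rewrite (@dis i n j) ?ltnn // -e minl_in.
Qed.

Let xt (n : 'I_3) : x n \in leaves (t n).
Proof. by rewrite mem_t; apply/existsP; exists n; rewrite /g ltnn inE. Qed.

Let dis_t (n : 'I_3) : {in leaves (t n), forall j, j \in leaves (b n) -> j = x n}.
Proof.
move=> j; rewrite mem_t => /existsP[i]; rewrite /g; case: ifP => [lt h1 h2|_].
  by rewrite (dis h1 h2) ltnn in lt.
by rewrite inE => /eqP-> /(dis (minl_in _)) ->.
Qed.

Let chinE (n : 'I_3) : {in leaves (t n), forall j, j != x n -> chin n.+1 j = chin n j}.
Proof.
move=> j _ ne; rewrite /chin; congr (if _ is Some i then psi i else _).
apply: eq_pick => i; rewrite [(n <= i)%N]leq_eqVlt.
have [e|] := eqVneq (n : nat) i; last by [].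
by rewrite -(val_inj e) ltnn eq_sym (negPf ne).
Qed.

Let x3 := [:: x (inord 0); x (inord 1); x (inord 2)].

Let nth_x (i : 'I_3) : nth 0%N x3 i = x i.
Proof.
by rewrite -[i in RHS]inord_val; case: i => -[|[|[|m]]] lt.
Qed.

Let sorted_x3 : sorted ltn x3.
Proof. by rewrite /= !incr // !inordK. Qed.

Let t0E : t 0 = tmap (nth 0%N x3) (tmap val P).
Proof. by rewrite tmap_tmap; apply: eq_in_bind => i _; rewrite /g /= nth_x. Qed.

(** The rule for [P] has the labels 0, 1, 2. Transporting it along the increasing map to the
    smallest labels of the branches leaves all paths, and hence all keys, unchanged. *)
Let w0 : wf sg (chin 0) c (t 0) /\ Lead F (chin 0) c (t 0).
Proof.
have uP : perm_eq (leaves (t 0)) x3.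
  by rewrite t0E leaves_tmap' (perm_map _ permP).
have slt : sl (t 0) = x3 by apply: sl_perm.
have chi3 : chin 0 \o @lab x3 = psi.
  by apply: funext => i /=; rewrite /lab nth_x chin_x.
have tE : tmap (@lab x3) P = t 0 by rewrite t0E tmap_tmap.
have mP : @sh_monomial colour (shs sg) 3 psi c P.
  rewrite -chi3; have -> := @okm_lab sg (chin 0) c x3 P sorted_x3.
  rewrite tE /okm uP t0E shuf_tmap ?shufP ?andbT; last first.
    move=> i j; rewrite !(perm_mem permP) !mem_iota /= add0n => hi hj lt.
    by rewrite (nth_x (Ordinal hi)) (nth_x (Ordinal hj)) incr.
  by rewrite -t0E -tE -typed_lab chi3.
have ww : wf sg (chin 0) c (t 0).
  apply: (okm_wf sorted_x3); rewrite -tE; have <- := @okm_lab sg (chin 0) c x3 P sorted_x3.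
  by rewrite chi3.
split=> //; have [f [Ff cf lf]] := rules mP badP.
have xi : injective (@lab x3) := lab_inj (sub_sorted_ltn sorted_x3).
exists (fgmap (tmap (@lab x3)) f); split.
- by rewrite slt; exists f => //; rewrite chi3.
- by rewrite -tE coeff_fgmap // => s _ /(tmap_inj xi).
move=> s /dom_fgmap[s' sf ->]; rewrite -tE (inj_eq (tmap_inj xi)) => ne.
rewrite tE slt; have := lf _ sf ne; rewrite /tlt t0E.
have -> : tmap (@lab x3) s' = tmap (nth 0%N x3) (tmap val s') by rewrite tmap_tmap.
have e3 r : tkey x3 r = tkey (map (nth 0%N x3) (iota 0 3)) r by [].
rewrite !e3.
have inj3 (s1 : tree sh_op 'I_3) :
    {in leaves (tmap val s1) ++ iota 0 3 &, injective (nth 0%N x3)}.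
  have lt3 i : i \in leaves (tmap val s1) ++ iota 0 3 -> (i < 3)%N.
    rewrite mem_cat mem_iota leaves_tmap' => /orP[/mapP[j _ ->]|//].
    exact: ltn_ord.
  move=> i j /lt3 hi /lt3 hj /eqP.
  by rewrite nth_uniq ?(sub_sorted_ltn sorted_x3) // => /eqP.
by rewrite !tkey_tmap.
Qed.

Lemma Lead_pattern : Lead F chi c (bind P b).
Proof.
have H n : (n <= 3)%N -> wf sg (chin n) c (t n) /\ Lead F (chin n) c (t n).
  elim: n => [|n IH] n3; first exact: w0.
  have [wn Ln] := IH (ltnW n3); pose m := Ordinal n3.
  rewrite (tS m); split.
    exact: wf_gr wn (wb m) (xt m) (@dis_t m) (@chinE m).
  exact: (Lead_grl idF wn (wb m) (xt m) (@dis_t m) (@chinE m) Ln).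
have [_] := H 3 isT.
have -> : t 3 = bind P b by apply: eq_in_bind => i _; rewrite /g ltn_ord.
suff -> : chin 3 = chi by [].
apply: funext => j; rewrite /chin; case: pickP => // i /andP[].
by rewrite leqNgt ltn_ord.
Qed.
End Patterns.

Section NonNormal.
Variables (k : fieldType) (sg : pred sh_op) (F : sh_family k (shs sg)).
Hypothesis idF : sh_ideal F.
Hypothesis rules : has_rules F.

Lemma Lead_nonnormal chi c (t : tree sh_op nat) :
  wf sg chi c t -> ~~ normal t -> Lead F chi c t.
Proof.
elim: t c => [x|g a IHa b IHb] c w //.
have [B _|nB] := boolP (bad (Node g a b)).
  have tid (s : tree sh_op nat) : tmap id s = s by apply: eq_in_tmap_id.
  have /and3P[ty un sh] := w.
  have := @bad_split _ id (Node g a b); rewrite tid => /(_ B sh un).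
  case=> P [d [e incr badP [shP pP] /(_ sg chi c ty)[psi [tP td]]]].
  rewrite e in w *; apply: (Lead_pattern idF rules w) badP shP pP tP _ => // i.
    by move=> j /incr; rewrite !tid.
  by have := td i; rewrite tid.
rewrite /= -/(bad (Node g a b)) nB /= negb_and.
move: (w); rewrite wf_Node => /and5P[_ _ wa wb _] /orP[na|nb].
  exact: (Lead_Node_left idF w (IHa _ wa na)).
exact: (Lead_Node_right idF w (IHb _ wb nb)).
Qed.
End NonNormal.

Definition sh_key (x : any_tree sh_sig) :=
  tkey (iota 0 (projT1 x)) (tmap val (projT2 x)).

Definition sh_le : rel (any_tree sh_sig) := fun x y => (sh_key x <= sh_key y)%O.

Lemma ord_iotaP n y : reflect (exists i : 'I_n, val i = y) (y \in iota 0 n).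
Proof.
rewrite mem_iota; apply: (iffP idP) => [lt|[i <-]] //; first by exists (Ordinal lt).
exact: ltn_ord.
Qed.

Lemma sh_monomial_perm n (chi : 'I_n -> colour) c (t : tree sh_op 'I_n) sg :
  @sh_monomial colour (shs sg) n chi c t -> perm_eq (leaves (tmap val t)) (iota 0 n).
Proof.
case/andP=> /andP[_ h] _.
by rewrite -(@monomial_perm _ t _ _ val_inj (iota_uniq 0 n) (@ord_iotaP n)).
Qed.

Lemma any_monomial_perm (x : any_tree sh_sig) :
  any_monomial x -> perm_eq (leaves (tmap val (projT2 x))) (iota 0 (projT1 x)).
Proof. by case=> chi [c h]; apply: (@sh_monomial_perm _ _ _ _ predT h). Qed.

Lemma sh_key_inj x y : any_monomial x -> any_monomial y -> sh_key x = sh_key y -> x = y.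
Proof.
case: x y => n t [m s] /any_monomial_perm ht /any_monomial_perm hs e.
have nm : n = m by case: e; rewrite !size_iota.
rewrite /sh_key /= in ht hs e; case: _ / nm in s hs e *.
by congr existT; apply/(tmap_inj val_inj)/(tkey_inj ht hs (iota_uniq _ _) e).
Qed.

Lemma sh_le_total : total_ordering sh_le.
Proof.
split=> [x _|x y hx hy xy yx|x y z _ _ _|x y _ _]; rewrite /sh_le.
- exact: lexx.
- by apply: sh_key_inj => //; apply/eqP; rewrite eq_le; apply/andP.
- exact: le_trans.
exact: le_total.
Qed.

(** * Admissibility *)

Section ShuffleGrafting.
Variables (G : Type) (n m p : nat) (l : 'I_n) (u : 'I_n -> 'I_p) (v : 'I_m -> 'I_p).
Hypothesis guv : shuffle_grafting l u v.
Hypothesis m_gt0 : (0 < m)%N.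

Let oext q (f : 'I_q -> 'I_p) (i : nat) : nat := oapp (fun x => f x : nat) 0%N (insub i).
Let oextE q (f : 'I_q -> 'I_p) (i : 'I_q) : oext f i = f i.
Proof. by rewrite /oext insubT ?ltn_ord // => lt /=; congr (val (f _)); apply: val_inj. Qed.

Definition graft_labels_l := map (oext u) (iota 0 n).
Definition graft_labels_r := map (oext v) (iota 0 m).
Local Notation A := graft_labels_l.
Local Notation B := graft_labels_r.
Local Notation C := (iota 0 p).

Let oext_mono q (f : 'I_q -> 'I_p) : {homo f : i j / (i < j)%N} ->
  {in iota 0 q &, {homo oext f : i j / (i < j)%N}}.
Proof.
move=> H i j /ord_iotaP[i' <-] /ord_iotaP[j' <-] /= lt.
by rewrite !oextE; apply: H.
Qed.

Let oext_inj q (f : 'I_q -> 'I_p) : {homo f : i j / (i < j)%N} ->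
  {in iota 0 q &, injective (oext f)}.
Proof.
move=> /oext_mono H i j hi hj e.
by have [lt|lt|//] := ltngtP i j; [have := H i j hi hj lt|have := H j i hj hi lt];
  rewrite e ltnn.
Qed.

Let oext_sorted q (f : 'I_q -> 'I_p) : {homo f : i j / (i < j)%N} ->
  sorted ltn (map (oext f) (iota 0 q)).
Proof.
by move=> /oext_mono H; apply: (homo_sorted_in H); [apply/allP|apply: iota_ltn_sorted].
Qed.

Let u_mono := let: And4 _ h _ _ := guv in h.
Let v_mono := let: And4 _ _ h _ := guv in h.
Let v0 : v (Ordinal m_gt0) = u l.
Proof. by case: guv => _ _ _; apply. Qed.

Lemma graft_sorted_l : sorted ltn A. Proof. exact: oext_sorted u_mono. Qed.
Lemma graft_sorted_r : sorted ltn B. Proof. exact: oext_sorted v_mono. Qed.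

Let memA y : reflect (exists x, u x = y :> nat) (y \in A).
Proof.
apply: (iffP mapP) => [[x /ord_iotaP[x' <-] ->]|[x <-]].
  by exists x'; rewrite oextE.
by exists (val x); rewrite /= ?oextE //; apply/ord_iotaP; exists x.
Qed.

Let memB y : reflect (exists x, v x = y :> nat) (y \in B).
Proof.
apply: (iffP mapP) => [[x /ord_iotaP[x' <-] ->]|[x <-]].
  by exists x'; rewrite oextE.
by exists (val x); rewrite /= ?oextE //; apply/ord_iotaP; exists x.
Qed.

Lemma graft_mem_l : (u l : nat) \in A. Proof. by apply/memA; exists l. Qed.
Lemma graft_mem_r : (u l : nat) \in B.
Proof. by apply/memB; exists (Ordinal m_gt0); rewrite v0. Qed.

Lemma graft_min_r : {in B, forall j, (u l <= j)%N}.
Proof.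
move=> j /memB[x <-]; rewrite -v0.
have [lt|e] : (0 < x)%N \/ x = Ordinal m_gt0 :> nat by case: (val x); [right|left].
  by apply/ltnW/v_mono.
by rewrite (val_inj e).
Qed.

Lemma graft_meet : {in A, forall j, j \in B -> j = u l}.
Proof.
move=> j /memA[x <-] /memB[y /val_inj e]; have [->//|xl] := eqVneq x l.
case: guv => /forallP/(_ (u x)) /eqP + _ _ _.
rewrite (cardD1 x) inE xl eqxx (cardD1 y) !inE e eqxx; lia.
Qed.

Lemma graft_cover j : (j \in C) = (j \in A) || (j \in B).
Proof.
apply/ord_iotaP/orP => [[z <-]|[/memA[x <-]|/memB[x <-]]]; last 2 first.
- by exists (u x).
- by exists (v x).
case: guv => /forallP/(_ z) /eqP h _ _ _.
have [/existsP[x /andP[_ /eqP<-]]|/existsPn H1] := boolP [exists x, (x != l) && (u x == z)].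
  by left; apply/memA; exists x.
have [/existsP[x /eqP<-]|/existsPn H2] := boolP [exists x, v x == z].
  by right; apply/memB; exists x.
rewrite !eq_card0 // in h => x; rewrite !inE; [exact/negbTE/H2|exact/negbTE/H1].
Qed.

Definition graft_l (t : tree G 'I_n) : tree G nat := tmap (oext u) (tmap val t).
Definition graft_r (s : tree G 'I_m) : tree G nat := tmap (oext v) (tmap val s).

Lemma graft_gr t s : tmap val (graft l u v t s) = gr (u l) (graft_l t) (graft_r s).
Proof.
rewrite /graft /graft_l /graft_r /gr tmap_bind !tmap_tmap bind_tmap.
apply: eq_in_bind => x _ /=; rewrite oextE (inj_eq val_inj).
have -> : (u x == u l) = (x == l).
  apply/eqP/eqP => [e|->//]; apply/eqP/negPn/negP => ne.
  have [lt|lt|/val_inj e'] := ltngtP x l; last by rewrite e' eqxx in ne.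
    by have := u_mono lt; rewrite e ltnn.
  by have := u_mono lt; rewrite e ltnn.
case: ifP => _; last by rewrite /tmap /= -oextE.
by rewrite tmap_tmap; apply: eq_in_tmap => y _ /=; rewrite oextE.
Qed.

Lemma perm_graft_l t : perm_eq (leaves (tmap val t)) (iota 0 n) -> perm_eq (leaves (graft_l t)) A.
Proof. by move=> h; rewrite leaves_tmap' perm_map. Qed.

Lemma perm_graft_r s : perm_eq (leaves (tmap val s)) (iota 0 m) -> perm_eq (leaves (graft_r s)) B.
Proof. by move=> h; rewrite leaves_tmap' perm_map. Qed.

Let inj_cat q (f : 'I_q -> 'I_p) (t : tree G 'I_q) : {homo f : i j / (i < j)%N} ->
  {in leaves (tmap val t) ++ iota 0 q &, injective (oext f)}.
Proof.
move=> /oext_inj; apply: sub_in2 => i; rewrite mem_cat leaves_tmap' => /orP[|//].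
by case/mapP=> j _ ->; apply/ord_iotaP; exists j.
Qed.

Let shuf_oext q (f : 'I_q -> 'I_p) (t : tree G 'I_q) : {homo f : i j / (i < j)%N} ->
  shuf (tmap (oext f) (tmap val t)) = shuf (tmap val t).
Proof.
move=> /oext_mono H; apply: shuf_tmap => i j; rewrite leaves_tmap'.
by move=> /mapP[i' _ ->] /mapP[j' _ ->]; apply: H; apply/ord_iotaP; [exists i'|exists j'].
Qed.

Lemma shuf_graft_l t : shuf (graft_l t) = shuf (tmap val t).
Proof. exact: shuf_oext. Qed.

Lemma shuf_graft_r t : shuf (graft_r t) = shuf (tmap val t).
Proof. exact: shuf_oext. Qed.

Lemma minl_graft_r t : perm_eq (leaves (tmap val t)) (iota 0 m) -> minl (graft_r t) = u l.
Proof.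
move=> /perm_graft_r/perm_mem e; apply: minl_eq; first by rewrite e graft_mem_r.
by move=> y; rewrite e; apply: graft_min_r.
Qed.

Lemma graft_inj_l t : exists2 f, A = map f (iota 0 n) /\ graft_l t = tmap f (tmap val t) &
  {in leaves (tmap val t) ++ iota 0 n &, injective f}.
Proof. by exists (oext u) => //; apply: inj_cat. Qed.

Lemma graft_inj_r t : exists2 f, B = map f (iota 0 m) /\ graft_r t = tmap f (tmap val t) &
  {in leaves (tmap val t) ++ iota 0 m &, injective f}.
Proof. by exists (oext v) => //; apply: inj_cat. Qed.
End ShuffleGrafting.

Lemma sh_le_graft n m p (l : 'I_n) (u : 'I_n -> 'I_p) (v : 'I_m -> 'I_p)
    (t t' : tree sh_op 'I_n) (s s' : tree sh_op 'I_m) :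
  shuffle_grafting l u v ->
  @composable colour sh_sig _ _ l t s -> @composable colour sh_sig _ _ l t' s' ->
  sh_le (@any _ sh_sig _ t) (@any _ sh_sig _ t') ->
  sh_le (@any _ sh_sig _ s) (@any _ sh_sig _ s') ->
  sh_le (@any _ sh_sig _ (graft l u v t s)) (@any _ sh_sig _ (graft l u v t' s')).
Proof.
move=> guv [chi [c [psi [/(@sh_monomial_perm _ _ _ _ predT) ht
  /(@sh_monomial_perm _ _ _ _ predT) hs]]]].
move=> [chi' [c' [psi' [/(@sh_monomial_perm _ _ _ _ predT) ht'
  /(@sh_monomial_perm _ _ _ _ predT) hs']]]].
(* A tree has at least one leaf. For m = 0 the last condition of [shuffle_grafting] would say
   nothing about [u l]. *)
have m0 : (0 < m)%N.
  have := perm_size hs; rewrite size_iota leaves_tmap' size_map size_leaves.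
  by move=> <-.
rewrite /sh_le /sh_key /= !(graft_gr guv).
have [f [Af fE] fi] := graft_inj_l guv t; have [f' [Af' fE'] fi'] := graft_inj_l guv t'.
have [h [Bh hE] hi] := graft_inj_r guv s; have [h' [Bh' hE'] hi'] := graft_inj_r guv s'.
rewrite -(tkey_tmap fi) -(tkey_tmap fi') -(tkey_tmap hi) -(tkey_tmap hi').
rewrite -Af -Af' -Bh -Bh' -fE -fE' -hE -hE'.
have sA := graft_sorted_l guv; have sB := graft_sorted_r guv.
have sC : sorted ltn (iota 0 p) := iota_ltn_sorted 0 p.
have aA := graft_mem_l l u; have aB := graft_mem_r guv m0.
have minB := graft_min_r guv m0; have AB := graft_meet guv m0.
have CAB := graft_cover guv.
have pt := perm_graft_l u ht; have pt' := perm_graft_l u ht'.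
have ps := perm_graft_r v hs; have ps' := perm_graft_r v hs'.
rewrite le_eqVlt => tt'; rewrite le_eqVlt => ss'.
apply: (@le_trans _ _ (tkey (iota 0 p) (gr (u l) (graft_l u t') (graft_r v s)))).
  case/orP: tt' => [/eqP/(tkey_inj pt pt' (sub_sorted_ltn sA))->//|lt].
  exact: (ltW (tlt_grl aA aB minB AB CAB sA sC pt pt' ps lt)).
case/orP: ss' => [/eqP/(tkey_inj ps ps' (sub_sorted_ltn sB))->//|lt].
exact: (ltW (tlt_grr aA aB AB CAB sA sB sC pt' ps ps' lt)).
Qed.

Lemma sh_le_admissible : admissible sh_le.
Proof.
split; first exact: sh_le_total.
  move=> x y _ _ lt; apply: ltW; rewrite /sh_key /tkey ltxi_pair /= !size_iota.
  by rewrite leEnat (ltnW lt) leqNgt lt.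
exact: sh_le_graft.
Qed.

(** * The bad patterns as leading terms of the relations *)

Section ToShuffle.
Variable k : fieldType.

Lemma sh_sign_neq0 n (t : tree lr_op 'I_n) : sh_sign k t != 0.
Proof.
elim: t => [x|g a IHa b IHb] /=; first exact: oner_neq0.
by rewrite !mulf_neq0 //; case: ifP; rewrite ?oner_neq0 // oppr_eq0 oner_neq0.
Qed.

Lemma to_shuffle_linear n : linear (@to_shuffle k n).
Proof. exact: fglift_linear. Qed.

Lemma to_shuffleU n e (t : tree lr_op 'I_n) :
  to_shuffle << e *g t >> = << e * sh_sign k t *g sh_tree t >>.
Proof.
rewrite /to_shuffle liftU; apply/eqP/freeg_eqP => z.
by rewrite coeffZ !coeffU mulrA.
Qed.

Lemma fgmapUg (T T' : choiceType) (h : T -> T') e t :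
  fgmap h << e *g t >> = << e *g h t >> :> {freeg T' / k}.
Proof.
rewrite /fgmap liftU; apply/eqP/freeg_eqP => z.
by rewrite coeffZ !coeffU mul1r.
Qed.
End ToShuffle.

Section RuleTable.
Variables (k : fieldType) (sg : pred sh_op) (F : sh_family k (shs sg)).
Variable rels : seq (relation k colour lr_op).
Hypothesis F_rels : forall (r : relation k colour lr_op) (s : {perm 'I_(rel_arity r)}),
  List.In r rels -> F (fun i => rel_col ((s^-1)%g i)) (rel_out r)
    (to_shuffle (fgmap (tmap s) (rel_elt r))).

Definition rule_at n (psi : 'I_n -> colour) c (P : tree sh_op 'I_n) :=
  exists f, [/\ F psi c f, coeff P f != 0
    & forall s : tree sh_op 'I_n, s \in dom f -> s != P ->
        tlt (iota 0 n) (tmap val s) (tmap val P)].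

(** The relation is written as a list headed by the prospective leading term. All other terms give
    strictly smaller monomials, so none can cancel the head, whatever signs [to_shuffle]
    produces. *)
Lemma rule_of_relation (s : seq colour) c e (c0 : k) t0 (l : seq (k * tree lr_op _))
    (f : 'I_(size s) -> 'I_(size s)) psi P :
  List.In (@lr_rel k s c e) rels -> injective f -> (forall j, psi (f j) = nth colS s j) ->
  e = \sum_(x <- (c0, t0) :: l) << x.1 *g x.2 >> -> c0 != 0 ->
  sh_tree (tmap f t0) = P ->
  all (fun x => tlt (iota 0 (size s)) (tmap val (sh_tree (tmap f x.2))) (tmap val P)) l ->
  rule_at psi c P.
Proof.
move=> inr fi hpsi eE c00 <- /allP ltl; subst e.
set g := \sum_(_ <- _) _ in inr.
have := @F_rels (@lr_rel k s c g) (perm fi) inr; rewrite /rel_col /rel_out /rel_elt /=.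
have -> : (fun i => nth colS s (((perm fi)^-1)%g i)) = psi.
  by apply: funext => i; rewrite -hpsi -(permE fi) permKV.
have -> : fgmap (tmap (perm fi)) g = fgmap (tmap f) g.
  congr fgmap; apply: funext => t; apply: eq_in_tmap => j _; exact: permE.
rewrite /g (lin_sum _ _ (fgmap_linear _)) (lin_sum _ _ (@to_shuffle_linear k _)).
set h := \sum_(_ <- _) _ => Fh; exists h.
have hE : h = \sum_(x <- (c0, t0) :: l)
    << x.1 * sh_sign k (tmap f x.2) *g sh_tree (tmap f x.2) >>.
  by apply: eq_bigr => x _; rewrite fgmapUg to_shuffleU.
have tl x : x \in l -> (sh_tree (tmap f x.2) == sh_tree (tmap f t0)) = false.
  by move=> xl; apply/eqP => e'; have := ltl _ xl; rewrite /= e' tlt_irr.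
split=> //.
  rewrite hE big_cons coeffD coeff_sum big1_seq => [|x /andP[_ xl]].
    by rewrite addr0 coeffU eqxx mulr1 mulf_neq0 // sh_sign_neq0.
  by rewrite coeffU tl // mulr0.
move=> r; rewrite hE big_cons => /domD_subset; rewrite mem_cat => /orP[|].
  by rewrite mem_dom coeffU => + /negPf ne; rewrite [_ == r]eq_sym ne mulr0 eqxx.
move=> /dom_sum_subset /flattenP[d /mapP[x]]; rewrite filter_predT => xl ->.
rewrite mem_dom coeffU.
have [/eqP <- _ _|_] := boolP (_ == r); last by rewrite mulr0 eqxx.
exact: ltl.
Qed.

Local Notation y1 := (Leaf (@Ordinal 3 0 isT)).
Local Notation y2 := (Leaf (@Ordinal 3 1 isT)).
Local Notation y3 := (Leaf (@Ordinal 3 2 isT)).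
Local Notation a := (Node alpha).
Local Notation b := (Node beta).
Local Notation d := (Node opd).
Local Notation m := (Node opm).

Lemma NU (T : choiceType) (t : T) : - << t >> = << -1 *g t >> :> {freeg T / k}.
Proof. exact: freegUN. Qed.

Lemma NNU (T : choiceType) (t : T) : - << -1 *g t >> = << t >> :> {freeg T / k}.
Proof. by rewrite freegUN opprK. Qed.

Ltac rel_tac := rewrite /= ?opprD ?opprB ?opprK ?NU ?NNU !big_cons big_nil /= addr0 ?addrA //.

(** In each of these seven relations the term put first is the one that becomes leading for suitable
    permutations of the labels; all bad patterns arise from these terms. *)
Lemma alpha_assocE : rel_elt (alpha_assoc k) =
  \sum_(x <- [:: (-1, a y1 (a y2 y3)); (1, a (a y1 y2) y3)]) << x.1 *g x.2 >>.
Proof. by rel_tac; rewrite addrC. Qed.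
Lemma beta_jacobiE : rel_elt (beta_jacobi k) =
  \sum_(x <- [:: (-1, b y1 (b y2 y3)); (1, b (b y1 y2) y3); (-1, b (b y1 y3) y2)])
    << x.1 *g x.2 >>.
Proof. by rel_tac; rewrite -[RHS]addrA [RHS]addrC. Qed.
Lemma d_leibnizE : rel_elt (d_leibniz k) =
  \sum_(x <- [:: (1, d (a y1 y2) y3); (-1, a y1 (d y2 y3)); (-1, a (d y1 y3) y2)])
    << x.1 *g x.2 >>.
Proof. by rel_tac. Qed.
Lemma d_actionE : rel_elt (d_action k) =
  \sum_(x <- [:: (1, d y1 (b y2 y3)); (-1, d (d y1 y3) y2); (1, d (d y1 y2) y3)])
    << x.1 *g x.2 >>.
Proof. by rel_tac; rewrite -!addrA; congr (_ + _); rewrite addrC. Qed.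
Lemma m_moduleE : rel_elt (m_module k) =
  \sum_(x <- [:: (-1, m y1 (m y2 y3)); (1, m (a y1 y2) y3)]) << x.1 *g x.2 >>.
Proof. by rel_tac; rewrite addrC. Qed.
Lemma d_anchorE : rel_elt (d_anchor k) =
  \sum_(x <- [:: (1, d y1 (m y2 y3)); (-1, a (d y1 y3) y2)]) << x.1 *g x.2 >>.
Proof. by rel_tac. Qed.
Lemma beta_leibnizE : rel_elt (beta_leibniz k) =
  \sum_(x <- [:: (1, b y2 (m y1 y3)); (-1, m y1 (b y2 y3)); (-1, m (d y1 y2) y3)])
    << x.1 *g x.2 >>.
Proof. by rel_tac. Qed.

Lemma two_vertices (P : tree sh_op 'I_3) :
  shuf (tmap val P) -> perm_eq (leaves (tmap val P)) (iota 0 3) -> exists g h,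
  [\/ P = Node g (Node h y1 y2) y3, P = Node g (Node h y1 y3) y2
    | P = Node g y1 (Node h y2 y3)].
Proof.
have o3 (i j l : 'I_3) : perm_eq [:: val i; val j; val l] (iota 0 3) -> (i < j)%N ->
    (i < l)%N -> i = Ordinal (isT : 0 < 3)%N /\
      (j = Ordinal (isT : 1 < 3)%N /\ l = Ordinal (isT : 2 < 3)%N \/
       j = Ordinal (isT : 2 < 3)%N /\ l = Ordinal (isT : 1 < 3)%N).
  move=> /perm_uniq u lij lil; move: u; rewrite /= !inE !negb_or => /andP[/andP[_ _] /andP[njl _]].
  have := ltn_ord i; have := ltn_ord j; have := ltn_ord l; move=> hl hj hi.
  have njl' : (j : nat) <> l by apply/eqP.
  split; first by apply: val_inj => /=; lia.
  have [h|h|/njl'//] := ltngtP j l; [left|right]; split; apply: val_inj => /=; lia.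
move=> sP pP; have := perm_size pP; rewrite leaves_tmap' size_map size_leaves size_iota.
case: P sP pP => [//|g A B] /=; rewrite -!/(tmap _ _).
case: A B => [i|h [i|//] [j|//]] [l|h' [l|? ? ?] [j'|? ? ?]] //=; try lia.
  move=> /and3P[l1 l2 _] p _; exists g, h'.
  have il : (i < l)%N by lia.
  have ij : (i < j')%N by lia.
  have [-> [[-> ->]|[el ej]]] := o3 i l j' p il ij; first by apply: Or33.
  by rewrite el ej /= in l2.
move=> /and3P[l1 /andP[l2 _] _] p _; exists g, h.
have il : (i < l)%N by lia.
have [-> [[-> ->]|[-> ->]]] := o3 i j l p l2 il; first by apply: Or31.
by apply: Or32.
Qed.

Hypothesis in_alpha_assoc : sg sh_alpha -> List.In (alpha_assoc k) rels.
Hypothesis in_beta_jacobi : sg sh_beta -> List.In (beta_jacobi k) rels.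
Hypothesis in_d_leibniz :
  sg sh_alpha -> sg sh_d || sg sh_e -> List.In (d_leibniz k) rels.
Hypothesis in_d_action :
  sg sh_d || sg sh_e -> sg sh_beta -> List.In (d_action k) rels.
Hypothesis in_d_anchor :
  sg sh_d || sg sh_e -> sg sh_m || sg sh_n -> List.In (d_anchor k) rels.
Hypothesis in_m_module : sg sh_m || sg sh_n -> List.In (m_module k) rels.
Hypothesis in_beta_leibniz :
  sg sh_beta -> sg sh_m || sg sh_n -> List.In (beta_leibniz k) rels.

Local Notation o1 := (@Ordinal 3 0 isT).
Local Notation o2 := (@Ordinal 3 1 isT).
Local Notation o3 := (@Ordinal 3 2 isT).

Definition fun3 (T : Type) (x y z : T) (j : 'I_3) : T :=
  match val j with 0 => x | 1 => y | _ => z end.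

Lemma ord3_ind (Q : 'I_3 -> Prop) : Q o1 -> Q o2 -> Q o3 -> forall j, Q j.
Proof.
by move=> h1 h2 h3 [[|[|[|//]]] lt]; [move: h1|move: h2|move: h3];
  congr Q; apply: val_inj.
Qed.

Lemma fun3_inj (x y z : 'I_3) : x != y -> x != z -> y != z -> injective (fun3 x y z).
Proof.
move=> /eqP xy /eqP xz /eqP yz i j; move: i j; do 2!apply: ord3_ind; rewrite /fun3 //= => e;
by [case: (xy e)|case: (xy (esym e))|case: (xz e)|case: (xz (esym e))|case: (yz e)|case: (yz (esym e))].
Qed.

Ltac use_rel s c R inr x y z :=
  apply: (@rule_of_relation s c _ _ _ _ (fun3 x y z) _ _ _ _ _ R);
  [ apply: inr; repeat match goal with H : is_true (sg _) |- _ => rewrite H end;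
    by rewrite ?orbT
  | by apply: fun3_inj | apply: ord3_ind; assumption
  | by rewrite ?oppr_eq0 oner_eq0 | reflexivity | by [] ].

Ltac use_perms s c R inr :=
  first [ use_rel s c R inr constr:(o1) constr:(o2) constr:(o3)
        | use_rel s c R inr constr:(o2) constr:(o1) constr:(o3)
        | use_rel s c R inr constr:(o1) constr:(o3) constr:(o2)
        | use_rel s c R inr constr:(o2) constr:(o3) constr:(o1)
        | use_rel s c R inr constr:(o3) constr:(o1) constr:(o2)
        | use_rel s c R inr constr:(o3) constr:(o2) constr:(o1) ].

Ltac use_rels :=
  first [ use_perms constr:([:: colS; colS; colS]) colS alpha_assocE in_alpha_assoc
        | use_perms constr:([:: colL; colL; colL]) colL beta_jacobiE in_beta_jacobi
        | use_perms constr:([:: colS; colS; colL]) colS d_leibnizE in_d_leibniz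
        | use_perms constr:([:: colS; colL; colL]) colS d_actionE in_d_action
        | use_perms constr:([:: colS; colS; colL]) colS d_anchorE in_d_anchor
        | use_perms constr:([:: colS; colS; colL]) colL m_moduleE in_m_module
        | use_perms constr:([:: colS; colL; colL]) colL beta_leibnizE in_beta_leibniz ].

(** A finite check: for each bad pattern a relation and a permutation of the labels are searched for
    which the head of the list is the pattern and the other terms lie below it. Each candidate is
    decided by computation. *)
Lemma rule_table : has_rules F.
Proof.
move=> psi c P /[dup] mP /andP[/andP[tP _] sP] badP.
have pP := sh_monomial_perm mP.
have {}sP : shuf (tmap val P).
  by elim: P sP {tP mP badP pP} => //= g A IHA B IHB; rewrite -!minl_tmap => /and3P[-> /IHA-> /IHB].
change (rule_at psi c P); have [g [h]] := two_vertices sP pP.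
case=> PE; subst P; move: badP (tP); rewrite /= ?orbF {mP sP pP tP}.
- move=> badP /and4P[sg1 /eqP ec /and4P[sg2 /eqP eh /eqP h1 /eqP h2] /eqP h3].
  subst c; move: sg1 sg2 badP eh h1 h2 h3.
  by case: g => //; case: h => //= sg1 sg2 _ _ h1 h2 h3; use_rels.
- move=> badP /and4P[sg1 /eqP ec /and4P[sg2 /eqP eh /eqP h1 /eqP h3] /eqP h2].
  subst c; move: sg1 sg2 badP eh h1 h2 h3.
  by case: g => //; case: h => //= sg1 sg2 _ _ h1 h2 h3; use_rels.
move=> badP /and4P[sg1 /eqP ec /eqP h1 /and4P[sg2 /eqP eh /eqP h2 /eqP h3]].
subst c; move: sg1 sg2 badP eh h1 h2 h3.
by case: g => //; case: h => //= sg1 sg2 _ _ h1 h2 h3; use_rels.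
Qed.
End RuleTable.

(** * Symmetric ideals and their pullbacks to shuffle trees *)

Section MonomialGraft.
Variables (I : eqType) (Sig : signature I) (X Y Z : finType).
Variables (chi : X -> I) (psi : Y -> I) (xi : Z -> I) (c : I).
Variables (l : X) (u : X -> Z) (v : Y -> Z).

Lemma monomial_leaves (W : finType) (om : W -> I) d (t : tree Sig W) :
  monomial om d t -> perm_eq (leaves t) (enum W).
Proof.
case/andP=> _ /forallP h; apply/allP => x _ /=; rewrite (eqP (h x)).
by rewrite count_uniq_mem ?enum_uniq // mem_enum.
Qed.

Lemma monomial_graft (t : tree Sig X) (s : tree Sig Y) :
  grafting l u v -> graft_colours chi psi xi l u v ->
  monomial chi c t -> monomial psi (chi l) s -> monomial xi c (graft l u v t s).
Proof.
move=> /forallP guv [cu cv] mt ms; apply/andP; split.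
  have {ms} : typed psi (chi l) s by case/andP: ms.
  case/andP: mt => + _ hs; elim: t c => [x|g a IHa b IHb] d /=; last first.
    by case/and4P=> h1 h2 /IHa h3 /IHb h4; apply/and4P.
  rewrite /graft /= => /eqP<-; have [->|/eqP xl] := eqVneq x l; last by rewrite /= cu.
  elim: s (chi l) hs => [y|g a IHa b IHb] e; rewrite /tmap /= ?cv //.
  by case/and4P=> h1 h2 /IHa h3 /IHb h4; apply/and4P.
apply/forallP => z; rewrite -(eqP (guv z)) leaves_bind count_flatten -map_comp.
rewrite sumnE big_map (perm_big _ (monomial_leaves mt)) big_enum /= (bigD1 l) //= eqxx.
rewrite addnC; apply/eqP; congr (_ + _)%N.
  rewrite -sum1_card big_mkcondr /=; apply: eq_bigr => x /negPf -> /=.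
  by rewrite addn0; case: (u x == z).
have /seq.permP e := monomial_leaves ms.
by rewrite leaves_tmap' count_map e -sum1_count big_enum_cond /= sum1_card.
Qed.
End MonomialGraft.

Section SymmetricIdeals.
Variables (k : fieldType) (I : eqType) (Sig : signature I) (M : sym_family k Sig).
Hypothesis idM : sym_ideal M.

Section Branches.
Variables (X Y Z : finType) (iY : Y -> X) (iZ : Z -> X) (z0 : Z).
Hypothesis part : forall x, (#|[pred y | iY y == x]| + #|[pred z | iZ z == x]| = 1)%N.
Variables (chi : X -> I) (col : bool -> I) (c : I).

Definition sub2 (T : tree Sig bool) (a : tree Sig Y) (b : tree Sig Z) : tree Sig X :=
  bind T (fun x => if x then tmap iY a else tmap iZ b).

(** Filling both inputs is split into two partial compositions with [option Y] as the labels in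
    between. The label None is the input false, left free by the first grafting; [z0] is the dummy
    value at the leaf that the second one uses up. *)
Let u1 (x : bool) : option Y := None.
Let u2 (o : option Y) : X := if o is Some y then iY y else iZ z0.
Let chi1 (o : option Y) : I := if o is Some y then chi (iY y) else col false.

Let gr1 : grafting true u1 (@Some Y).
Proof.
apply/forallP => -[y|]; apply/eqP.
  rewrite eq_card0 ?(@eq_card1 _ y) // => z; rewrite !inE ?andbF //.
rewrite (@eq_card1 _ false) ?eq_card0 // => -[] //.
Qed.

Let gr2 : grafting None u2 iZ.
Proof.
apply/forallP => x; apply/eqP; rewrite -[RHS](part x); congr (_ + _)%N.
rewrite -(card_image (f := @Some Y)) => [|y y' []//].
apply: eq_card => -[y|]; rewrite !inE /=; last first.
  by symmetry; apply/negbTE/negP => /imageP[].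
apply/idP/imageP => [e|[y' + [->]]]; first by exists y.
by rewrite inE.
Qed.

Let gc1 : graft_colours col (chi \o iY) chi1 true u1 (@Some Y).
Proof. by split=> // -[]. Qed.

Let gc2 : graft_colours chi1 (chi \o iZ) chi None u2 iZ.
Proof. by split=> // -[]. Qed.

Let sub2E T a b :
  sub2 T a b = graft None u2 iZ (graft true u1 (@Some Y) T a) b.
Proof.
rewrite /graft bind_bind; apply: eq_in_bind => -[] _ //=.
by rewrite bind_tmap; apply: eq_in_bind => y _.
Qed.

Let homU (W : finType) (xi : W -> I) d (t : tree Sig W) :
  monomial xi d t -> homogeneous xi d (<< t >> : {freeg _ / k}).
Proof. by move=> h; rewrite /homogeneous domU1 /= h. Qed.

Let graft_linU (X' Y' Z' : finType) l (u : X' -> Z') (v : Y' -> Z')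
  (t : tree Sig X') (s : tree Sig Y') :
  graft_lin l u v << t >> << s >> = << graft l u v t s >> :> {freeg _ / k}.
Proof. by rewrite /graft_lin !liftU !scale1r. Qed.

Let graft_linL (X' Y' Z' : finType) l (u : X' -> Z') (v : Y' -> Z') (s : tree Sig Y') :
  linear (fun f : {freeg (tree Sig X') / k} => graft_lin l u v f << s >>).
Proof. by move=> x f1 f2; rewrite /graft_lin fglift_linear. Qed.

Let graft_linR (X' Y' Z' : finType) l (u : X' -> Z') (v : Y' -> Z') (t : tree Sig X') :
  linear (fun f : {freeg (tree Sig Y') / k} => graft_lin l u v << t >> f).
Proof. by move=> x f1 f2; rewrite /graft_lin !liftU !scale1r fglift_linear. Qed.

Let fgmap_sub (T U : choiceType) (h : T -> U) (L : {freeg T / k} -> {freeg U / k}) f :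
  linear L -> (forall t, L << t >> = << h t >>) -> L f = fgmap h f.
Proof. by move=> Ll H; apply: freeg_ext => // [|t]; [apply: fgmap_linear|rewrite fgmapU]. Qed.

Lemma sub2_top f a b : M col c f ->
  monomial (chi \o iY) (col true) a -> monomial (chi \o iZ) (col false) b ->
  M chi c (fgmap (fun T => sub2 T a b) f).
Proof.
move=> Mf ha hb.
have := symi_graftl idM gr1 gc1 Mf (homU ha) => /(symi_graftl idM gr2 gc2)/(_ (homU hb)).
rewrite (fgmap_sub (L := fun f => graft_lin None u2 iZ (graft_lin true u1 some f << a >>) << b >>)
   (h := fun T => sub2 T a b)) // => [x f1 f2|t]; first by rewrite !graft_linL.
by rewrite !graft_linU sub2E.
Qed.

Lemma sub2_left T f b : monomial col c T ->
  M (chi \o iY) (col true) f -> monomial (chi \o iZ) (col false) b ->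
  M chi c (fgmap (fun a => sub2 T a b) f).
Proof.
move=> hT Mf hb.
have := symi_graftr idM gr1 gc1 (homU hT) Mf => /(symi_graftl idM gr2 gc2)/(_ (homU hb)).
rewrite (fgmap_sub (L := fun f => graft_lin None u2 iZ (graft_lin true u1 some << T >> f) << b >>)
   (h := fun a => sub2 T a b)) // => [x f1 f2|t]; first by rewrite graft_linR graft_linL.
by rewrite !graft_linU sub2E.
Qed.

Lemma sub2_right T a f : monomial col c T -> monomial (chi \o iY) (col true) a ->
  M (chi \o iZ) (col false) f ->
  M chi c (fgmap (fun b => sub2 T a b) f).
Proof.
move=> hT ha Mf.
have := symi_graftr idM gr2 gc2 (homU (monomial_graft gr1 gc1 hT ha)) Mf.
rewrite (fgmap_sub (L := fun f => graft_lin None u2 iZ << graft true u1 some T a >> f)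
   (h := fun b => sub2 T a b)) // => t.
by rewrite !graft_linU sub2E.
Qed.
End Branches.
End SymmetricIdeals.

(** * Translation between ordinary trees and shuffle trees *)

Definition unsh (g : sh_op) : lr_op * bool :=
  match g with
  | sh_alpha => (alpha, false) | sh_beta => (beta, false)
  | sh_d => (opd, false) | sh_e => (opd, true)
  | sh_m => (opm, false) | sh_n => (opm, true)
  end.

(** The meaning of a shuffle monomial in the free symmetric operad. It involves no signs and
    commutes with grafting exactly, which is why ideals are transferred along this map and not along
    [to_shuffle]. *)
Fixpoint from_sh (X : Type) (t : tree sh_op X) : tree lr_op X :=
  match t with
  | Leaf x => Leaf x
  | Node g a b => if (unsh g).2 then Node (unsh g).1 (from_sh b) (from_sh a)
                  else Node (unsh g).1 (from_sh a) (from_sh b)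
  end.

Definition sg_of (s : seq lr_op) : pred sh_op := fun g => (unsh g).1 \in s.

(* sh_tree for leaves ordered by r *)
Fixpoint shr (X : Type) (r : X -> nat) (t : tree lr_op X) : tree sh_op X :=
  match t with
  | Leaf i => Leaf i
  | Node g a b =>
      if (minl (tmap r a) < minl (tmap r b))%N
      then Node (sh_keep g) (shr r a) (shr r b)
      else Node (sh_swap g) (shr r b) (shr r a)
  end.

Lemma from_sh_bind X Y (f : X -> tree sh_op Y) (t : tree sh_op X) :
  from_sh (bind t f) = bind (from_sh t) (fun x => from_sh (f x)).
Proof. by elim: t => //= g a IHa b IHb; case: ifP => _ /=; rewrite IHa IHb. Qed.

Lemma from_sh_tmap X Y (f : X -> Y) (t : tree sh_op X) :
  from_sh (tmap f t) = tmap f (from_sh t).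
Proof. exact: from_sh_bind. Qed.

Lemma from_sh_graft (X : eqType) (Y Z : Type) (l : X) (u : X -> Z) (v : Y -> Z) t s :
  from_sh (graft l u v t s) = graft l u v (from_sh t) (from_sh s).
Proof.
rewrite from_sh_bind; apply: eq_in_bind => x _.
by case: ifP => _ //; rewrite from_sh_tmap.
Qed.

Lemma from_sh_typed (X : finType) (chi : X -> colour) c s t :
  @typed _ (lr_sig s) X chi c (from_sh t) = @typed _ (shs (sg_of s)) X chi c t.
Proof.
elim: t c => //= g a IHa b IHb c.
by case: g; rewrite /= IHa IHb // [X in [&& _, _ & X]]andbC.
Qed.

Lemma perm_from_sh (X : eqType) (t : tree sh_op X) : perm_eq (leaves (from_sh t)) (leaves t).
Proof.
elim: t => //= g a IHa b IHb; case: ifP => _ /=; last exact: perm_cat.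
by rewrite perm_catC; apply: perm_cat.
Qed.

Lemma from_sh_monomial (X : finType) (chi : X -> colour) c s t :
  @monomial _ (lr_sig s) X chi c (from_sh t) = @monomial _ (shs (sg_of s)) X chi c t.
Proof.
rewrite /monomial from_sh_typed; congr (_ && _); apply: eq_forallb => x.
by have /seq.permP-> := perm_from_sh t.
Qed.

Lemma shr_tmap X Y (f : X -> Y) (r : Y -> nat) t :
  shr r (tmap f t) = tmap f (shr (r \o f) t).
Proof.
elim: t => //= g a IHa b IHb; rewrite -!/(tmap _ _) !tmap_tmap IHa IHb.
by case: ifP.
Qed.

Lemma shr_val n (t : tree lr_op 'I_n) : shr val t = sh_tree t.
Proof. by elim: t => //= g a -> b ->; rewrite !minl_tmap. Qed.

Lemma perm_from_shr (X : eqType) (r : X -> nat) t :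
  perm_eq (leaves (from_sh (shr r t))) (leaves t).
Proof.
elim: t => //= g a IHa b IHb.
have H1 := perm_cat IHa IHb.
have H2 := perm_cat IHb IHa; rewrite perm_sym perm_catC perm_sym in H2.
by case: ifP => _; case: g.
Qed.

Lemma monomial_from_shr (X : finType) (chi : X -> colour) c (r : X -> nat) s t :
  @monomial _ (lr_sig s) X chi c t -> @monomial _ (lr_sig s) X chi c (from_sh (shr r t)).
Proof.
case/andP=> ht hl; apply/andP; split; last first.
  apply/forallP => x; have /seq.permP-> := perm_from_shr r t.
  exact: (forallP hl).
elim: t c ht {hl} => //= g a IHa b IHb c /and4P[hs hc /IHa ha /IHb hb].
by case: ifP => _; case: g hs hc ha hb => /= -> -> -> ->.
Qed.

Lemma tree_sub (G : Type) (X : finType) (P : pred X) (t : tree G X) :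
  {subset leaves t <= P} -> exists t' : tree G {x | P x}, tmap val t' = t.
Proof.
elim: t => [x|g a IHa b IHb] /= H.
  by exists (Leaf (exist _ x (H x (mem_head _ _)))).
have [|a' <-] := IHa; first by move=> x xa; apply: H; rewrite mem_cat xa.
have [|b' <-] := IHb; first by move=> x xb; apply: H; rewrite mem_cat xb orbT.
by exists (Node g a' b').
Qed.

Lemma card_sub_eq (X : finType) (P : pred X) x : #|[pred y : {x | P x} | val y == x]| = P x.
Proof.
have [Px|nPx] := boolP (P x).
  by rewrite (@eq_card1 _ (exist _ x Px)) // => y; rewrite !inE -val_eqE.
by rewrite eq_card0 // => y; rewrite !inE; apply: contraNF nPx => /eqP <-; apply: (valP y).
Qed.

Section Split.
Variables (I : eqType) (Sig : signature I).

Lemma typed_tmap' (X Y : finType) (f : Y -> X) (chi : X -> I) d (t : tree Sig Y) :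
  typed (chi \o f) d t = typed chi d (tmap f t).
Proof. by elim: t d => //= g a IHa b IHb d; rewrite IHa IHb. Qed.

Lemma monomial_sub (X : finType) (P : pred X) (chi : X -> I) d (t : tree Sig {x | P x}) :
  typed chi d (tmap val t) -> uniq (leaves (tmap val t)) ->
  (forall x, P x -> x \in leaves (tmap val t)) ->
  monomial (chi \o val) d t.
Proof.
rewrite /monomial (typed_tmap' val) => -> /= u H; apply/forallP => x.
move: u (H _ (valP x)); rewrite leaves_tmap' (map_inj_uniq val_inj) (mem_map val_inj).
by move=> u xt; rewrite count_uniq_mem // xt.
Qed.

Lemma node_split (X : finType) (chi : X -> I) c g (a b : tree Sig X) :
  monomial chi c (Node g a b) ->
  exists (Y Z : finType) (iY : Y -> X) (iZ : Z -> X) (a' : tree Sig Y) (b' : tree Sig Z),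
  [/\ forall x, (#|[pred y | iY y == x]| + #|[pred z | iZ z == x]| = 1)%N,
      tmap iY a' = a, tmap iZ b' = b,
      monomial (chi \o iY) (src1 g) a' & monomial (chi \o iZ) (src2 g) b'].
Proof.
case/andP=> /= /and4P[_ _ ha hb] /forallP hl.
have [a' ea] := @tree_sub Sig X (mem (leaves a)) a (fun x h => h).
have [b' eb] := @tree_sub Sig X (mem (leaves b)) b (fun x h => h).
have cl x : (count_mem x (leaves a) + count_mem x (leaves b) = 1)%N.
  by rewrite -count_cat (eqP (hl x)).
have uab : uniq (leaves a) /\ uniq (leaves b).
  have H x (u v : seq X) : (count_mem x u + count_mem x v = 1)%N ->
      count_mem x u = (x \in u).
    by rewrite -has_pred1 has_count; lia.
  split; apply: count_mem_uniq => x; first exact: H (cl x).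
  by apply: (H x _ (leaves a)); rewrite addnC.
exists {x | x \in leaves a}, {x | x \in leaves b}, val, val, a', b'; split=> //.
- move=> x; rewrite !card_sub_eq -(cl x).
  by case: uab => ua ub; rewrite !count_uniq_mem.
- by apply: monomial_sub; rewrite ea //; case: uab.
by apply: monomial_sub; rewrite eb //; case: uab.
Qed.
End Split.

Section Straighten.
Variables (k : fieldType) (s : seq lr_op) (M : sym_family k (lr_sig s)).
Hypothesis idM : sym_ideal M.
Hypothesis M_alpha : alpha \in s -> M (@rel_col _ _ _ (alpha_sym k)) colS (rel_elt (alpha_sym k)).
Hypothesis M_beta : beta \in s -> M (@rel_col _ _ _ (beta_skew k)) colL (rel_elt (beta_skew k)).

Fixpoint rsign (X : Type) (r : X -> nat) (t : tree lr_op X) : k :=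
  match t with
  | Leaf _ => 1
  | Node g a b =>
      (if (g == beta) && ~~ (minl (tmap r a) < minl (tmap r b))%N then -1 else 1)
      * rsign r a * rsign r b
  end.

Lemma rsign_val n (t : tree lr_op 'I_n) : rsign val t = sh_sign k t.
Proof. by elim: t => //= g a -> b ->; rewrite !minl_tmap. Qed.

Lemma rsign_tmap X Y (f : X -> Y) (r : Y -> nat) t : rsign r (tmap f t) = rsign (r \o f) t.
Proof. by elim: t => //= g a IHa b IHb; rewrite -!/(tmap _ _) !tmap_tmap IHa IHb. Qed.

Let swap_elt (g : lr_op) (e : k) : {freeg (tree lr_op bool) / k} :=
  << Node g (Leaf true) (Leaf false) >> - e *: << Node g (Leaf false) (Leaf true) >>.

Let to_bool (i : 'I_2) : bool := val i == 0%N.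
Let of_bool (b : bool) : 'I_2 := if b then Ordinal (isT : 0 < 2)%N else Ordinal (isT : 1 < 2)%N.
Let to_boolK : cancel to_bool of_bool.
Proof. by case=> -[|[|//]] ?; apply: val_inj. Qed.
Let of_boolK : cancel of_bool to_bool.
Proof. by case. Qed.

Let M_swap (g : lr_op) e : g \in s -> (g = alpha /\ e = 1) \/ (g = beta /\ e = -1) ->
  M (fun b : bool => if b then lr_src1 g else lr_src2 g) (lr_tgt g) (swap_elt g e).
Proof.
move=> gs [[eg ee]|[eg ee]]; subst g e.
  have col : forall i, (if to_bool i then lr_src1 alpha else lr_src2 alpha) =
    @rel_col _ _ _ (alpha_sym k) i by case=> -[|[|//]].
  have := symi_relabel idM (@Cbij _ _ _ _ (fun b : bool => if b then lr_src1 alpha else lr_src2 alpha)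
    _ _ to_boolK of_boolK col) (M_alpha gs).
  by rewrite /relabel /= (linB (fgmap_linear _)) !fgmapU /swap_elt scale1r.
have col : forall i, (if to_bool i then lr_src1 beta else lr_src2 beta) =
  @rel_col _ _ _ (beta_skew k) i by case=> -[|[|//]].
have := symi_relabel idM (@Cbij _ _ _ _ (fun b : bool => if b then lr_src1 beta else lr_src2 beta)
    _ _ to_boolK of_boolK col) (M_beta gs).
by rewrite /relabel /= (linD (fgmap_linear _)) !fgmapU /swap_elt scaleN1r opprK.
Qed.

Let M_lin (X : finType) (chi : X -> colour) c a f1 f2 :
  M chi c f1 -> M chi c f2 -> M chi c (a *: f1 + f2).
Proof. by case: (symi_subspace idM chi c) => _; apply. Qed.

(** Exchanging the inputs of d or m turns them into e or n, which [from_sh] undoes. A relation is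
    used only to exchange the inputs of alpha or beta, and beta contributes the sign. *)
Lemma straighten (X : finType) (chi : X -> colour) c (r : X -> nat) (t : tree lr_op X) :
  @monomial _ (lr_sig s) X chi c t ->
  M chi c (<< t >> - rsign r t *: << from_sh (shr r t) >>).
Proof.
(* The branches are relabelled by label sets of their own, so they are not literally subtrees of t;
   hence the induction on the number of vertices for all label sets at once. *)
have [n] := ubnP (nvertices t); elim: n X chi c r t => // n IH X chi c r [x|g a b] ltn.
  move=> _; rewrite /= scale1r subrr; by case: (symi_subspace idM chi c).
move=> /[dup] hN /(@node_split _ (lr_sig s))[Y [Z [iY [iZ [a' [b' [part ea eb ha hb]]]]]]].
have gs : g \in s by case/andP: hN => /andP[].
have ec : lr_tgt g = c by case/andP: hN => /and4P[_ /eqP].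
have z0 : Z by case: (leaves b') (size_leaves b') => [|z].
move: ltn; rewrite -ea -eb /= !nvertices_tmap => ltn.
have Ma := IH _ _ _ (r \o iY) a' _ ha; have Mb := IH _ _ _ (r \o iZ) b' _ hb.
have {}Ma := Ma ltac:(lia); have {}Mb := Mb ltac:(lia).
rewrite !rsign_tmap !shr_tmap !tmap_tmap.
set sa := rsign _ a' in Ma *; set sb := rsign _ b' in Mb *.
set a0 := from_sh (shr _ a') in Ma; set b0 := from_sh (shr _ b') in Mb.
have ha0 : @monomial _ (lr_sig s) _ (chi \o iY) (lr_src1 g) a0 by apply: monomial_from_shr.
have hb0 : @monomial _ (lr_sig s) _ (chi \o iZ) (lr_src2 g) b0 by apply: monomial_from_shr.
pose T : tree lr_op bool := Node g (Leaf true) (Leaf false).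
pose col (b : bool) := if b then lr_src1 g else lr_src2 g.
have hT : @monomial _ (lr_sig s) _ col c T.
  by apply/andP; rewrite /= gs ec !eqxx; split=> //; apply/forallP => -[].
pose N x y : tree lr_op X := @sub2 _ (lr_sig s) X Y Z iY iZ T x y.
have M1 : M chi c (<< N a' b' >> - (sa * sb) *: << N a0 b0 >>).
  have := sub2_left idM z0 part hT Ma hb; rewrite (linB (fgmap_linear _)) (linZ _ _ (fgmap_linear _)) !fgmapU.
  have := sub2_right idM z0 part hT ha0 Mb; rewrite (linB (fgmap_linear _)) (linZ _ _ (fgmap_linear _)) !fgmapU.
  move=> h1 h2; have := M_lin sa h1 h2.
  by rewrite scalerBr scalerA addrC addrA subrK.
have M2 e : (g = alpha /\ e = 1) \/ (g = beta /\ e = -1) ->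
    M chi c (<< N a0 b0 >> - e *: << @sub2 _ (lr_sig s) X Y Z iY iZ
      (Node g (Leaf false) (Leaf true)) a0 b0 >>).
  move=> h; have := sub2_top idM z0 part (M_swap gs h) ha0 hb0; rewrite ec.
  by rewrite (linB (fgmap_linear _)) (linZ _ _ (fgmap_linear _)) !fgmapU.
have [lt|_] := boolP (minl (tmap (r \o iY) a') < minl (tmap (r \o iZ) b'))%N;
  rewrite ?andbF ?andbT ?mul1r /=.
  move: M1; rewrite /N /sub2 /T /a0 /b0 /= -!from_sh_tmap.
  by case: (g).
have M3 e : (g = alpha /\ e = 1) \/ (g = beta /\ e = -1) ->
   M chi c (<< N a' b' >> - (e * sa * sb) *: << @sub2 _ (lr_sig s) X Y Z iY iZ
      (Node g (Leaf false) (Leaf true)) a0 b0 >>).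
  move=> /M2 h; have := M_lin (sa * sb) h M1.
  by rewrite scalerBr scalerA addrC addrA subrK mulrC mulrA.
move: M1 M3; rewrite /N /sub2 /T /a0 /b0 /= -!from_sh_tmap; case: (g) => /=.
- by move=> _ /(_ 1); apply; left.
- by move=> _ /(_ (-1)); apply; right.
- by rewrite mul1r.
by rewrite mul1r.
Qed.
End Straighten.

Lemma subspace_free (k : fieldType) (T : choiceType) (V : lmodType k) (W : V -> Prop)
    (h : {freeg T / k} -> V) (g : {freeg T / k}) : subspace W -> linear h ->
  (forall t, t \in dom g -> W (h << t >>)) -> W (h g).
Proof.
move=> [W0 WL] Lh; rewrite {2}(freegE g) (lin_sum _ _ Lh).
elim: (dom g) => [|t s IH] Ht; first by rewrite big_nil.
rewrite big_cons (linZ _ _ Lh); apply: WL; first by apply: Ht; rewrite inE eqxx.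
by apply: IH => u us; apply: Ht; rewrite inE us orbT.
Qed.

Section DomPredicates.
Variables (k : fieldType) (T T' : choiceType).

Lemma all_dom_lin (Q : pred T) (x : k) (f g : {freeg T / k}) :
  all Q (dom f) -> all Q (dom g) -> all Q (dom (x *: f + g)).
Proof.
move=> /allP hf /allP hg; apply/allP => t /domD_subset; rewrite mem_cat.
case/orP => [|/hg//]; rewrite mem_dom coeffZ mulf_eq0 negb_or -mem_dom => /andP[_].
exact: hf.
Qed.

Lemma all_dom0 (Q : pred T) : all Q (dom (0 : {freeg T / k})).
Proof. by rewrite dom0. Qed.

Lemma all_domU (Q : pred T) t : all Q (dom (<< t >> : {freeg T / k})) = Q t.
Proof. by rewrite domU1 /= andbT. Qed.

End DomPredicates.

Lemma all_dom_fglift (k : fieldType) (T T' : choiceType) (Q : pred T) (Q' : pred T')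
    (h : T -> {freeg T' / k}) f :
  all Q (dom f) -> (forall t, Q t -> all Q' (dom (h t))) -> all Q' (dom (fglift h f)).
Proof.
move=> /allP hf hh; rewrite fgliftE.
suff H r : {subset r <= dom f} -> all Q' (dom (\sum_(t <- r) coeff t f *: h t)) by apply: H.
elim: r => [|i r IH] rf; first by rewrite big_nil all_dom0.
rewrite big_cons; apply: all_dom_lin; first by apply/hh/hf/rf; rewrite inE eqxx.
by apply: IH => j jr; apply: rf; rewrite inE jr orbT.
Qed.

Lemma all_dom_fgmap (k : fieldType) (T T' : choiceType) (Q : pred T) (Q' : pred T')
    (h : T -> T') (f : {freeg T / k}) :
  all Q (dom f) -> (forall t, Q t -> Q' (h t)) -> all Q' (dom (fgmap h f)).
Proof.
by move=> hf hh; apply: all_dom_fglift hf _ => t /hh; rewrite all_domU.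
Qed.

Section GeneratedIdeal.
Variables (k : fieldType) (I : eqType) (Sig : signature I).

Lemma all_dom_graft (X Y Z : finType) (Q : pred (tree Sig X)) (Q' : pred (tree Sig Y))
    (Q'' : pred (tree Sig Z)) l (u : X -> Z) (v : Y -> Z)
    (f : {freeg (tree Sig X) / k}) (g : {freeg (tree Sig Y) / k}) :
  all Q (dom f) -> all Q' (dom g) -> (forall t s, Q t -> Q' s -> Q'' (graft l u v t s)) ->
  all Q'' (dom (graft_lin l u v f g)).
Proof.
move=> hf hg H; apply: all_dom_fglift hf _ => t ht.
by apply: all_dom_fglift hg _ => s hs; rewrite all_domU H.
Qed.

Lemma homogeneous_ideal : sym_ideal (fun X chi c f => @homogeneous k I Sig X chi c f).
Proof.
split=> //.
- move=> X chi c; split; first exact: all_dom0.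
  by move=> a u v; apply: all_dom_lin.
- move=> X Y chi psi c h f hf; apply: all_dom_fgmap hf _ => t; exact: monomial_tmap.
- move=> X Y Z chi psi xi c l u v f g guv gc hf hg.
  by apply: all_dom_graft hf hg _ => t s; apply: monomial_graft.
move=> X Y Z chi psi xi c l u v f g guv gc hf hg.
by apply: all_dom_graft hf hg _ => t s; apply: monomial_graft.
Qed.

Variable rels : seq (relation k I Sig).

Lemma sym_gen_rel r : List.In r rels ->
  sym_ideal_gen rels (@rel_col _ _ _ r) (rel_out r) (rel_elt r).
Proof. by move=> inr M _; apply. Qed.

Hypothesis rels_hom : forall r, List.In r rels ->
  homogeneous (@rel_col _ _ _ r) (rel_out r) (rel_elt r).

(** The closure properties pass to the intersection of all ideals containing the relations.
    Homogeneity requires that there is such an ideal, namely that of all homogeneous elements. *)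
Lemma sym_gen_ideal : sym_ideal (sym_ideal_gen rels).
Proof.
split.
- by move=> X chi c f /(_ _ homogeneous_ideal rels_hom).
- move=> X chi c; split=> [M iM _|a u v hu hv M iM hM].
    by case: (symi_subspace iM chi c).
  by case: (symi_subspace iM chi c) => _; apply; [apply: hu|apply: hv].
- by move=> X Y chi psi c h f hf M iM hM; apply: (symi_relabel iM); apply: hf.
- move=> X Y Z chi psi xi c l u v f g guv gc hf hg M iM hM.
  by apply: (symi_graftl iM guv gc) => //; apply: hf.
move=> X Y Z chi psi xi c l u v f g guv gc hf hg M iM hM.
by apply: (symi_graftr iM guv gc) => //; apply: hg.
Qed.
End GeneratedIdeal.

Section ShuffleGenerated.
Variables (k : fieldType) (I : eqType) (Sig : signature I) (R M0 : sh_family k Sig).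
Hypothesis idM0 : sh_ideal M0.
Hypothesis RM0 : forall m (psi : 'I_m -> I) d g, R psi d g -> M0 psi d g.

Lemma sh_gen_ideal : sh_ideal (sh_ideal_gen R).
Proof.
split.
- by move=> n chi c f /(_ M0 idM0 RM0); apply: (shi_hom idM0).
- move=> n chi c; split=> [M iM _|a u v hu hv M iM hM].
    by case: (shi_subspace iM chi c).
  by case: (shi_subspace iM chi c) => _; apply; [apply: hu|apply: hv].
- move=> n m p chi psi xi c l u v f g guv gc hf hg M iM hM.
  by apply: (shi_graftl iM guv gc) => //; apply: hf.
move=> n m p chi psi xi c l u v f g guv gc hf hg M iM hM.
by apply: (shi_graftr iM guv gc) => //; apply: hg.
Qed.
End ShuffleGenerated.

Lemma is_shuffle_shuf (Sig : signature colour) n (t : tree Sig 'I_n) :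
  is_shuffle t = shuf (tmap val t).
Proof. by elim: t => //= g a -> b ->; rewrite -!/(tmap _ _) !minl_tmap. Qed.

(** * Shuffle ideals obtained from symmetric ideals *)

Section Pullback.
Variables (k : fieldType) (s : seq lr_op) (M : sym_family k (lr_sig s)).
Hypothesis idM : sym_ideal M.

Definition pull : sh_family k (shs (sg_of s)) := fun n chi c f =>
  sh_homogeneous chi c f /\ M chi c (fgmap (@from_sh 'I_n) f).

Lemma sh_monomial_graft (sg : pred sh_op) n m p (chi : 'I_n -> colour) (psi : 'I_m -> colour)
    (xi : 'I_p -> colour) c l (u : 'I_n -> 'I_p) (v : 'I_m -> 'I_p) t t' :
  shuffle_grafting l u v -> graft_colours chi psi xi l u v ->
  @sh_monomial _ (shs sg) _ chi c t -> @sh_monomial _ (shs sg) _ psi (chi l) t' ->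
  @sh_monomial _ (shs sg) _ xi c (graft l u v t t').
Proof.
move=> guv gc /andP[ht st] /[dup] mt' /andP[ht' st'].
have [g _ _ _] := guv; rewrite /sh_monomial (monomial_graft g gc ht ht') /=.
rewrite is_shuffle_shuf (graft_gr guv).
have m0 : (0 < m)%N.
  have := perm_size (sh_monomial_perm mt'); rewrite size_iota leaves_tmap' size_map size_leaves.
  by move=> <-.
apply: shuf_gr.
- exact: minl_graft_r guv m0 _ (sh_monomial_perm mt').
- by rewrite (shuf_graft_l guv) -is_shuffle_shuf.
by rewrite (shuf_graft_r guv) -is_shuffle_shuf.
Qed.

Lemma from_sh_graft_lin n m p (l : 'I_n) (u : 'I_n -> 'I_p) (v : 'I_m -> 'I_p)
    (f : {freeg (tree sh_op 'I_n) / k}) (g : {freeg (tree sh_op 'I_m) / k}) :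
  fgmap (@from_sh _) (@graft_lin k _ (shs (sg_of s)) _ _ _ l u v f g) =
  @graft_lin k _ (lr_sig s) _ _ _ l u v (fgmap (@from_sh _) f) (fgmap (@from_sh _) g).
Proof.
move: f; apply: (freeg_ext (f := fun f => fgmap _ (@graft_lin k _ (shs (sg_of s)) _ _ _ l u v f g))
  (g := fun f => @graft_lin k _ (lr_sig s) _ _ _ l u v (fgmap _ f) _)) => [x y z|x y z|t].
- by rewrite /graft_lin fglift_linear fgmap_linear.
- by rewrite /graft_lin fgmap_linear fglift_linear.
rewrite /graft_lin fgmapU !liftU !scale1r.
move: g; apply: (freeg_ext (f := fun g => fgmap _ (fglift _ g))
  (g := fun g => fglift _ (fgmap _ g))) => [x y z|x y z|r].
- by rewrite fglift_linear fgmap_linear.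
- by rewrite fgmap_linear fglift_linear.
by rewrite fgmapU !liftU !scale1r fgmapU from_sh_graft.
Qed.

Lemma sh_homogeneous_from n (chi : 'I_n -> colour) c (f : {freeg (tree sh_op 'I_n) / k}) :
  @sh_homogeneous k _ (shs (sg_of s)) n chi c f ->
  @homogeneous k _ (lr_sig s) _ chi c (fgmap (@from_sh _) f).
Proof.
by move=> hf; apply: all_dom_fgmap hf _ => t /andP[ht _]; rewrite from_sh_monomial.
Qed.

Lemma pull_ideal : sh_ideal pull.
Proof.
split.
- by move=> n chi c f [].
- move=> n chi c; have [M0 ML] := symi_subspace idM chi c; split.
    by split; [apply: all_dom0|rewrite (lin0 (fgmap_linear _))].
  move=> a u v [hu Mu] [hv Mv]; split; first exact: all_dom_lin.
  by rewrite fgmap_linear; apply: ML.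
- move=> n m p chi psi xi c l u v f g guv gc [hf Mf] hg; split.
    by apply: all_dom_graft hf hg _ => t t'; apply: sh_monomial_graft.
  have [g1 _ _ _] := guv; rewrite from_sh_graft_lin.
  exact: (symi_graftl idM g1 gc Mf (sh_homogeneous_from hg)).
move=> n m p chi psi xi c l u v f g guv gc hf [hg Mg]; split.
  by apply: all_dom_graft hf hg _ => t t'; apply: sh_monomial_graft.
have [g1 _ _ _] := guv; rewrite from_sh_graft_lin.
exact: (symi_graftr idM g1 gc (sh_homogeneous_from hf) Mg).
Qed.

Hypothesis M_alpha : alpha \in s -> M (@rel_col _ _ _ (alpha_sym k)) colS (rel_elt (alpha_sym k)).
Hypothesis M_beta : beta \in s -> M (@rel_col _ _ _ (beta_skew k)) colL (rel_elt (beta_skew k)).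

Lemma sh_tree_monomial n (chi : 'I_n -> colour) c (t : tree lr_op 'I_n) :
  @monomial _ (lr_sig s) _ chi c t -> @sh_monomial _ (shs (sg_of s)) _ chi c (sh_tree t).
Proof.
move=> ht; have := monomial_from_shr val ht; rewrite from_sh_monomial shr_val => hs.
apply/andP; split=> //; rewrite is_shuffle_shuf.
have : uniq (leaves (tmap val t)).
  rewrite leaves_tmap' (map_inj_uniq val_inj); apply: count_mem_uniq => x.
  case/andP: ht => _ /forallP/(_ x)/eqP; rewrite -has_pred1 has_count => ->//.
have minE (r : tree lr_op 'I_n) : minl (tmap val (sh_tree r)) = minl (tmap val r).
  elim: r => //= g a IHa b IHb; rewrite -!/(tmap _ _); case: ifP => _ /=;
  by rewrite -!/(tmap _ _) IHa IHb // minnC.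
elim: t {ht hs} => //= g a IHa b IHb; rewrite -!/(tmap _ _) cat_uniq => /and3P[ua dis ub].
case: ifP => [lt|nlt] /=; rewrite -!/(tmap _ _) !minE ?minl_tmap IHa // IHb // !andbT //.
rewrite ltn_neqAle leqNgt nlt andbT; apply: contraNneq dis => e; apply/hasP.
exists (minl (tmap val b)); first exact: minl_in.
by rewrite /= minl_tmap e -minl_tmap minl_in.
Qed.

(** By [straighten] every tree of f differs from its signed shuffle form by an element of [M], so f
    and the interpretation of [to_shuffle f] agree modulo [M]. *)
Lemma pull_to_shuffle n (chi : 'I_n -> colour) c (f : {freeg (tree lr_op 'I_n) / k}) :
  M chi c f -> pull chi c (to_shuffle f).
Proof.
move=> Mf; have hf := symi_hom idM Mf; split.
  apply: all_dom_fglift hf _ => t ht; apply/allP => r.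
  rewrite mem_dom coeffU; case: (sh_tree t =P r) => [<- _|_].
    exact: sh_tree_monomial.
  by rewrite mulr0 eqxx.
have [M0 ML] := symi_subspace idM chi c.
suff : M chi c (f - fgmap (@from_sh _) (to_shuffle f)).
  move=> h; have := ML (-1) _ _ h Mf.
  by rewrite scaleN1r opprB subrK.
rewrite {1}[f]freegE /to_shuffle fgliftE (lin_sum _ _ (fgmap_linear _)) -sumrB.
suff H r : {subset r <= dom f} -> M chi c (\sum_(i <- r) (coeff i f *: << i >> -
    fgmap (@from_sh _) (coeff i f *: << sh_sign k i *g sh_tree i >>))) by apply: H.
elim: r => [|t r IH] rf; first by rewrite big_nil.
rewrite big_cons; have {}IH : M chi c _ := IH (fun x h => rf x (@mem_behead _ (t :: r) x h)).
rewrite (linZ _ _ (fgmap_linear _)) fgmapUg -scalerBr; apply: ML => //.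
have := straighten idM M_alpha M_beta val (allP hf t (rf t (mem_head _ _))).
rewrite rsign_val shr_val; congr (M _ _ (_ - _)).
by apply/eqP/freeg_eqP => z; rewrite coeffZ !coeffU mul1r.
Qed.
End Pullback.

(** * Reduction to normal monomials in a fixed arity *)

Section OrdinalLabels.
Variables (k : fieldType) (sg : pred sh_op) (F : sh_family k (shs sg)).
Hypothesis idF : sh_ideal F.
Hypothesis rules : has_rules F.
Variables (n : nat) (chi : 'I_n -> colour) (c : colour).
Implicit Types (t s : tree sh_op 'I_n).
Local Notation mono := (@sh_monomial _ (shs sg) n chi c).

Definition olt s t := tlt (iota 0 n) (tmap val s) (tmap val t).
Definition onormal t := normal (tmap val t).

Lemma olt_irr t : olt t t = false. Proof. exact: tlt_irr. Qed.
Lemma olt_trans t s r : olt t s -> olt s r -> olt t r. Proof. exact: tlt_trans. Qed.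

Lemma Fh_ord (chi' : nat -> colour) (A : seq nat) m (la : 'I_m -> nat) f :
  size A = m -> (forall i : 'I_m, la i = nth 0%N A i) -> Fh F chi' c A f ->
  exists2 f', fgmap (tmap la) f' = f & F (chi' \o la) c f'.
Proof.
move=> e; case: _ / e in la * => laE [f' e Ff'].
have -> : la = @lab A by apply: funext => i; rewrite laE.
by exists f'.
Qed.

Lemma Lead_ord t : mono t -> ~~ onormal t ->
  exists f, [/\ F chi c f, coeff t f != 0 & forall s, s \in dom f -> s != t -> olt s t].
Proof.
move=> mt nt; have pt := sh_monomial_perm mt.
have slt : sl (tmap val t) = iota 0 n by apply: sl_perm pt; apply: iota_ltn_sorted.
pose chi' j := oapp chi colS (insub j).
have chiE : chi' \o val = chi.
  apply: funext => i /=; rewrite /chi' insubT ?ltn_ord // => lt /=.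
  by congr chi; apply: val_inj.
have wt : wf sg chi' c (tmap val t).
  case/andP: mt => /andP[ht _] st; apply/and3P; split; last by rewrite -(is_shuffle_shuf (Sig := shs sg)).
    by rewrite -typed_lab chiE.
  by rewrite (perm_uniq pt) iota_uniq.
have [f [Ff cf lf]] := Lead_nonnormal idF rules wt nt.
rewrite slt in Ff lf.
have [i|f' e Ff'] := @Fh_ord chi' _ n val f (size_iota 0 n) _ Ff.
  by rewrite nth_iota.
subst f; exists f'; rewrite chiE in Ff'; split=> //.
  by rewrite -(coeff_fgmap (h := tmap val)) // => s _ /(tmap_inj val_inj).
move=> s sf ne; apply: lf; last by rewrite (inj_eq (tmap_inj val_inj)).
rewrite mem_dom (coeff_fgmap (h := tmap val)) -?mem_dom // => s' _.
exact: (tmap_inj val_inj).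
Qed.

Fixpoint all_trees (d : nat) : seq (tree sh_op 'I_n) :=
  let lv := [seq Leaf i | i <- enum 'I_n] in
  if d is e.+1 then
    lv ++ [seq Node g ab.1 ab.2 | g <- [:: sh_alpha; sh_beta; sh_d; sh_e; sh_m; sh_n],
           ab <- allpairs pair (all_trees e) (all_trees e)]
  else lv.

Lemma all_treesP d t : (nvertices t <= d)%N -> t \in all_trees d.
Proof.
have lv i : (Leaf i : tree sh_op 'I_n) \in [seq Leaf i | i <- enum 'I_n].
  by apply: map_f; rewrite mem_enum.
elim: d t => [|d IH] [i|g a b] // le; first by rewrite mem_cat lv.
rewrite /= in le; rewrite mem_cat; apply/orP; right; apply/allpairsPdep; exists g, (a, b); split=> //=.
  by case: (g).
by apply/allpairsPdep; exists a, b; split=> //; apply: IH; lia.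
Qed.

(** A monomial with n leaves has n - 1 vertices, so all monomials of arity n lie in one finite list.
    The number of members of the list below t is the measure of the induction. *)
Lemma olt_ind (Q : tree sh_op 'I_n -> Prop) :
  (forall t, mono t -> (forall s, mono s -> olt s t -> Q s) -> Q t) ->
  forall t, mono t -> Q t.
Proof.
move=> H t mt; pose E := all_trees n.
have mE s : mono s -> s \in E.
  move=> ms; apply: all_treesP; have := perm_size (sh_monomial_perm ms).
  rewrite size_iota leaves_tmap' size_map size_leaves => e.
  have {}e : (nvertices s).+1 = n := e.
  by lia.
have [m] := ubnP (count (olt^~ t) E); elim: m t mt => // m IH t mt lt.
apply: H => // s ms st; apply: IH => //; rewrite ltnS in lt; apply: leq_trans lt.
have sub : subpred (olt^~ s) (olt^~ t) by move=> r /= rs; apply: olt_trans st.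
have : has (predD (olt^~ t) (olt^~ s)) E.
  by apply/hasP; exists s; rewrite ?mE //= olt_irr st.
rewrite has_count => pos.
have -> : count (olt^~ t) E = (count (olt^~ s) E + count (predD (olt^~ t) (olt^~ s)) E)%N.
  rewrite -count_predUI -[LHS]addn0; congr (_ + _)%N.
    by apply: eq_count => r /=; case rs: (olt r s); rewrite ?(sub r rs).
  by symmetry; apply/eqP; rewrite -leqn0 leqNgt -has_count; apply/hasPn => r _ /=; case: (olt r s).
by rewrite -addn1 leq_add2l.
Qed.

Definition spanned (f : {freeg (tree sh_op 'I_n) / k}) :=
  exists2 g, all (fun t => mono t && onormal t) (dom g) & F chi c (f - g).

Let F0 : F chi c 0. Proof. by case: (shi_subspace idF chi c). Qed.
Let FL a u v : F chi c u -> F chi c v -> F chi c (a *: u + v).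
Proof. by case: (shi_subspace idF chi c) => _; apply. Qed.

Lemma spanned_lin a f1 f2 : spanned f1 -> spanned f2 -> spanned (a *: f1 + f2).
Proof.
move=> [g1 n1 F1] [g2 n2 F2]; exists (a *: g1 + g2); first exact: all_dom_lin.
have -> : a *: f1 + f2 - (a *: g1 + g2) = a *: (f1 - g1) + (f2 - g2).
  by rewrite scalerBr opprD addrACA.
exact: FL.
Qed.

Lemma spanned_dom f : (forall t, t \in dom f -> spanned << t >>) -> spanned f.
Proof.
move=> H; rewrite [f]freegE.
suff G r : {subset r <= dom f} -> spanned (\sum_(t <- r) coeff t f *: << t >>) by apply: G.
elim: r => [|t r IH] rf; first by rewrite big_nil; exists 0; rewrite ?dom0 // subrr.
rewrite big_cons; apply: spanned_lin; first by apply/H/rf; rewrite inE eqxx.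
by apply: IH => s sr; apply: rf; rewrite inE sr orbT.
Qed.

Lemma spanned_mono t : mono t -> spanned << t >>.
Proof.
apply: (olt_ind (Q := fun t => spanned << t >>)) t => t mt IH.
have [nt|nt] := boolP (onormal t).
  by exists << t >>; rewrite ?subrr ?all_domU ?mt.
have [f [Ff cf lf]] := Lead_ord mt nt.
have [g ng Fg] : spanned (<< t >> - (coeff t f)^-1 *: f).
  apply: spanned_dom => s; rewrite mem_dom coeffB coeffZ coeffU mul1r.
  have [<-|ne] := eqVneq t s; first by rewrite mulVf // subrr eqxx.
  rewrite sub0r oppr_eq0 mulf_eq0 negb_or -mem_dom => /andP[_ sf].
  apply: IH; last by apply: lf => //; rewrite eq_sym.
  exact: (allP (shi_hom idF Ff)).
exists g => //; have -> : << t >> - g = (coeff t f)^-1 *: f + (<< t >> - (coeff t f)^-1 *: f - g).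
  by rewrite [X in _ = _ + X]addrAC [RHS]addrC subrK.
exact: FL.
Qed.

(* A normal monomial detected by a functional that kills F is not a leading
   term: the functional vanishes on all smaller monomials. *)
Lemma leading_not_normal (phi : {freeg (tree sh_op 'I_n) / k} -> k^o) t :
  linear phi -> (forall f, F chi c f -> phi f = 0) ->
  (forall s, mono s -> onormal s -> phi << s >> = (s == t)%:R) ->
  mono t -> onormal t ->
  forall f, F chi c f -> t \in dom f -> (forall s, s \in dom f -> s != t -> olt s t) -> False.
Proof.
move=> Lphi kill delta mt nt f Ff tf lf.
have phiE g : phi g = \sum_(s <- dom g) coeff s g *: phi << s >>.
  by rewrite {1}[g]freegE (lin_sum _ _ Lphi); apply: eq_bigr => s _; rewrite (linZ _ _ Lphi).
have small s : mono s -> olt s t -> phi << s >> = 0.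
  apply: (olt_ind (Q := fun s => olt s t -> phi << s >> = 0)) s => s ms IH st.
  have [ns|ns] := boolP (onormal s).
    rewrite delta //; case: eqP => // e; by rewrite e olt_irr in st.
  have [g [Fg cg lg]] := Lead_ord ms ns.
  have := kill _ Fg; rewrite phiE (bigD1_seq s) ?uniq_dom ?mem_dom //= big1_seq.
    by rewrite addr0 => /eqP; rewrite scaler_eq0 (negPf cg) => /eqP.
  move=> r /andP[ne rg]; have rs := lg r rg ne.
  rewrite IH ?scaler0 //; first exact: (allP (shi_hom idF Fg)).
  exact: olt_trans st.
have := kill _ Ff; rewrite phiE (bigD1_seq t) ?uniq_dom //= big1_seq.
  rewrite delta // eqxx addr0 => /eqP; rewrite scaler_eq0 oner_eq0 orbF.
  by rewrite (negPf (_ : coeff t f != 0)) // -mem_dom.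
move=> s /andP[ne sf]; rewrite small ?scaler0 //; last exact: lf.
exact: (allP (shi_hom idF Ff)).
Qed.
End OrdinalLabels.

Section RulesOfPull.
Variables (k : fieldType) (s : seq lr_op) (M : sym_family k (lr_sig s)).
Variable rels : seq (relation k colour lr_op).
Hypothesis idM : sym_ideal M.
Hypothesis M_rels : forall r, List.In r rels -> M (@rel_col _ _ _ r) (rel_out r) (rel_elt r).
Hypothesis in_alpha_sym : alpha \in s -> List.In (alpha_sym k) rels.
Hypothesis in_beta_skew : beta \in s -> List.In (beta_skew k) rels.
Hypothesis in_alpha_assoc : alpha \in s -> List.In (alpha_assoc k) rels.
Hypothesis in_beta_jacobi : beta \in s -> List.In (beta_jacobi k) rels.
Hypothesis in_d_leibniz : alpha \in s -> opd \in s -> List.In (d_leibniz k) rels.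
Hypothesis in_d_action : opd \in s -> beta \in s -> List.In (d_action k) rels.
Hypothesis in_d_anchor : opd \in s -> opm \in s -> List.In (d_anchor k) rels.
Hypothesis in_m_module : opm \in s -> List.In (m_module k) rels.
Hypothesis in_beta_leibniz : beta \in s -> opm \in s -> List.In (beta_leibniz k) rels.

Let Ma (h : alpha \in s) := M_rels (in_alpha_sym h).
Let Mb (h : beta \in s) := M_rels (in_beta_skew h).

Lemma pull_rel (r : relation k colour lr_op) (p : {perm 'I_(rel_arity r)}) :
  List.In r rels -> pull M (fun i => rel_col ((p^-1)%g i)) (rel_out r)
    (to_shuffle (fgmap (tmap p) (rel_elt r))).
Proof.
move=> inr; apply: (pull_to_shuffle idM Ma Mb).
exact: (symi_relabel idM (cbij_perm (@rel_col _ _ _ r) p) (M_rels inr)).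
Qed.

Lemma pull_rules : has_rules (pull M).
Proof.
by apply: (rule_table pull_rel); rewrite /sg_of /= ?orbb.
Qed.
End RulesOfPull.

Lemma fglift_graft (k : fieldType) (I : eqType) (Sig : signature I) (X Y Z : finType)
    (W : lmodType k) (phi : tree Sig Z -> W) l (u : X -> Z) (v : Y -> Z)
    (f : {freeg (tree Sig X) / k}) (g : {freeg (tree Sig Y) / k}) :
  fglift phi (graft_lin l u v f g) =
  \sum_(t <- dom f) \sum_(s <- dom g) (coeff t f * coeff s g) *: phi (graft l u v t s).
Proof.
have L := fglift_linear phi.
rewrite /graft_lin [fglift _ f]fgliftE (lin_sum _ _ L); apply: eq_bigr => t _.
rewrite (linZ _ _ L) [fglift _ g]fgliftE (lin_sum _ _ L) scaler_sumr.
by apply: eq_bigr => s _; rewrite (linZ _ _ L) liftU scale1r scalerA.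
Qed.

(** * Derivations of polynomial rings *)

Section DerivationModel.
Variables (k : fieldType) (A : comAlgType k).

(* Derivations of A form a Lie-Rinehart algebra over A. *)
Definition derivation (D : A -> A) : Prop :=
  linear D /\ forall x y, D (x * y) = D x * y + x * D y.

(** Each tree receives both an element and an operator, so that values are defined without reference
    to typing; at a vertex the component of the wrong colour is 0, which is also a derivation. *)
Fixpoint ev (X : Type) (rS : X -> A) (rL : X -> A -> A) (t : tree lr_op X) : A * (A -> A) :=
  match t with
  | Leaf x => (rS x, rL x)
  | Node g a b =>
      let ea := ev rS rL a in let eb := ev rS rL b in
      match g with
      | alpha => (ea.1 * eb.1, fun=> 0)
      | beta => (0, fun p => ea.2 (eb.2 p) - eb.2 (ea.2 p))
      | opd => (eb.2 ea.1, fun=> 0)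
      | opm => (0, fun p => ea.1 * eb.2 p)
      end
  end.

Definition evc (c : colour) (p : A) (e : A * (A -> A)) : A :=
  if c is colS then e.1 else e.2 p.

Lemma derivation0 : derivation (fun=> 0).
Proof. by split=> [a x y|x y]; rewrite ?scaler0 ?mul0r ?mulr0 addr0. Qed.

Lemma derivation_ev X (rS : X -> A) rL t :
  (forall x, derivation (rL x)) -> derivation (ev rS rL t).2.
Proof.
move=> H; elim: t => [x|g a [aL aD] b [bL bD]] //=; case: g => /=; try exact: derivation0.
  split=> [e x y|x y].
    rewrite (bL e x y) (aL e x y) (aL e) (bL e) scalerBr.
    by rewrite opprD addrACA.
  by rewrite bD aD (linD aL) (linD bL) !aD !bD mulrBr mulrBl; ring.
split=> [e x y|x y].
  by rewrite (bL e x y) mulrDr scalerAr.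
by rewrite bD mulrDr mulrA mulrCA.
Qed.

Lemma ev_tmap X Y (h : X -> Y) (rS : Y -> A) rL t :
  ev rS rL (tmap h t) = ev (rS \o h) (rL \o h) t.
Proof. by elim: t => //= g a IHa b IHb; rewrite -!/(tmap _ _) IHa IHb. Qed.

Lemma ev_graft (X : eqType) Y Z l (u : X -> Z) (v : Y -> Z) (rS : Z -> A) rL t s :
  let e := ev (rS \o v) (rL \o v) s in
  ev rS rL (graft l u v t s) =
  ev (fun x => if x == l then e.1 else rS (u x)) (fun x => if x == l then e.2 else rL (u x)) t.
Proof.
move=> e; elim: t => [x|g a IHa b IHb] /=.
  by rewrite /graft /=; case: eqP => // _; rewrite ev_tmap -/e; case: (e).
by rewrite -!/(graft _ _ _ _ _) IHa IHb.
Qed.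

Lemma eq_in_ev (X : eqType) (rS rS' : X -> A) rL rL' t :
  {in leaves t, rS =1 rS'} -> {in leaves t, rL =1 rL'} -> ev rS rL t = ev rS' rL' t.
Proof.
elim: t => [x|g a IHa b IHb] /= H H'; first by rewrite H ?H' ?inE.
by rewrite IHa ?IHb // => x hx; (apply: H || apply: H'); rewrite mem_cat hx ?orbT.
Qed.

Section Vanishing.
Variable s : seq lr_op.
Local Notation Sig := (lr_sig s).

Definition vanishing : sym_family k Sig := fun X chi c f =>
  homogeneous chi c f /\
  forall (rS : X -> A) (rL : X -> A -> A) p, (forall x, derivation (rL x)) ->
    \sum_(t <- dom f) coeff t f *: evc c p (ev rS rL t) = 0.

Lemma vanishingE (X : finType) (chi : X -> colour) c f : @vanishing X chi c f <->
  homogeneous chi c f /\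
  forall (rS : X -> A) (rL : X -> A -> A) p, (forall x, derivation (rL x)) ->
    fglift (fun t => evc c p (ev rS rL t)) f = 0.
Proof. by split=> -[h H]; split=> // rS rL p D; have := H rS rL p D; rewrite fgliftE. Qed.

(** A context in which l occurs once is linear in the value at l, while branches without l have
    constant values. The claim is made for all p at once because inside a bracket the operator of a
    branch is applied to arguments other than p. *)
Lemma evc_multilinear (X Y Z : finType) (chi : X -> colour) d l (u : X -> Z) (v : Y -> Z)
    (rS : Z -> A) rL (J : Type) (r : seq J) (a : J -> k) (g : J -> tree lr_op Y) t :
  (forall x, derivation (rL x)) ->
  @typed _ Sig X chi d t -> count_mem l (leaves t) = 1%N ->
  (forall p, \sum_(j <- r) a j *: evc (chi l) p (ev (rS \o v) (rL \o v) (g j)) = 0) ->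
  forall p, \sum_(j <- r) a j *: evc d p (ev rS rL (graft l u v t (g j))) = 0.
Proof.
move=> D + + H; elim: t d => [x|h b IHb c IHc] d.
  rewrite /= /graft /= => /eqP ed; case: eqP => //= e _ p; subst x d.
  by rewrite -[RHS](H p); apply: eq_bigr => j _; rewrite ev_tmap.
move=> /and4P[_ /eqP ed tb tc]; rewrite /= count_cat => cnt p.
have out t' : count_mem l (leaves t') = 0%N -> forall j,
    ev rS rL (graft l u v t' (g j)) = ev (rS \o u) (rL \o u) t'.
  move=> c0 j; rewrite ev_graft; have lt' : l \notin leaves t'.
    by rewrite -has_pred1 has_count c0.
  by apply: eq_in_ev => x xt; have [e|//] := eqVneq x l; rewrite -e xt in lt'.
have Db j := derivation_ev rS (graft l u v b (g j)) D.
have Dc j := derivation_ev rS (graft l u v c (g j)) D.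
have [[cb cc]|[cb cc]] : (count_mem l (leaves b) = 1 /\ count_mem l (leaves c) = 0 \/
  count_mem l (leaves b) = 0 /\ count_mem l (leaves c) = 1)%N.
  by move: cnt; case: (count_mem l (leaves b)) => [|[|m]] //=; [right|left]; split=> //; lia.
  have {}IHb := IHb _ tb cb; have {}out := out c cc.
  have [Lc _] := derivation_ev (rS \o u) c (fun x => D (u x)).
  subst d; case: h tb tc IHb => /= tb tc IHb; rewrite /evc /= in IHb *.
  - under eq_bigr => j _ do rewrite out scalerAl.
    by rewrite -mulr_suml (IHb 0) mul0r.
  - under eq_bigr => j _ do rewrite out scalerBr.
    rewrite sumrB (IHb _) sub0r.
    under eq_bigr => j _ do rewrite -(linZ _ _ Lc).
    by rewrite -(lin_sum _ _ Lc) (IHb p) (lin0 Lc) oppr0.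
  - under eq_bigr => j _ do rewrite out -(linZ _ _ Lc).
    by rewrite -(lin_sum _ _ Lc) (IHb 0) (lin0 Lc).
  - under eq_bigr => j _ do rewrite out scalerAl.
    by rewrite -mulr_suml (IHb 0) mul0r.
have {}IHc := IHc _ tc cc; have {}out := out b cb.
have [Lb _] := derivation_ev (rS \o u) b (fun x => D (u x)).
subst d; case: h tb tc IHc => /= tb tc IHc; rewrite /evc /= in IHc *.
- under eq_bigr => j _ do rewrite out scalerAr.
  by rewrite -mulr_sumr (IHc 0) mulr0.
- under eq_bigr => j _ do rewrite out scalerBr.
  rewrite sumrB (IHc _) subr0.
  under eq_bigr => j _ do rewrite -(linZ _ _ Lb).
  by rewrite -(lin_sum _ _ Lb) (IHc p) (lin0 Lb).
- by under eq_bigr => j _ do rewrite out; apply: IHc.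
under eq_bigr => j _ do rewrite out scalerAr.
by rewrite -mulr_sumr (IHc p) mulr0.
Qed.

(** If a tree is grafted into an element of the family, its value becomes the assignment at the leaf
    l; this is allowed because the values of trees are again derivations. If an element of the
    family is grafted into a tree, [evc_multilinear] applies. *)
Lemma vanishing_ideal : sym_ideal vanishing.
Proof.
split.
- by move=> X chi c f [].
- move=> X chi c; split.
    by apply/vanishingE; split=> [|rS rL p D]; [apply: all_dom0|rewrite (lin0 (fglift_linear _))].
  move=> a f g /vanishingE[hf Vf] /vanishingE[hg Vg]; apply/vanishingE.
  split=> [|rS rL p D]; first exact: all_dom_lin.
  by rewrite fglift_linear Vf ?Vg // scaler0 addr0.
- move=> X Y chi psi c h f /vanishingE[hf Vf]; apply/vanishingE.
  split=> [|rS rL p D].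
    by apply: all_dom_fgmap hf _ => t; exact: monomial_tmap.
  rewrite -[RHS](Vf (rS \o h) (rL \o h) p (fun x => D (h x))).
  move: f {hf Vf}; apply: (freeg_ext (f := fun f => fglift _ (relabel _ f))) => [a f g|a f g|t].
  - by rewrite /relabel fgmap_linear fglift_linear.
  - by rewrite fglift_linear.
  by rewrite /relabel fgmapU !liftU ev_tmap.
- move=> X Y Z chi psi xi c l u v f g guv gc /vanishingE[hf Vf] hg; apply/vanishingE.
  split=> [|rS rL p D].
    by apply: all_dom_graft hf hg _ => t t'; apply: monomial_graft.
  rewrite (@fglift_graft k _ Sig) exchange_big big1 // => t' _ /=.
  have De := derivation_ev (rS \o v) t' (fun y => D (v y)).
  pose e := ev (rS \o v) (rL \o v) t'.
  have := Vf (fun x => if x == l then e.1 else rS (u x)) (fun x => if x == l then e.2 else rL (u x)) p.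
  rewrite fgliftE => H; rewrite -[RHS](scaler0 _ (coeff t' g)) -[X in _ = _ *: X]H => [|x].
    rewrite scaler_sumr; apply: eq_bigr => t _.
    by rewrite scalerA mulrC ev_graft.
  by case: eqP => _; [apply: De|apply: D].
move=> X Y Z chi psi xi c l u v f g guv gc hf /vanishingE[hg Vg]; apply/vanishingE.
split=> [|rS rL p D].
  by apply: all_dom_graft hf hg _ => t t'; apply: monomial_graft.
rewrite (@fglift_graft k _ Sig) big1_seq // => t /andP[_ tf].
under eq_bigr => t' _ do rewrite -scalerA.
rewrite -scaler_sumr.
have /andP[tt /forallP/(_ l)/eqP cl] := allP hf t tf.
rewrite (evc_multilinear u D tt cl) ?scaler0 // => q.
by have := Vg (rS \o v) (rL \o v) q (fun y => D (v y)); rewrite fgliftE.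
Qed.
End Vanishing.

Lemma vanishing_rels r : List.In r (lr_rels_full k) ->
  @vanishing [:: alpha; beta; opd; opm] _ (@rel_col _ _ _ r) (rel_out r) (rel_elt r).
Proof.
move=> inr; apply/vanishingE; split; first exact: lr_rels_hom.
move=> rS rL p D; move: inr rS rL D; rewrite /lr_rels_full /lr_relations /=.
have L (T : choiceType) (h : T -> A) := fglift_linear (k := k) h.
have DM X (rL : X -> A -> A) : (forall x, derivation (rL x)) ->
  forall i x y, rL i (x * y) = rL i x * y + x * rL i y by move=> D i; case: (D i).
have DD X (rL : X -> A -> A) : (forall x, derivation (rL x)) ->
  forall i x y, rL i (x + y) = rL i x + rL i y by move=> D i x y; case: (D i) => /linD.
have DN X (rL : X -> A -> A) : (forall x, derivation (rL x)) ->
  forall i x, rL i (- x) = - rL i x.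
  by move=> D i x; case: (D i) => DL _; rewrite -scaleN1r (linZ _ _ DL) scaleN1r.
do 9![case=> [<-|]; first
  by move=> rS rL D /=; rewrite ?(linB (L _ _), linD (L _ _)) !liftU !scale1r /= ?(DM _ rL D, DD _ rL D, DN _ rL D); ring].
by [].
Qed.
End DerivationModel.

(** * The polynomial ring on which the generators act freely *)

Section PolynomialModel.
Variables (k : fieldType) (n : nat).
Local Notation V := (option 'I_n * n.-bseq 'I_n)%type.
Local Notation N := #|{: V}|.
Local Notation A := {mpoly k[N]}.

(* The variable Y x w stands for the image of a generator x under the
   derivations of the word w; None is an additional generator, on which the
   derivations are evaluated. *)
Definition vidx (x : option 'I_n) (w : seq 'I_n) : 'I_N := enum_rank (x, insub_bseq n w).
Definition vdec (i : 'I_N) : option 'I_n * seq 'I_n :=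
  ((enum_val i).1, bseqval (enum_val i).2).
Definition Y x w : A := 'X_(vidx x w).

Lemma vidxK x w : (size w <= n)%N -> vdec (vidx x w) = (x, w).
Proof.
move=> le; rewrite /vdec /vidx enum_rankK /=; congr pair.
by rewrite /insub_bseq insubdK.
Qed.

(** Words have length at most n so that there are finitely many variables. A word that becomes too
    long is replaced by a default one; [Dl] is a derivation all the same, and the words produced by
    trees with n leaves never exceed the bound. *)
Definition Dl (l : 'I_n) (p : A) : A :=
  \sum_(i < N) Y (vdec i).1 (l :: (vdec i).2) * mderiv i p.

Lemma Dl_derivation l : derivation (Dl l).
Proof.
split=> [a x y|x y]; rewrite /Dl.
  rewrite scaler_sumr -big_split; apply: eq_bigr => i _ /=.
  by rewrite mderivD mderivZ mulrDr scalerAr.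
rewrite mulr_suml mulr_sumr -big_split; apply: eq_bigr => i _ /=.
by rewrite mderivM; ring.
Qed.

Lemma Dl_Y l x w : (size w < n)%N -> Dl l (Y x w) = Y x (l :: w).
Proof.
move=> lt; rewrite /Dl (bigD1 (vidx x w)) // vidxK ?(ltnW lt) // big1 => [|i ne].
  have e (m : 'X_{1..N}) : (m - m = 0)%MM by rewrite -{1}[m]add0m addmK.
  rewrite /Y mderivX mnm1E eqxx scale1r e mpolyX0 mulr1 -/(Y _ _); apply: addr0.
by rewrite /Y mderivX mnm1E eq_sym (negPf ne) scale0r mulr0.
Qed.

Definition ymon (s : seq (option 'I_n * seq 'I_n)) : 'X_{1..N} :=
  (\sum_(p <- s) U_(vidx p.1 p.2))%MM.

Lemma prod_Y s : \prod_(p <- s) Y p.1 p.2 = 'X_[ymon s].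
Proof.
rewrite /ymon; elim: s => [|p s IH]; first by rewrite !big_nil mpolyX0.
by rewrite !big_cons mpolyXD IH.
Qed.

Lemma mon_inj s s' : all (fun p => size p.2 <= n)%N s -> all (fun p => size p.2 <= n)%N s' ->
  ymon s = ymon s' -> perm_eq s s'.
Proof.
move=> hs hs' e.
have cnt (r : seq (option 'I_n * seq 'I_n)) i :
    ymon r i = count_mem i [seq vidx p.1 p.2 | p <- r].
  rewrite /ymon mnm_sumE; elim: r => [|p r IH]; first by rewrite big_nil.
  by rewrite big_cons IH mnm1E /=.
have dec (r : seq (option 'I_n * seq 'I_n)) : all (fun p => size p.2 <= n)%N r ->
    [seq vdec i | i <- [seq vidx p.1 p.2 | p <- r]] = r.
  elim: r => //= -[x w] r IH /andP[h /IH ->]; by rewrite vidxK.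
rewrite -(dec s hs) -(dec s' hs'); apply: perm_map.
by apply/allP => i _ /=; rewrite -!cnt e.
Qed.
End PolynomialModel.

(* Normal monomials: products of towers of derivations with output S, Lie
   words, and products of both. *)
Section NormalShapes.
Variable n : nat.
Implicit Types (t a b : tree sh_op 'I_n) (x l : 'I_n) (w : seq 'I_n).
Local Notation min t := (minl (tmap val t)).

Inductive Tower : tree sh_op 'I_n -> 'I_n -> seq 'I_n -> Prop :=
| TowerLeaf x : Tower (Leaf x) x [::]
| TowerD a x w l : Tower a x w -> Tower (Node sh_d a (Leaf l)) x (l :: w)
| TowerE a x w l : Tower a x w -> Tower (Node sh_e (Leaf l) a) x (l :: w).

Inductive Comb : tree sh_op 'I_n -> seq ('I_n * seq 'I_n) -> Prop :=
| Comb1 t x w : Tower t x w -> Comb t [:: (x, w)]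
| CombA a b s x w : Comb a s -> Tower b x w -> Comb (Node sh_alpha a b) (rcons s (x, w)).

Inductive LieWord : tree sh_op 'I_n -> 'I_n -> seq 'I_n -> Prop :=
| LieLeaf x : LieWord (Leaf x) x [::]
| LieB a x w l : LieWord a x w -> LieWord (Node sh_beta a (Leaf l)) x (rcons w l).

Inductive LNormal : tree sh_op 'I_n -> seq ('I_n * seq 'I_n) -> 'I_n -> seq 'I_n -> Prop :=
| LNormalLie t x w : LieWord t x w -> LNormal t [::] x w
| LNormalM a b s x w : Comb a s -> LieWord b x w -> LNormal (Node sh_m a b) s x w
| LNormalN a b s x w : LieWord a x w -> Comb b s -> LNormal (Node sh_n a b) s x w.

Lemma Comb_neq0 t s : Comb t s -> s <> [::].
Proof. by case=> // a b [|p s'] x w. Qed.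

(** The word determines which derivation is outermost, and the shuffle condition whether it is
    written with d or with e. *)
Lemma Tower_inj t t' x w : Tower t x w -> Tower t' x w ->
  shuf (tmap val t) -> shuf (tmap val t') -> t = t'.
Proof.
move=> T; elim: T t' => {t x w} [x|a x w l T IH|a x w l T IH] t' T';
  inversion T' as [y|a' y w' l' T1|a' y w' l' T1]; subst => //=;
  rewrite -!/(tmap _ _) ?andbT => /andP[h1 h2] /andP[h3 h4].
- by rewrite (IH _ T1).
- by move: h1; rewrite (IH _ T1) // ltnNge (ltnW h3).
- by move: h1; rewrite (IH _ T1) // ltnNge (ltnW h3).
by rewrite (IH _ T1).
Qed.

Lemma Tower_leaves t x w : Tower t x w -> perm_eq (leaves t) (x :: w).
Proof.
have P l y v : perm_eq (y :: l :: v) (l :: y :: v).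
  by rewrite -[_ :: l :: v]/([:: y] ++ [:: l] ++ v) perm_catCA.
elim=> {t x w} [x|a x w l _ IH|a x w l _ IH] //=; rewrite (permPr (P _ _ _)).
  by rewrite perm_catC /= perm_cons.
by rewrite perm_cons.
Qed.

Lemma LieWord_leaves t x w : LieWord t x w -> leaves t = x :: w.
Proof. by elim=> {t x w} [x|a x w l _ IH] //=; rewrite IH /= cats1. Qed.

Lemma LieWord_inj t t' x w : LieWord t x w -> LieWord t' x w -> t = t'.
Proof.
move=> L; elim: L t' => {t x w} [x|a x w l L IH] t' L'.
  inversion L' as [|a' x' w' l' L1 e1 e2 e3] => //.
  by case: (w') e3.
inversion L' as [y e1 e2 e3|a' x' w' l' L1 e1 e2 e3]; first by case: (w) e3.
by have [ew ->] := rcons_inj e3; subst w'; rewrite (IH a').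
Qed.
End NormalShapes.

Section NormalForms.
Variable n : nat.
Implicit Types (t a b : tree sh_op 'I_n) (x l : 'I_n) (w : seq 'I_n).
Local Notation min t := (minl (tmap val t)).

Definition pmin (p : 'I_n * seq 'I_n) : nat := foldr (fun l m => minn (val l) m) (val p.1) p.2.

Lemma Tower_min t x w : Tower t x w -> min t = pmin (x, w).
Proof.
by elim=> {t x w} [x|a x w l _ IH|a x w l _ IH] //=; rewrite -!/(tmap _ _) IH // minnC.
Qed.

Definition psorted (s : seq ('I_n * seq 'I_n)) := sorted ltn (map pmin s).

Lemma Comb_sorted t s : Comb t s -> shuf (tmap val t) -> normal (tmap val t) ->
  psorted s /\ min t = head 0%N (map pmin s).
Proof.
elim=> {t s} [t x w T _ _|a b s x w C IH T]; first by rewrite (Tower_min T).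
rewrite /= -!/(tmap _ _) => /and3P[lt sa sb] /andP[nb /andP[na _]].
have [srt ma] := IH sa na.
have s0 := Comb_neq0 C; rewrite /psorted map_rcons.
split; last first.
  by move: ma lt; case: (s) s0 => //= p s' _ ->; rewrite (Tower_min T); lia.
suff : (last 0 (map pmin s) < pmin (x, w))%N.
  move: srt; rewrite /psorted; case: (s) s0 => //= p s' _ srt h.
  by rewrite rcons_path srt.
rewrite -(Tower_min T); inversion C as [t x' w' T'|a' b' s' x' w' C' T']; subst => /=.
  by rewrite -(Tower_min T').
rewrite map_rcons last_rcons -(Tower_min T').
by move: nb; rewrite /bad /= negb_or negbK => /andP[].
Qed.

Lemma Comb_inj t t' s : Comb t s -> Comb t' s ->
  shuf (tmap val t) -> shuf (tmap val t') -> t = t'.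
Proof.
move=> C; elim: C t' => {t s} [t x w T|a b s x w C IH T] t' C'.
  inversion C' as [t1 x1 w1 T1 e1 e2|a1 b1 s1 x1 w1 C1 T1 e1 e2]; subst => //.
    by apply: Tower_inj T1.
  by case: (s1) (Comb_neq0 C1) e2 => [|? [|? ?]].
inversion C' as [t1 x1 w1 T1 e1 e2|a1 b1 s1 x1 w1 C1 T1 e1 e2]; subst.
  by case: (s) (Comb_neq0 C) e2 => [|? [|? ?]].
have [es [ex ew]] := rcons_inj e2; subst s1 x1 w1.
move=> /= /and3P[_ sa sb] /and3P[_ sa' sb'].
by rewrite (IH a1) // (Tower_inj T T1).
Qed.

(** The value of a comb is a commutative product and retains only the multiset of factors. Normality
    sorts the factors by their smallest labels, which recovers their order. *)
Lemma Comb_perm_inj t t' s s' : Comb t s -> Comb t' s' -> perm_eq s s' ->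
  shuf (tmap val t) -> shuf (tmap val t') -> normal (tmap val t) -> normal (tmap val t') ->
  t = t'.
Proof.
move=> C C' p st st' nt nt'.
have [srt _] := Comb_sorted C st nt; have [srt' _] := Comb_sorted C' st' nt'.
suff e : s = s' by subst s'; apply: Comb_inj C C' st st'.
rewrite /psorted !sorted_map in srt srt'.
apply: (irr_sorted_eq (leT := relpre pmin ltn)) srt srt' (perm_mem p).
  by move=> x y z; apply: ltn_trans.
by move=> x; apply: ltnn.
Qed.

Lemma LieWord_min t x w : LieWord t x w -> shuf (tmap val t) -> all (fun l : 'I_n => x < l)%N w.
Proof.
elim=> {t x w} [x|a x w l L IH] //= /and3P[lt sa _]; rewrite all_rcons IH // andbT.
apply: leq_ltn_trans lt; rewrite -/(tmap _ _).
have := LieWord_leaves L; move: (IH sa) => /allP H e.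
have := minl_in (tmap val a); rewrite leaves_tmap' => /mapP[y].
rewrite e inE => /orP[/eqP-> ->//|/H lt' ->]; exact: ltnW.
Qed.

Lemma LNormal_inj t t' s s' x w : LNormal t s x w -> LNormal t' s' x w -> perm_eq s s' ->
  shuf (tmap val t) -> shuf (tmap val t') -> normal (tmap val t) -> normal (tmap val t') ->
  t = t'.
Proof.
move=> L L' p.
have nil_comb a r : Comb a r -> ~ perm_eq [::] r.
  move=> C; rewrite perm_sym => /perm_nilP e; exact: Comb_neq0 C e.
inversion L as [t1 x1 w1 L1|a b s1 x1 w1 C1 L1|a b s1 x1 w1 L1 C1];
inversion L' as [t2 x2 w2 L2|a' b' s2 x2 w2 C2 L2|a' b' s2 x2 w2 L2 C2]; subst.
- by move=> *; apply: LieWord_inj L1 L2.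
- by case: (nil_comb _ _ C2).
- by case: (nil_comb _ _ C2).
- by rewrite perm_sym in p; case: (nil_comb _ _ C1).
- rewrite /= -!/(tmap _ _) => /and3P[_ sa sb] /and3P[_ sa' sb'] /and3P[_ na nb] /and3P[_ na' nb'].
  by rewrite (LieWord_inj L1 L2) (Comb_perm_inj C1 C2 p).
- rewrite /= -!/(tmap _ _) => /and3P[lt sa sb] /and3P[lt' sa' sb'] /and3P[_ na nb] /and3P[_ na' nb'].
  move: lt; rewrite (LieWord_inj L1 L2) (Comb_perm_inj C1 C2 p) //.
  by rewrite ltnNge (ltnW lt').
- by rewrite perm_sym in p; case: (nil_comb _ _ C1).
- rewrite /= -!/(tmap _ _) => /and3P[lt sa sb] /and3P[lt' sa' sb'] /and3P[_ na nb] /and3P[_ na' nb'].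
  move: lt; rewrite (LieWord_inj L1 L2) (Comb_perm_inj C1 C2 p) //.
  by rewrite ltnNge (ltnW lt').
rewrite /= -!/(tmap _ _) => /and3P[_ sa sb] /and3P[_ sa' sb'] /and3P[_ na nb] /and3P[_ na' nb'].
by rewrite (LieWord_inj L1 L2) (Comb_perm_inj C1 C2 p).
Qed.

(** The second half of each case is what the induction needs. The forbidden patterns exclude
    products below d and e and as right factors of alpha, so these children are towers; they exclude
    m and n as roots of the children of colour L, so these are Lie words, and single leaves below d
    and e and on the right of beta. *)
Lemma normal_shape sg (chi : 'I_n -> colour) c t : @typed _ (shs sg) _ chi c t ->
  normal (tmap val t) ->
  if c is colS then (exists s, Comb t s) /\
     ((if t is Node sh_alpha _ _ then False else True) -> exists x w, Tower t x w)
  else (exists s x w, LNormal t s x w) /\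
     ((if t is Node (sh_m | sh_n) _ _ then False else True) -> exists x w, LieWord t x w).
Proof.
elim: t c => [x|g a IHa b IHb] c.
  move=> _ _; case: c; split.
  - by exists [:: (x, [::])]; do 2!constructor.
  - by exists x, [::]; constructor.
  - by exists [::], x, [::]; do 2!constructor.
  by exists x, [::]; constructor.
have leafL (u : tree sh_op 'I_n) : @typed _ (shs sg) _ chi colL u ->
    (if u is Node (sh_beta | sh_m | sh_n) _ _ then false else true) ->
    exists l, u = Leaf l.
  by case: u => [l|[] ? ?] //=; [exists l|rewrite andbF..].
rewrite /= -!/(tmap _ _) => /and4P[_ /eqP <- ta tb] /andP[B /andP[na nb]].
have {}IHa := IHa _ ta na; have {}IHb := IHb _ tb nb.
case: g B ta tb IHa IHb => /= B ta tb IHa IHb.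
- have [[s C] _] := IHa; have [_ T] := IHb.
  have [|x [w Tb]] := T.
    by move: B; case: (b) => [|[] ? ?] //=; rewrite orbT.
  by split=> //; exists (rcons s (x, w)); constructor.
- have [_ La] := IHa; have [|x [w L]] := La.
    by move: B; case: (a) => [|[] ? ?].
  have [|l eb] := leafL b tb; first by move: B; case: (b) => [|[] ? ?] //=; rewrite ?orbT.
  subst b; have LL := LieB l L.
  by split=> [|_]; [exists [::], x, (rcons w l); constructor|exists x, (rcons w l)].
- have [_ Ta] := IHa; have [|x [w T]] := Ta.
    by move: B; case: (a) => [|[] ? ?].
  have [|l eb] := leafL b tb; first by move: B; case: (b) => [|[] ? ?] //=; rewrite ?orbT.
  subst b; have TT := TowerD l T.
  by split=> [|_]; [exists [:: (x, l :: w)]; constructor|exists x, (l :: w)].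
- have [_ Tb] := IHb; have [|x [w T]] := Tb.
    by move: B; case: (b) => [|[] ? ?] //=; rewrite ?orbT.
  have [|l ea] := leafL a ta; first by move: B; case: (a) => [|[] ? ?] //=.
  subst a; have TT := TowerE l T.
  by split=> [|_]; [exists [:: (x, l :: w)]; constructor|exists x, (l :: w)].
- have [[s C] _] := IHa; have [_ Lb] := IHb; have [|x [w L]] := Lb.
    by move: B; case: (b) => [|[] ? ?] //=; rewrite ?orbT.
  by split=> //; exists s, x, w; constructor.
have [_ La] := IHa; have [[s C] _] := IHb; have [|x [w L]] := La.
  by move: B; case: (a) => [|[] ? ?] //=.
by split=> //; exists s, x, w; constructor.
Qed.
End NormalForms.

(** * Values of normal monomials and their independence *)

Section Detection.
Variables (k : fieldType) (n : nat).
Local Notation A := {mpoly k[#|{: option 'I_n * n.-bseq 'I_n}|]}.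
Implicit Types (t : tree sh_op 'I_n) (x l : 'I_n) (w u : seq 'I_n).

Let rS x : A := Y k (Some x) [::].
Let rL (l : 'I_n) : A -> A := @Dl k n l.
Let E t := ev rS rL (from_sh t).
Let lift (p : 'I_n * seq 'I_n) := (Some p.1, p.2).

Let rL_der l : derivation (rL l). Proof. exact: Dl_derivation. Qed.

Lemma Tower_ev t x w : Tower t x w -> (size w <= n)%N -> (E t).1 = Y k (Some x) w.
Proof.
rewrite /E; elim=> {t x w} [x|a x w l _ IH|a x w l _ IH] //= lt;
  by rewrite IH ?(ltnW lt) // /rL Dl_Y.
Qed.

Lemma Comb_ev t s : Comb t s -> all (fun p => size p.2 <= n)%N s ->
  (E t).1 = 'X_[ymon (map lift s)].
Proof.
rewrite /E; elim=> {t s} [t x w T|a b s x w _ IH T] /=.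
  rewrite andbT => le; rewrite (Tower_ev T le) -prod_Y big_cons big_nil /=.
  by rewrite mulr1.
rewrite all_rcons => /andP[le H]; rewrite IH // (Tower_ev T le) -!prod_Y map_rcons.
by rewrite -cats1 big_cat big_cons big_nil /= mulr1.
Qed.

Lemma Comb_leaves t s : Comb t s ->
  perm_eq (leaves t) (flatten [seq p.1 :: p.2 | p <- s]).
Proof.
elim=> {t s} [t x w T|a b s x w _ IH T] /=; first by rewrite cats0 Tower_leaves.
by rewrite map_rcons flatten_rcons perm_cat // Tower_leaves.
Qed.

Lemma Comb_size t s : Comb t s -> (size (leaves t) <= n)%N ->
  all (fun p => size p.2 <= n)%N s.
Proof.
move=> /Comb_leaves/perm_size ->; elim: s => //= p s IH.
by rewrite size_cat => le; rewrite IH; lia.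
Qed.

(** Induction on [a, l] = a l - l a. If l acts first, the words of a are followed by l; if it acts
    last, all words begin with l, which differs from x because normal words start with their
    smallest letter. So [x :: w] occurs once, and no other word begins with x. *)
Lemma LieWord_ev t x w : LieWord t x w -> shuf (tmap val t) ->
  exists2 J : seq (k * seq 'I_n),
    (forall j, j \in J -> ohead j.2 != Some x /\ perm_eq j.2 (x :: w)) &
    forall z u, (size (x :: w) + size u <= n)%N ->
      (E t).2 (Y k z u) =
      Y k z (x :: w ++ u) + \sum_(j <- J) j.1 *: Y k z (j.2 ++ u).
Proof.
rewrite /E; elim=> {t x w} [x _|a x w l L IH].
  exists [::] => // z u /= lt; rewrite big_nil addr0 /rL Dl_Y //.
move=> st; have sa : shuf (tmap val a) by case/and3P: st.
have [J HJ EJ] := IH sa.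
have Ll := LieWord_leaves L.
have lx : l != x.
  have := LieWord_min (LieB l L) st; rewrite all_rcons => /andP[lt _].
  by apply: contraTneq lt => ->; rewrite ltnn.
exists ([seq (j.1, rcons j.2 l) | j <- J] ++ (-1, l :: x :: w) :: [seq (- j.1, l :: j.2) | j <- J]).
  have Pl v : perm_eq v (x :: w) -> perm_eq (l :: v) (x :: rcons w l).
    by move=> p; rewrite -rcons_cons perm_sym perm_rcons perm_cons perm_sym.
  move=> j; rewrite mem_cat inE => /or3P[/mapP[i /HJ[h p] ->]|/eqP->|/mapP[i /HJ[h p] ->]] /=.
  - split; last by rewrite perm_rcons Pl.
    by case: (i.2) h p => //= p; have := perm_size p.
  - by split; [apply: contra lx => /eqP[->]|apply: Pl].
  by split; [apply: contra lx => /eqP[->]|apply: Pl].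
move=> z u; rewrite /= size_rcons => le.
rewrite /rL Dl_Y; last by lia.
rewrite !EJ /=; [|by rewrite /=; lia..].
have [DL _] := Dl_derivation k l.
rewrite (linD DL) (lin_sum _ _ DL) Dl_Y /=; last by rewrite size_cat; lia.
rewrite big_cat big_cons !big_map /= cat_rcons scaleN1r.
have e : \sum_(i <- J) Dl l (i.1 *: Y k z (i.2 ++ u)) =
   - \sum_(j <- J) (- j.1) *: Y k z (l :: j.2 ++ u).
  rewrite -sumrN; apply: eq_big_seq => j /HJ[_ /perm_size sj].
  rewrite (linZ _ _ DL) Dl_Y ?scaleNr ?opprK // size_cat sj /=; lia.
have e' : \sum_(j <- J) j.1 *: Y k z (j.2 ++ l :: u) = \sum_(j <- J) j.1 *: Y k z (rcons j.2 l ++ u).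
  by apply: eq_bigr => j _; rewrite cat_rcons.
by rewrite e e' opprD opprK !addrA.
Qed.

Lemma LNormal_ev t s x w : LNormal t s x w -> shuf (tmap val t) -> (size (leaves t) <= n)%N ->
  exists2 J : seq (k * seq 'I_n),
    (forall j, j \in J -> ohead j.2 != Some x /\ perm_eq j.2 (x :: w)) &
    (E t).2 (Y k None [::]) = 'X_[ymon ((None, x :: w) :: map lift s)] +
       \sum_(j <- J) j.1 *: 'X_[ymon ((None, j.2) :: map lift s)].
Proof.
have monE v r : 'X_[ymon ((None, v) :: map lift r)] = 'X_[ymon (map lift r)] * Y k None v.
  by rewrite -!prod_Y big_cons mulrC.
have main a b r y v : LieWord a y v -> shuf (tmap val a) -> (size (leaves a) <= n)%N ->
    Comb b r -> (size (leaves b) <= n)%N ->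
    exists2 J : seq (k * seq 'I_n),
    (forall j, j \in J -> ohead j.2 != Some y /\ perm_eq j.2 (y :: v)) &
    (E b).1 * (E a).2 (Y k None [::]) = 'X_[ymon ((None, y :: v) :: map lift r)] +
       \sum_(j <- J) j.1 *: 'X_[ymon ((None, j.2) :: map lift r)].
  move=> L sa le C le'; have [J HJ EJ] := LieWord_ev L sa; exists J => //.
  rewrite EJ ?(Comb_ev C) ?(Comb_size C) //; last first.
    by move: le; rewrite (LieWord_leaves L) /= addn0.
  rewrite mulrDr cats0 mulr_sumr -monE; congr (_ + _); apply: eq_bigr => j _.
  by rewrite monE cats0 scalerAr.
case=> {t s x w} [t x w L|a b s x w C L|a b s x w L C].
- move=> st le; have [J HJ EJ] := LieWord_ev L st; exists J => //.
  rewrite EJ; last by move: le; rewrite (LieWord_leaves L) /= addn0.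
  have m1 v : 'X_[ymon [:: (None, v)]] = Y k None v by rewrite -prod_Y big_cons big_nil mulr1.
  rewrite cats0 /= m1; congr (_ + _); apply: eq_bigr => j _.
  by rewrite m1 cats0.
- rewrite /= -!/(tmap _ _) size_cat => /and3P[_ _ sb] le; rewrite /E /=.
  by apply: main => //; lia.
rewrite /= -!/(tmap _ _) size_cat => /and3P[_ sa _] le; rewrite /E /=.
by apply: main => //; lia.
Qed.

Lemma mon_None_inj v v' s s' : (size v <= n)%N -> (size v' <= n)%N ->
  all (fun p => size p.2 <= n)%N s -> all (fun p => size p.2 <= n)%N s' ->
  ymon ((None, v) :: map lift s) = ymon ((None, v') :: map lift s') ->
  v = v' /\ perm_eq s s'.
Proof.
move=> hv hv' hs hs' /mon_inj; rewrite /= hv hv' !all_map => /(_ hs hs') p.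
have flt r : [seq q <- map lift r | q.1 == None] = [::] by elim: r.
have := perm_filter (fun q : option 'I_n * seq 'I_n => q.1 == None) p; rewrite /= !flt => /perm_mem/(_ (None, v)).
rewrite !inE eqxx => /esym/eqP[e]; split=> //.
move: p; rewrite e perm_cons; apply: perm_map_inj => -[a b] [c d] [-> ->] //.
Qed.

Lemma mon_Comb_inj s s' :
  all (fun p => size p.2 <= n)%N s -> all (fun p => size p.2 <= n)%N s' ->
  ymon (map lift s) = ymon (map lift s') -> perm_eq s s'.
Proof.
move=> hs hs' /mon_inj; rewrite !all_map => /(_ hs hs').
by apply: perm_map_inj => -[a b] [c d] [-> ->].
Qed.

Lemma LNormal_size t s x w : LNormal t s x w -> (size (leaves t) <= n)%N ->
  all (fun p => size p.2 <= n)%N s && (size (x :: w) <= n)%N.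
Proof.
case=> {t s x w} [t x w L|a b s x w C L|a b s x w L C] /=.
- by rewrite (LieWord_leaves L).
- rewrite size_cat (LieWord_leaves L) /= => le; rewrite (Comb_size C); lia.
rewrite size_cat (LieWord_leaves L) /= => le; rewrite (Comb_size C); lia.
Qed.

Lemma LNormal_min t s x w : LNormal t s x w -> shuf (tmap val t) ->
  all (fun l : 'I_n => x < l)%N w.
Proof.
case=> {t s x w} [t x w L|a b s x w C L|a b s x w L C] /=; first exact: LieWord_min.
  by move=> /and3P[_ _ sb]; apply: LieWord_min L sb.
by move=> /and3P[_ sa _]; apply: LieWord_min L sa.
Qed.

Variables (sg : pred sh_op) (chi : 'I_n -> colour) (c : colour).
Local Notation mono := (@sh_monomial _ (shs sg) n chi c).

(** The functional reads off the coefficient of the monomial attached to t. It is required to vanish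
    on universal identities for derivations, and not on one particular ideal, because it serves both
    the shuffle ideal and the symmetric ideal. *)
Lemma detect t : mono t -> normal (tmap val t) ->
  exists phi : {freeg (tree sh_op 'I_n) / k} -> k^o,
  [/\ linear phi,
      forall f, (forall (rS : 'I_n -> A) (rL : 'I_n -> A -> A) p, (forall x, derivation (rL x)) ->
        fglift (fun s => evc c p (ev rS rL (from_sh s))) f = 0) -> phi f = 0
    & forall s, mono s -> normal (tmap val s) -> phi << s >> = (s == t)%:R].
Proof.
pose val_at m (f : {freeg (tree sh_op 'I_n) / k}) : k^o :=
  mcoeff m (fglift (fun s => evc c (Y k None [::]) (E s)) f).
have val_lin m : linear (val_at m).
  by move=> a x y; rewrite /val_at fglift_linear mcoeffD mcoeffZ.
have val_kill m f : (forall (rS : 'I_n -> A) (rL : 'I_n -> A -> A) p, (forall x, derivation (rL x)) ->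
        fglift (fun s => evc c p (ev rS rL (from_sh s))) f = 0) -> val_at m f = 0.
  by move=> H; rewrite /val_at H ?mcoeff0.
have valU m s : val_at m << s >> = mcoeff m (evc c (Y k None [::]) (E s)).
  by rewrite /val_at liftU scale1r.
have msz s : mono s -> (size (leaves s) <= n)%N.
  move=> /sh_monomial_perm/perm_size; rewrite size_iota leaves_tmap' size_map => e.
  by rewrite (_ : size (leaves s) = n).
have msh s : mono s -> shuf (tmap val s).
  by case/andP=> _; rewrite is_shuffle_shuf.
have mty s : mono s -> @typed _ (shs sg) _ chi c s by case/andP=> /andP[].
move=> mt nt; have tt := mty _ mt; have szt := msz _ mt; have sht := msh _ mt.
case: c mt tt val_lin val_kill valU msz msh mty => mt tt val_lin val_kill valU msz msh mty.
  have [[C HC] _] := normal_shape tt nt.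
  exists (val_at (ymon (map lift C))); split; [exact: val_lin|exact: val_kill|].
  move=> s ms ns; rewrite valU /=.
  have [->|ne] := eqVneq s t.
    by rewrite (Comb_ev HC) ?mcoeffX ?eqxx // (Comb_size HC).
  have [[C' HC'] _] := normal_shape (mty _ ms) ns.
  rewrite (Comb_ev HC') ?(Comb_size HC') ?msz // mcoeffX; case: eqP => // e.
  move: ne; rewrite (Comb_perm_inj HC' HC) ?eqxx ?msh //.
  by apply: mon_Comb_inj e; rewrite ?(Comb_size HC') ?(Comb_size HC) ?msz.
have [[C [x [w HL]]] _] := normal_shape tt nt.
exists (val_at (ymon ((None, x :: w) :: map lift C))); split; [exact: val_lin|exact: val_kill|].
  move=> s ms ns; rewrite valU /=.
have /andP[szC szw] := LNormal_size HL szt.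
have [->|ne] := eqVneq s t.
  have [J HJ ->] := LNormal_ev HL sht szt.
  rewrite mcoeffD mcoeffX eqxx (raddf_sum (mcoeff _)) big1_seq ?addr0 // => j /andP[_ /HJ[h p]].
  rewrite /= mcoeffZ mcoeffX; case: eqP => [e|_]; last by rewrite mulr0.
  have [e' _] : j.2 = x :: w /\ perm_eq C C.
    by apply: mon_None_inj e => //; rewrite (perm_size p).
  by rewrite e' /= eqxx in h.
have [[C' [x' [w' HL']]] _] := normal_shape (mty _ ms) ns.
have /andP[szC' szw'] := LNormal_size HL' (msz _ ms).
have [J HJ ->] := LNormal_ev HL' (msh _ ms) (msz _ ms).
rewrite mcoeffD mcoeffX (raddf_sum (mcoeff _)) big1_seq ?addr0.
  case: eqP => // e; have [e' p] := mon_None_inj szw' szw szC' szC e.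
  case: e' HL' => -> -> HL'; move: ne.
  by rewrite (LNormal_inj HL' HL p (msh _ ms) sht ns nt) eqxx.
move=> j /andP[_ /HJ[h p]].
rewrite /= mcoeffZ mcoeffX; case: eqP => [e|_]; last by rewrite mulr0.
have [e' _] : j.2 = x :: w /\ perm_eq C' C.
  by apply: mon_None_inj e => //; rewrite (perm_size p).
(* A further term of s could match the word of t only if the first letters x and x' differ. But the
   two words have the same letters, and each begins with its smallest one. *)
rewrite e' in h p; have /allP lx := LNormal_min HL sht.
have /allP lx' := LNormal_min HL' (msh _ ms).
have xx' : x != x' by apply: contraNneq h => ->.
have : x \in x' :: w' by rewrite -(perm_mem p) inE eqxx.
rewrite inE (negPf xx') => /lx' l1.
have : x' \in x :: w by rewrite (perm_mem p) inE eqxx.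
rewrite inE eq_sym (negPf xx') => /lx l2.
by have := ltn_trans l1 l2; rewrite ltnn.
Qed.
End Detection.

Local Notation full := [:: alpha; beta; opd; opm].

(** The generators in the shuffle signature are given by [predT], and [sg_of] of all operations
    equals it by extensionality only. The equation is used up here, where the family does not yet
    occur in other types. *)
Lemma pull_transport (k : fieldType) (s : seq lr_op) (M : sym_family k (lr_sig s)) sg :
  sym_ideal M -> sg_of s = sg ->
  (alpha \in s -> M _ (@rel_col _ _ _ (alpha_sym k)) colS (rel_elt (alpha_sym k))) ->
  (beta \in s -> M _ (@rel_col _ _ _ (beta_skew k)) colL (rel_elt (beta_skew k))) ->
  exists F : sh_family k (shs sg), [/\ sh_ideal F,
    forall n (chi : 'I_n -> colour) c f, F n chi c f -> M _ chi c (fgmap (@from_sh _) f) &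
    forall n (chi : 'I_n -> colour) c f, M _ chi c f -> F n chi c (to_shuffle f)].
Proof.
move=> idM <- Ma Mb; exists (pull M); split; first exact: pull_ideal.
  by move=> n chi c f [].
by move=> n chi c f; apply: pull_to_shuffle.
Qed.

Lemma sg_full : sg_of full = predT.
Proof. by apply: funext => -[]. Qed.

(** * The Groebner basis *)

Section LieRinehartIdeal.
Variable k : fieldType.
Local Notation M := (@lr_sh_ideal k).

Lemma pull_relations (W : sym_family k (lr_sig full)) (F : sh_family k (shs predT)) :
  sym_ideal W ->
  (forall r, List.In r (lr_rels_full k) -> W _ (@rel_col _ _ _ r) (rel_out r) (rel_elt r)) ->
  (forall n (chi : 'I_n -> colour) c f, W _ chi c f -> F n chi c (to_shuffle f)) ->
  forall n (chi : 'I_n -> colour) c f, @lr_sh_relations k n chi c f -> F n chi c f.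
Proof.
move=> idW WR WF n chi c f [r s inr]; apply: WF.
apply: (symi_relabel idW (cbij_perm (@rel_col _ _ _ r) s)).
by apply: WR; right; right.
Qed.

Lemma lr_sh_idealP : sh_ideal M.
Proof.
have idW := @sym_gen_ideal k _ lr_sig_full (lr_rels_full k) (@lr_rels_hom k).
have WR := @sym_gen_rel k _ lr_sig_full (lr_rels_full k).
have [F [idF _ WF]] := pull_transport idW sg_full
  (fun _ => WR _ (or_introl erefl)) (fun _ => WR _ (or_intror (or_introl erefl))).
exact: (sh_gen_ideal idF (pull_relations idW WR WF)).
Qed.

Lemma lr_sh_ideal_rel n (chi : 'I_n -> colour) c f :
  @lr_sh_relations k n chi c f -> M chi c f.
Proof. by move=> h F _; apply. Qed.

Lemma lr_sh_rules : @has_rules k predT M.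
Proof.
apply: (@rule_table k predT M (lr_relations k)) => //.
- move=> r s inr; apply: lr_sh_ideal_rel; exact: LrShRelation.
all: by rewrite /= ; intuition.
Qed.

Lemma lr_sh_vanish (A : comAlgType k) n (chi : 'I_n -> colour) c f : M chi c f ->
  forall (rS : 'I_n -> A) (rL : 'I_n -> A -> A) p, (forall x, derivation (rL x)) ->
    fglift (fun s => evc c p (ev rS rL (from_sh s))) f = 0.
Proof.
move=> Mf rS rL p D.
have idW := vanishing_ideal A full; have WR := @vanishing_rels k A.
have [F [idF FW WF]] := pull_transport idW sg_full
  (fun _ => WR _ (or_introl erefl)) (fun _ => WR _ (or_intror (or_introl erefl))).
have /FW/vanishingE[_ /(_ rS rL p D)] := Mf F idF (pull_relations idW WR WF).
move=> <-; move: f {Mf}; apply: (freeg_ext (g := fun f => fglift _ (fgmap _ f))) => [a f g|a f g|t].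
- by rewrite fglift_linear.
- by rewrite fgmap_linear fglift_linear.
by rewrite fgmapU !liftU.
Qed.

(** All elements of the ideal with two vertices are taken, not just the given relations: any element
    of arity 3 whose leading term is a bad pattern then belongs to the basis. *)
Definition lr_quadratic : sh_family k sh_sig := fun n chi c f =>
  M chi c f /\ all (fun t : tree sh_op 'I_n => nvertices t == 2%N) (dom f).

Lemma nvertices_sh_tree n (t : tree lr_op 'I_n) : nvertices (sh_tree t) = nvertices t.
Proof. by elim: t => //= g a IHa b IHb; case: ifP => _ /=; rewrite IHa IHb // addnC. Qed.

Lemma lr_relations_quadratic r : List.In r (lr_relations k) ->
  all (fun t => nvertices t == 2%N) (dom (rel_elt r)).
Proof.
have B (T : choiceType) (Q : pred T) (l : seq (k * T)) : all (fun x => Q x.2) l ->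
    all Q (dom (\sum_(x <- l) << x.1 *g x.2 >> : {freeg T / k})).
  elim: l => [|x l IH]; first by rewrite big_nil all_dom0.
  rewrite big_cons => /andP[Qx /IH /allP H]; apply/allP => t /domD_subset.
  rewrite mem_cat => /orP[|/H//]; rewrite mem_dom coeffU.
  by have [/eqP <-|_] := boolP (_ == t); last by rewrite mulr0 eqxx.
rewrite /lr_relations /=; do 7![case=> [<-|]; first
 (first [ rewrite alpha_assocE | rewrite beta_jacobiE | rewrite d_leibnizE | rewrite d_actionE
        | rewrite m_moduleE | rewrite d_anchorE | rewrite beta_leibnizE ]; exact: B)].
by [].
Qed.

Lemma lr_sh_relations_quadratic n (chi : 'I_n -> colour) c f :
  @lr_sh_relations k n chi c f -> lr_quadratic chi c f.
Proof.
move=> h; split; first exact: lr_sh_ideal_rel.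
case: h => r s inr; apply: (@all_dom_fglift _ _ _ (fun t => nvertices t == 2%N)).
  apply: (all_dom_fgmap (lr_relations_quadratic inr)) => t.
  by rewrite nvertices_tmap.
move=> t /eqP h; apply/allP => u; rewrite mem_dom coeffU.
have [/eqP <- _|_] := boolP (_ == u); last by rewrite mulr0 eqxx.
by rewrite nvertices_sh_tree h.
Qed.

Lemma branch_refl n (t : tree sh_op 'I_n) : branch (Sig := sh_sig) t t.
Proof. by case: t => [x|g a b] /=; rewrite eqxx. Qed.

Lemma bad_branch n (chi : 'I_n -> colour) c (t : tree sh_op 'I_n) :
  @typed _ (shs predT) _ chi c t -> shuf (tmap val t) -> uniq (leaves t) ->
  ~~ normal (tmap val t) ->
  exists (P : tree sh_op 'I_3) psi d, [/\ @sh_monomial _ (shs predT) 3 psi d P,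
    bad (tmap val P) & @divisible _ sh_sig n 3 t P].
Proof.
elim: t c => [x|g a IHa b IHb] c // ty sh un.
have [B _|nB] := boolP (bad (tmap val (Node g a b))).
  pose chi' j := oapp chi colS (insub j).
  have chiE : chi' \o val = chi.
    apply: funext => i /=; rewrite /chi' insubT ?ltn_ord // => lt /=.
    by congr chi; apply: val_inj.
  have un' : uniq (leaves (tmap val (Node g a b))) by rewrite leaves_tmap' map_inj_uniq //; apply: val_inj.
  have [P [f [e incr badP [shP pP] H]]] := bad_split B sh un'.
  have [|psi [tP _]] := H predT chi' c; first by rewrite -typed_lab chiE.
  exists P, psi, c; split=> //.
    apply/andP; split; last by rewrite (is_shuffle_shuf (Sig := shs predT)).
    by rewrite /monomial tP (monomial_perm _ val_inj (iota_uniq 0 3) (@ord_iotaP 3)).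
  exists f; rewrite {1}e branch_refl; split=> // i j /incr.
  by rewrite !minl_tmap.
move: ty sh un => /= /and3P[_ ta tb]; rewrite -!/(tmap _ _) => /and3P[_ sa sb].
rewrite cat_uniq => /and3P[ua _ ub]; rewrite -/(tmap _ _) in nB.
rewrite nB /= negb_and -!/(tmap _ _) => /orP[na|nb].
  have [P [psi [d [mP bP [f [br incr]]]]]] := IHa _ ta sa ua na.
  by exists P, psi, d; split=> //; exists f; rewrite /= br orbT.
have [P [psi [d [mP bP [f [br incr]]]]]] := IHb _ tb sb ub nb.
by exists P, psi, d; split=> //; exists f; rewrite /= br !orbT.
Qed.

Lemma lr_groebner : groebner_basis sh_le M lr_quadratic.
Proof.
split=> [n chi c f|n chi c f t Mf _ [tf lf]].
  split=> [Mf F idF GF|Gf].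
    by apply: Mf => // m psi d g /lr_sh_relations_quadratic; apply: GF.
  by apply: Gf; [exact: lr_sh_idealP|move=> m psi d g []].
have mono s : s \in dom f -> @sh_monomial _ (shs predT) _ chi c s.
  by move=> sf; apply: (allP (shi_hom lr_sh_idealP Mf)).
have lt s : s \in dom f -> s != t -> olt s t.
  move=> sf ne; have := lf s sf; rewrite /sh_le le_eqVlt => /orP[/eqP e|//].
  case/eqP: ne; apply: (@tmap_inj sh_op 'I_n nat val val_inj).
  exact: (tkey_inj (sh_monomial_perm (mono _ sf)) (sh_monomial_perm (mono _ tf)) (iota_uniq _ _) e).
have [nt|nt] := boolP (onormal t).
  have [phi [Lphi kill delta]] := @detect k n predT chi c t (mono _ tf) nt.
  case: (leading_not_normal lr_sh_idealP lr_sh_rules Lphi _ delta (mono _ tf) nt Mf tf lt).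
  by move=> g Mg; apply: kill => rS rL p D; apply: (lr_sh_vanish Mg).
have mt := mono _ tf; have /andP[/andP[ty _] sh] := mt.
have [||P [psi [d [mP bP div]]]] := bad_branch ty _ _ nt.
- by rewrite -(is_shuffle_shuf (Sig := shs predT)).
- by rewrite -(map_inj_uniq val_inj) -leaves_tmap' (perm_uniq (sh_monomial_perm mt)) iota_uniq.
have [g [Mg cg lg]] := lr_sh_rules mP bP.
exists 3, psi, d, g, P; split=> //.
  (* All generators are binary, so monomials of arity 3 have two vertices. *)
  split=> //; apply/allP => s /(allP (shi_hom lr_sh_idealP Mg)) ms.
  have := perm_size (sh_monomial_perm (sg := predT) ms).
  by rewrite leaves_tmap' size_map size_leaves => -[->].
split; first by rewrite mem_dom.
move=> s sg; have [->|ne] := eqVneq s P; first exact: lexx.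
exact: (ltW (lg s sg ne)).
Qed.

Lemma lr_quadraticP : quadratic lr_quadratic.
Proof. by move=> n chi c g [_ /allP H] t /H/eqP. Qed.
End LieRinehartIdeal.

(** * The composition and its map to the Lie-Rinehart operad *)

Section Classes.
Variables (k : fieldType) (I : eqType) (Sig : signature I) (rels : seq (relation k I Sig)).
Local Notation M := (sym_ideal_gen rels).
Hypothesis idM : sym_ideal M.

(** Trees that are not monomials of the component are sent to 0. This makes [cls] total and linear;
    on homogeneous elements it is the intended class. *)
Definition to_mon (X : finType) (chi : X -> I) c (f : {freeg (tree Sig X) / k}) :
  {freeg (mon Sig chi c) / k} :=
  fglift (fun t => oapp (fun m : mon Sig chi c => << m >> : {freeg _ / k}) 0 (insub t)) f.

Definition cls (X : finType) (chi : X -> I) c (f : {freeg (tree Sig X) / k}) :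
  op_sp rels chi c := quot_pi _ (to_mon chi c f).

Definition rep (X : finType) (chi : X -> I) c (x : op_sp rels chi c) :
  {freeg (tree Sig X) / k} := mon_val (quot_repr x).

Lemma mon_val_linear (X : finType) (chi : X -> I) c :
  linear (@mon_val k I Sig X chi c).
Proof. exact: fgmap_linear. Qed.

Lemma to_monK (X : finType) (chi : X -> I) c f : homogeneous chi c f ->
  mon_val (to_mon chi c f) = f.
Proof.
move=> /allP hf; rewrite [in RHS](freegE f) /to_mon fgliftE (lin_sum _ _ (@mon_val_linear X chi c)).
apply: eq_big_seq => t /hf ht; rewrite (linZ _ _ (@mon_val_linear X chi c)).
by rewrite insubT /= /mon_val fgmapU SubK.
Qed.

Lemma mon_valK (X : finType) (chi : X -> I) c (g : {freeg (mon Sig chi c) / k}) :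
  to_mon chi c (mon_val g) = g.
Proof.
move: g; apply: (freeg_ext (f := to_mon chi c \o _) (g := id)) => [a u v|//|m] /=.
  by rewrite mon_val_linear /to_mon fglift_linear.
by rewrite /mon_val fgmapU /to_mon liftU scale1r valK.
Qed.

Lemma rep_hom (X : finType) (chi : X -> I) c (x : op_sp rels chi c) :
  homogeneous chi c (rep x).
Proof.
apply/allP => t; rewrite /rep /mon_val => /dom_fgmap[m _ ->]; exact: (valP m).
Qed.

Lemma cls_rep (X : finType) (chi : X -> I) c (x : op_sp rels chi c) : cls chi c (rep x) = x.
Proof. by rewrite /cls /rep mon_valK quot_reprK. Qed.

Lemma cls_linear (X : finType) (chi : X -> I) c : linear (@cls X chi c).
Proof. by move=> a u v; rewrite /cls /to_mon fglift_linear quot_pi_linear. Qed.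

Lemma op_relP (X : finType) (chi : X -> I) c f :
  linspan (@op_rel k I Sig rels X chi c) f <-> M chi c (mon_val f).
Proof.
split=> [h|h]; last by apply: linspan_sub.
have [M0 ML] := symi_subspace idM chi c.
apply: (h (fun f => M chi c (mon_val f))) => //; split; first by rewrite (lin0 (@mon_val_linear X chi c)).
by move=> a u v hu hv; rewrite mon_val_linear; apply: ML.
Qed.

Lemma cls_eq (X : finType) (chi : X -> I) c f g :
  homogeneous chi c f -> homogeneous chi c g ->
  cls chi c f = cls chi c g <-> M chi c (f - g).
Proof.
move=> hf hg; rewrite /cls quot_piP op_relP (linB (@mon_val_linear X chi c)).
by rewrite !to_monK.
Qed.

Lemma rep_cls (X : finType) (chi : X -> I) c f : homogeneous chi c f ->
  M chi c (rep (cls chi c f) - f).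
Proof. by move=> hf; apply/cls_eq; rewrite ?cls_rep //; apply: rep_hom. Qed.

Lemma homogeneous_lin (X : finType) (chi : X -> I) c a (f g : {freeg (tree Sig X) / k}) :
  homogeneous chi c f -> homogeneous chi c g -> homogeneous chi c (a *: f + g).
Proof. exact: all_dom_lin. Qed.

Lemma rep_linear (X : finType) (chi : X -> I) c a (x y : op_sp rels chi c) :
  M chi c (rep (a *: x + y) - (a *: rep x + rep y)).
Proof.
apply/cls_eq; [exact: rep_hom|by apply: homogeneous_lin; apply: rep_hom|].
by rewrite cls_linear !cls_rep.
Qed.

Lemma homogeneous_relabel (X Y : finType) (chi : X -> I) (psi : Y -> I) c
    (h : cbij chi psi) (f : {freeg (tree Sig X) / k}) :
  homogeneous chi c f -> homogeneous psi c (relabel h f).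
Proof. exact: (symi_relabel (homogeneous_ideal k Sig)). Qed.

Lemma op_map_cls (X Y : finType) (chi : X -> I) (psi : Y -> I) c (h : cbij chi psi) f :
  homogeneous chi c f -> op_map h (cls chi c f) = cls psi c (relabel h f).
Proof.
move=> hf; rewrite /op_map /cls qmap_pi; last exact: op_compat.
congr (quot_pi _ _); rewrite -[LHS]mon_valK; congr (to_mon _ _ _).
have -> : mon_val (fgmap (mon_map (c := c) h) (to_mon chi c f)) =
    relabel h (mon_val (to_mon chi c f)).
  move: (to_mon chi c f); apply: (freeg_ext (f := @mon_val _ _ _ _ _ _ \o _)
    (g := @relabel _ _ _ _ _ _ \o _)) => [a u v|a u v|t] /=.
  - by rewrite /mon_val !fgmap_linear.
  - by rewrite /mon_val /relabel !fgmap_linear.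
  - by rewrite /mon_val /relabel !fgmapU SubK.
by rewrite to_monK.
Qed.

Lemma rep_op_map (X Y : finType) (chi : X -> I) (psi : Y -> I) c (h : cbij chi psi)
    (x : op_sp rels chi c) : M psi c (rep (op_map h x) - relabel h (rep x)).
Proof.
apply/cls_eq; [exact: rep_hom|by apply: homogeneous_relabel; apply: rep_hom|].
by rewrite cls_rep -op_map_cls ?cls_rep //; apply: rep_hom.
Qed.
End Classes.

Section SubLabels.
Variables (k : fieldType) (Sig : signature colour) (M : sym_family k Sig).
Hypothesis idM : sym_ideal M.

(** The branches of a composition are labelled by the fibres of a map, each a type of its own. This
    predicate expresses membership in an ideal for elements relabelled in X, where different
    branches can be combined. *)
Definition subM (X : finType) (chi : X -> colour) (P : pred X) (d : colour)
    (F : {freeg (tree Sig X) / k}) : Prop :=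
  exists2 F' : {freeg (tree Sig {x | P x}) / k},
    fgmap (tmap val) F' = F & M (chi \o val) d F'.

Definition node2 (X : choiceType) (g : Sig) (F G : {freeg (tree Sig X) / k}) :
  {freeg (tree Sig X) / k} := fglift (fun a => fgmap (Node g a) G) F.

Lemma node2_linl (X : choiceType) g (G : {freeg (tree Sig X) / k}) :
  linear (fun F => node2 g F G).
Proof. by move=> a u v; rewrite /node2 fglift_linear. Qed.

Lemma node2U (X : choiceType) g a (G : {freeg (tree Sig X) / k}) :
  node2 g << a >> G = fgmap (Node g a) G.
Proof. by rewrite /node2 liftU scale1r. Qed.

Lemma node2_linr (X : choiceType) g (F : {freeg (tree Sig X) / k}) :
  linear (node2 g F).
Proof.
move=> a u v; rewrite /node2 !fgliftE scaler_sumr -big_split; apply: eq_bigr => t _ /=.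
by rewrite fgmap_linear scalerDr !scalerA mulrC.
Qed.

Lemma node2_fgmap (X Y : choiceType) (h : X -> Y) g (F G : {freeg (tree Sig X) / k}) :
  node2 g (fgmap (tmap h) F) (fgmap (tmap h) G) = fgmap (tmap h) (node2 g F G).
Proof.
move: F; apply: (freeg_ext (f := fun F => node2 g (fgmap _ F) _)
  (g := fun F => fgmap _ (node2 g F G))) => [a u v|a u v|t].
- by rewrite fgmap_linear node2_linl.
- by rewrite node2_linl fgmap_linear.
by rewrite fgmapU !node2U !fgmap_comp.
Qed.

Lemma subM_full (X : finType) (chi : X -> colour) (P : pred X) d F :
  (forall x, P x) -> subM chi P d F -> M chi d F.
Proof.
move=> H [F' <- MF'].
pose v (x : {x | P x}) := val x; pose w x : {x | P x} := exist _ x (H x).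
have vK : cancel v w by move=> x; apply: val_inj.
have wK : cancel w v by [].
exact: (symi_relabel idM (@Cbij _ _ _ (chi \o val) chi v w vK wK (fun=> erefl)) MF').
Qed.

Variables (X : finType) (chi : X -> colour) (g : Sig) (P Q : pred X).
Hypothesis part : forall x, (P x + Q x = 1)%N.
Hypothesis gg : gens g.

Let part' x : (#|[pred y : {x | P x} | val y == x]| + #|[pred z : {x | Q x} | val z == x]| = 1)%N.
Proof. by rewrite !card_sub_eq part. Qed.

Let T : tree Sig bool := Node g (Leaf true) (Leaf false).
Let col (b : bool) := if b then src1 g else src2 g.
Let hT : monomial col (tgt g) T.
Proof. by apply/andP; rewrite /= gg !eqxx; split=> //; apply/forallP => -[]. Qed.

Let M_sum (c : colour) (J : eqType) (r : seq J) (a : J -> k) (F : J -> {freeg (tree Sig X) / k}) :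
  (forall j, j \in r -> M chi c (F j)) -> M chi c (\sum_(j <- r) a j *: F j).
Proof.
have [M0 ML] := symi_subspace idM chi c.
move=> H; elim: r H => [|j r IH] H; rewrite ?big_nil // big_cons; apply: ML.
  by apply: H; rewrite inE eqxx.
by apply: IH => i ir; apply: H; rewrite inE ir orbT.
Qed.

Lemma node2_left F G : subM chi P (src1 g) F ->
  (exists2 G' : {freeg (tree Sig {x | Q x}) / k},
    fgmap (tmap val) G' = G & homogeneous (chi \o val) (src2 g) G') ->
  M chi (tgt g) (node2 g F G).
Proof.
move=> [F' <- MF] [G' <- /allP hG].
have -> : node2 g (fgmap (tmap val) F') (fgmap (tmap val) G') =
   \sum_(t <- dom G') coeff t G' *: fgmap (fun a => sub2 val val T a t) F'.
  rewrite [in LHS](fgmapE (tmap val) G') (lin_sum _ _ (@node2_linr _ g _)).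
  apply: eq_bigr => t _; rewrite (linZ _ _ (@node2_linr _ g _)); congr (_ *: _).
  move: F' {MF}; apply: (freeg_ext (f := fun F => node2 g (fgmap _ F) _)) => [a u v|a u v|a].
  - by rewrite fgmap_linear node2_linl.
  - by rewrite fgmap_linear.
  by rewrite !fgmapU node2U fgmapU.
apply: M_sum => t tG.
have z0 : {x | Q x} by case: (leaves t) (size_leaves t) => [|z].
exact: (sub2_left idM z0 part' hT MF (hG t tG)).
Qed.

Lemma node2_right F G :
  (exists2 F' : {freeg (tree Sig {x | P x}) / k},
    fgmap (tmap val) F' = F & homogeneous (chi \o val) (src1 g) F') ->
  subM chi Q (src2 g) G -> M chi (tgt g) (node2 g F G).
Proof.
move=> [F' <- /allP hF] [G' <- MG].
have -> : node2 g (fgmap (tmap val) F') (fgmap (tmap val) G') =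
   \sum_(t <- dom F') coeff t F' *: fgmap (fun b => sub2 val val T t b) G'.
  rewrite [in LHS](fgmapE (tmap val) F') (lin_sum _ _ (@node2_linl _ g _)).
  apply: eq_bigr => t _; rewrite (linZ _ _ (@node2_linl _ g _)); congr (_ *: _).
  by rewrite node2U fgmap_comp.
have [M0 ML] := symi_subspace idM chi (tgt g).
(* [sub2_right] asks for a point of [Q]. If there is none, no tree has its labels there, and G' =
   0. *)
have [e|[z0]] : (forall z : {x | Q x}, False) \/ exists z : {x | Q x}, True.
  by case: (pselect (exists z : {x | Q x}, True)) => h; [right|left=> z; apply: h; exists z].
- have G0 : G' = 0.
    apply/eqP; rewrite -dom_eq0; case E : (dom G') => [//|t s].
    by case: (leaves t) (size_leaves t) => [|z] // _; case: (e z).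
  by rewrite G0 big1 // => t _; rewrite (lin0 (fgmap_linear _)) scaler0.
move=> _; apply: M_sum => t tF.
exact: (sub2_right idM z0 part' hT (hF t tF) MG).
Qed.
End SubLabels.

(** * Substitution of branches into the operations of N_m *)

Section Substitution.
Variable k : fieldType.
Local Notation Sg := (lr_sig full).
Local Notation Nn := (lr_sig [:: opm]).
Local Notation ftree X := {freeg (tree lr_op X) / k}.
Local Notation nd := (@node2 k Sg _).

(* In N_m all trees with two or more vertices vanish. *)
Definition subst_tree (X J : choiceType) (s : J -> ftree X) (T : tree lr_op J) : ftree X :=
  match T with
  | Leaf j => s j
  | Node g (Leaf i) (Leaf j) => nd g (s i) (s j)
  | _ => 0
  end.

Definition subst (X J : choiceType) (s : J -> ftree X) (p : ftree J) : ftree X :=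
  fglift (subst_tree s) p.

Lemma subst_linear (X J : choiceType) (s : J -> ftree X) : linear (subst s).
Proof. exact: fglift_linear. Qed.

Lemma nm_small (J : finType) (col : J -> colour) c (T : tree lr_op J) :
  @monomial _ Nn _ col c T ->
  [\/ (1 < nvertices T)%N,
      exists i, [/\ T = Leaf i, forall j, j = i & col i = c]
    | exists i j, [/\ T = Node opm (Leaf i) (Leaf j), forall x, ((x == i) + (x == j) = 1)%N,
        col i = colS, col j = colL & c = colL]].
Proof.
case/andP; case: T => [i|g [i|g1 a b] [j|g2 a' b']] /= ht /forallP hl.
- apply: Or32; exists i; split=> // [j|]; last exact/eqP.
  by apply/eqP; move: (hl j); rewrite /= addn0 eqb1 eq_sym.
- apply: Or33; exists i, j; case/and4P: ht; rewrite inE => /eqP-> /eqP<- /eqP ? /eqP ?.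
  by split=> // x; rewrite -[RHS](eqP (hl x)) addn0 !(eq_sym x).
- by apply: Or31; rewrite addnS.
- by apply: Or31.
- by apply: Or31; rewrite addnS.
Qed.

Lemma subst_tree_big (X J : choiceType) (s : J -> ftree X) T : (1 < nvertices T)%N ->
  subst_tree s T = 0.
Proof. by case: T => [|g [i|g1 a b] [j|g2 a' b']]. Qed.

Section Congruence.
Variables (X J : finType) (chi : X -> colour) (col : J -> colour) (f : X -> J) (c : colour).
Variable M : sym_family k Sg.
Hypothesis idM : sym_ideal M.

Definition fib (N : sym_family k Sg) (s : J -> ftree X) : Prop :=
  forall j, subM N chi (fun x => f x == j) (col j) (s j).
Definition hom_fib := fib (fun X chi c f => @homogeneous k _ Sg X chi c f).

Let part i j : (forall x : J, ((x == i) + (x == j) = 1)%N) ->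
  forall x, ((f x == i) + (f x == j) = 1)%N.
Proof. by []. Qed.

Lemma subst_tree_diff s s' T : @monomial _ Nn _ col c T ->
  hom_fib s -> hom_fib s' -> fib M (fun j => s j - s' j) ->
  M chi c (subst_tree s T - subst_tree s' T).
Proof.
have [M0 ML] := symi_subspace idM chi c.
case/nm_small => [big|[i [-> all_i <-]]|[i [j [-> ij ci cj ->]]]] hs hs' d.
- by rewrite !subst_tree_big // subrr.
- by apply: (subM_full idM _ (d i)) => x; rewrite [f x]all_i.
rewrite /subst_tree -[nd opm (s i) (s j)](subrK (nd opm (s' i) (s j))) -addrA.
rewrite -(linB (node2_linl (Sig := Sg) opm (s j))) -(linB (node2_linr (Sig := Sg) opm (s' i))).
have [L0 LL] := symi_subspace idM chi colL.
rewrite -[X in _ + X]scale1r addrC; apply: LL.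
- apply: (node2_right idM (g := opm : Sg) (part ij)) => //.
    by have := hs' i; rewrite ci.
  by have := d j; rewrite cj.
- apply: (node2_left idM (g := opm : Sg) (part ij)) => //.
    by have := d i; rewrite ci.
  by have := hs j; rewrite cj.
Qed.

(** The branches are representatives of classes, unique only modulo an ideal; the substitution thus
    passes to classes. With the homogeneous elements for [M] and 0 for s' it also yields
    [subst_hom]. *)
Lemma subst_diff s s' p : @homogeneous k _ Nn _ col c p ->
  hom_fib s -> hom_fib s' -> fib M (fun j => s j - s' j) ->
  M chi c (subst s p - subst s' p).
Proof.
move=> /allP hp hs hs' d; have [M0 ML] := symi_subspace idM chi c.
rewrite /subst !fgliftE -sumrB; elim: (dom p) hp => [|t r IH] hp; first by rewrite big_nil.
rewrite big_cons -scalerBr; apply: ML.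
  by apply: subst_tree_diff => //; apply: hp; rewrite inE eqxx.
by apply: IH => u ur; apply: hp; rewrite inE ur orbT.
Qed.
End Congruence.

Lemma fib0 (X J : finType) (chi : X -> colour) (col : J -> colour) (f : X -> J) M :
  sym_ideal M -> fib chi col f M (fun=> 0).
Proof.
move=> idM j; exists 0; first exact: lin0 (fgmap_linear _).
by case: (symi_subspace idM (chi \o val : {x | f x == j} -> _) (col j)).
Qed.

Lemma subst_hom (X J : finType) (chi : X -> colour) (col : J -> colour) (f : X -> J) c s p :
  @homogeneous k _ Nn _ col c p -> hom_fib chi col f s -> @homogeneous k _ Sg _ chi c (subst s p).
Proof.
move=> hp hs; have idH := homogeneous_ideal k Sg.
have := subst_diff idH hp hs (fib0 chi col f idH).
have -> : subst (fun=> 0) p = 0 :> ftree X.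
  rewrite /subst fgliftE big1 // => -[i|g [i|? ? ?] [j|? ? ?]] _; rewrite ?scaler0 //=.
  by rewrite (lin0 (node2_linr (Sig := Sg) g _)) scaler0.
by rewrite subr0; apply=> j; have := hs j; rewrite subr0.
Qed.

(** The equation holds exactly, not just modulo an ideal: in the monomials not sent to 0 every label
    occurs once. *)
Lemma subst_linr (X J : finType) (col : J -> colour) c j (a : k) (s s1 s2 : J -> ftree X) p :
  @homogeneous k _ Nn _ col c p ->
  (forall i, i != j -> s i = s1 i /\ s i = s2 i) -> s j = a *: s1 j + s2 j ->
  subst s p = a *: subst s1 p + subst s2 p.
Proof.
move=> /allP hp hs sj; rewrite /subst !fgliftE scaler_sumr -big_split.
apply: eq_big_seq => T /hp /nm_small hT /=.
rewrite scalerA [a * _]mulrC -scalerA -scalerDr; congr (_ *: _).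
case: hT => [big|[i [-> all_i _]]|[i [l [-> il _ _ _]]]] /=.
- by rewrite !subst_tree_big // scaler0 addr0.
- by rewrite -(all_i j).
have := il j; case: (eqVneq j i) => [<-|ji]; case: (eqVneq j l) => [<-|jl] //= _.
- have /hs[e1 e2] : l != j by rewrite eq_sym.
  by rewrite -e1 -e2 sj (node2_linl (Sig := Sg)).
- have /hs[e1 e2] : i != j by rewrite eq_sym.
  by rewrite -e1 -e2 sj (node2_linr (Sig := Sg)).
Qed.

Lemma subst_relabel (X J J' : choiceType) (h : J -> J') (s : J' -> ftree X) p :
  subst s (fgmap (tmap h) p) = subst (s \o h) p.
Proof.
move: p; apply: (freeg_ext (f := subst s \o fgmap _)) => [a u v|a u v|t] /=.
- by rewrite fgmap_linear subst_linear.
- by rewrite subst_linear.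
rewrite fgmapU /subst !liftU !scale1r.
by case: t => [|g [i|? ? ?] [j|? ? ?]].
Qed.

Lemma fgmap_subst (X Y J : choiceType) (h : X -> Y) (s : J -> ftree X) p :
  fgmap (tmap h) (subst s p) = subst (fun j => fgmap (tmap h) (s j)) p.
Proof.
move: p; apply: (freeg_ext (f := fgmap _ \o subst s)) => [a u v|a u v|t] /=.
- by rewrite subst_linear fgmap_linear.
- by rewrite subst_linear.
rewrite /subst !liftU !scale1r.
have f0 := lin0 (fgmap_linear (k := k) (@tmap lr_op _ _ h)).
by case: t => [|g [i|? ? ?] [j|? ? ?]] //=; rewrite -(node2_fgmap (Sig := Sg) h) /=.
Qed.

Lemma graft_nvertices (X : eqType) (Y Z : Type) l (u : X -> Z) (v : Y -> Z)
    (t : tree lr_op X) (s : tree lr_op Y) :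
  (nvertices t + (l \in leaves t) * nvertices s <= nvertices (graft l u v t s))%N.
Proof.
elim: t => [x|g a IHa b IHb] /=.
  by rewrite inE eq_sym /graft /=; case: eqP; rewrite /= ?nvertices_tmap ?mul1n ?mul0n ?add0n.
rewrite mem_cat; move: IHa IHb; rewrite /graft /=.
by case: (l \in leaves a); case: (l \in leaves b); rewrite /= ?mul1n ?mul0n; lia.
Qed.

(** The combinations of monomials with at least two vertices form an ideal that contains the
    relation, since grafting loses no vertices. *)
Lemma nm_ideal_big (X : finType) (chi : X -> colour) c p :
  sym_ideal_gen (nm_rels k) (Sig := Nn) chi c p -> all (fun t => 1 < nvertices t)%N (dom p).
Proof.
move=> /(_ (fun X chi c p => all (predI (@monomial _ Nn X chi c) (fun t => 1 < nvertices t)%N) (dom p))).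
move=> H; suff /allP h : all (predI (@monomial _ Nn X chi c) (fun t => 1 < nvertices t)%N) (dom p).
  by apply/allP => t /h /andP[].
apply: H => [|r [<-|//]]; last first.
  rewrite /= domU1 /= andbT; apply/andP; split=> //; apply/andP; split=> //.
  by apply/forallP => -[[|[|[|]]] ?].
split=> [Y psi d f h|Y psi d|Y Z psi xi d h f hf|Y Y' Z psi psi' xi d l u v f g gr gc hf hg|
         Y Y' Z psi psi' xi d l u v f g gr gc hf hg].
- by apply: sub_all h => t /andP[].
- by split=> [|a f g hf hg]; [apply: all_dom0|apply: all_dom_lin].
- apply: (all_dom_fgmap hf) => t /andP[ht bt]; rewrite /= nvertices_tmap bt andbT.
  exact: monomial_tmap ht.
- apply: (all_dom_graft hf hg) => t s /andP[ht bt] hs /=.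
  rewrite (monomial_graft gr gc ht hs) (leq_trans bt) //.
  by apply: leq_trans (graft_nvertices l u v t s); rewrite leq_addr.
- apply: (all_dom_graft hf hg) => t s ht /andP[hs bs] /=.
  rewrite (monomial_graft gr gc ht hs) (leq_trans bs) //.
  apply: leq_trans (graft_nvertices l u v t s).
  by rewrite (perm_mem (monomial_leaves ht)) mem_enum mul1n leq_addl.
Qed.

Lemma subst_nm_ideal (X : choiceType) (J : finType) (col : J -> colour) c (s : J -> ftree X) p :
  sym_ideal_gen (nm_rels k) (Sig := Nn) col c p -> subst s p = 0.
Proof.
move=> /nm_ideal_big /allP h; rewrite /subst fgliftE big_seq big1 // => t /h bt.
by rewrite subst_tree_big ?scaler0.
Qed.
End Substitution.

Arguments ct_m {k I P Q X chi c} t : rename.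
Arguments ct_col {k I P Q X chi c} t j : rename.
Arguments ct_f {k I P Q X chi c} t x : rename.
Arguments ct_p {k I P Q X chi c} t : rename.
Arguments ct_q {k I P Q X chi c} t j : rename.

(** * The map from the composition to Lie-Rinehart *)

Section Psi.
Variable k : fieldType.
Local Notation Sg := (lr_sig full).
Local Notation Nn := (lr_sig [:: opm]).
Local Notation ftree X := {freeg (tree lr_op X) / k}.
Local Notation MLR := (sym_ideal_gen (lr_rels_full k) (Sig := Sg)).
Local Notation MN := (sym_ideal_gen (nm_rels k) (Sig := Nn)).
Local Notation Q := (DCom1_Lie k).

Definition dl_ops (c : colour) : seq lr_op := if c is colS then [:: alpha; opd] else [:: beta].
Definition dl_rels (c : colour) : seq (relation k colour lr_op) :=
  if c is colS then dcom_rels k else lie_rels k.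
Definition dl_ideal (c : colour) : sym_family k (lr_sig (dl_ops c)) :=
  sym_ideal_gen (dl_rels c) (Sig := lr_sig (dl_ops c)).
Arguments dl_ideal c [X] chi d f.

Lemma lr_ideal : sym_ideal MLR. Proof. by apply: sym_gen_ideal => r; apply: lr_rels_hom. Qed.
Lemma nm_ideal : sym_ideal MN. Proof. by apply: sym_gen_ideal => r; apply: nm_rels_hom. Qed.
Lemma dl_ideal_ideal c : sym_ideal (dl_ideal c).
Proof.
by case: c; apply: sym_gen_ideal => r; [apply: dcom_rels_hom|apply: lie_rels_hom].
Qed.

Lemma monomial_sub_sig s (X : finType) (chi : X -> colour) c (t : tree lr_op X) :
  @monomial _ (lr_sig s) _ chi c t -> @monomial _ Sg _ chi c t.
Proof.
rewrite /monomial => /andP[ht ->]; rewrite andbT; elim: t c ht => //= g a IHa b IHb c /and4P[_ -> /IHa -> /IHb ->].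
by rewrite !andbT; case: g.
Qed.

Lemma homogeneous_sub_sig s (X : finType) (chi : X -> colour) c (f : ftree X) :
  @homogeneous k _ (lr_sig s) _ chi c f -> @homogeneous k _ Sg _ chi c f.
Proof. by apply: sub_all => t; apply: monomial_sub_sig. Qed.

(** The trace of the ideal of Lie-Rinehart on trees in the operations s is an ideal of the smaller
    free operad, so it contains the ideal generated there by any of the relations of Lie-Rinehart
    that involve only s. *)
Lemma restrict_ideal s : @sym_ideal k _ (lr_sig s) (fun (X : finType) chi c (f : ftree X) =>
   @homogeneous k _ (lr_sig s) _ chi c f /\ MLR chi c f).
Proof.
have H := homogeneous_ideal k (lr_sig s); have L := lr_ideal.
split=> [X chi c f [] //|X chi c|X Y chi psi c h f [hf Mf]|X Y Z chi psi xi c l u v f g gr gc [hf Mf] hg|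
  X Y Z chi psi xi c l u v f g gr gc hf [hg Mg]].
- have [H0 HL] := symi_subspace H chi c; have [L0 LL] := symi_subspace L chi c.
  by split=> // a u v [hu Mu] [hv Mv]; split; [apply: HL|apply: LL].
- by split; [apply: (symi_relabel H)|apply: (symi_relabel L)].
- split; first exact: (symi_graftl H gr gc hf hg).
  exact: (symi_graftl L gr gc Mf (homogeneous_sub_sig hg)).
- split; first exact: (symi_graftr H gr gc hf hg).
  exact: (symi_graftr L gr gc (homogeneous_sub_sig hf) Mg).
Qed.

Lemma dl_ideal_lr c (X : finType) (chi : X -> colour) d (f : ftree X) : dl_ideal c chi d f -> MLR chi d f.
Proof.
move=> h; suff [] : @homogeneous k _ (lr_sig (dl_ops c)) _ chi d f /\ MLR chi d f by [].
apply: (h _ (restrict_ideal (dl_ops c))); case: c {h} => r hr; split.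
- exact: dcom_rels_hom.
- apply: sym_gen_rel; case: hr => [<-|]; first by left.
  by case=> [<-|[<-|//]]; do 2!right; [left|do 2!right; left].
- exact: lie_rels_hom.
apply: sym_gen_rel; case: hr => [<-|[<-|//]]; first by right; left.
by do 3!right; left.
Qed.

Definition dl_rep (X : finType) (chi : X -> colour) c : Q X chi c -> ftree X :=
  match c return Q X chi c -> ftree X with
  | colS => @rep k _ dcom_sig (dcom_rels k) X chi colS
  | colL => @rep k _ lie_sig (lie_rels k) X chi colL
  end.

Definition dl_cls (X : finType) (chi : X -> colour) c : ftree X -> Q X chi c :=
  match c return ftree X -> Q X chi c with
  | colS => @cls k _ dcom_sig (dcom_rels k) X chi colS
  | colL => @cls k _ lie_sig (lie_rels k) X chi colL
  end.

Section DL.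
Variables (X : finType) (chi : X -> colour) (c : colour).
Local Notation dhom := (@homogeneous k _ (lr_sig (dl_ops c)) X chi c).

Lemma dl_rep_hom (x : Q X chi c) : dhom (dl_rep x).
Proof. by case: c x => x; apply: rep_hom. Qed.

Lemma dl_cls_rep (x : Q X chi c) : dl_cls chi c (dl_rep x) = x.
Proof. by case: c x => x; apply: cls_rep. Qed.

Lemma dl_cls_linear : linear (@dl_cls X chi c).
Proof.
by case: c => a u v; [apply: (@cls_linear k _ dcom_sig)|apply: (@cls_linear k _ lie_sig)].
Qed.

Lemma dl_rep_cls f : dhom f -> dl_ideal c chi c (dl_rep (dl_cls chi c f) - f).
Proof.
have := dl_ideal_ideal c; rewrite /dl_ideal; case: c => id hf; exact: (rep_cls id hf).
Qed.

Lemma dl_cls_eq f g : dhom f -> dhom g -> dl_ideal c chi c (f - g) ->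
  dl_cls chi c f = dl_cls chi c g.
Proof.
by have := dl_ideal_ideal c; rewrite /dl_ideal; case: c => id hf hg /(cls_eq id hf hg).
Qed.

Lemma dl_rep_linear a (x y : Q X chi c) :
  dl_ideal c chi c (dl_rep (a *: x + y) - (a *: dl_rep x + dl_rep y)).
Proof.
by have := dl_ideal_ideal c; rewrite /dl_ideal; case: c x y => x y id; apply: (rep_linear id).
Qed.
End DL.

Lemma dl_rep_map (X Y : finType) (chi : X -> colour) (psi : Y -> colour) c (h : cbij chi psi)
    (x : Q X chi c) : dl_ideal c psi c (dl_rep (cmap h x) - fgmap (tmap h) (dl_rep x)).
Proof.
by have := dl_ideal_ideal c; rewrite /dl_ideal; case: c x => x id; apply: (rep_op_map id).
Qed.

Lemma fgmap_val_val (X Y : finType) (h : X -> Y) (P : pred X) (R : pred Y)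
    (g : {x | P x} -> {y | R y}) (F : ftree {x | P x}) : (forall x, val (g x) = h (val x)) ->
  fgmap (tmap val) (fgmap (tmap g) F) = fgmap (tmap h) (fgmap (tmap val) F).
Proof.
move=> e; rewrite !fgmap_comp; congr (fgmap _ F); apply: funext => t.
by rewrite /= !tmap_tmap; apply: eq_in_tmap => x _; apply: e.
Qed.

Section CompTerm.
Variables (X : finType) (chi : X -> colour) (c : colour).
Local Notation term := (comp_term (Nm k) Q chi c).

Definition branches (m : nat) (col : 'I_m -> colour) (f : X -> 'I_m)
    (q : forall j, Q (fibre f j) (fun x => chi (val x)) (col j)) (j : 'I_m) : ftree X :=
  fgmap (tmap val) (dl_rep (q j)).

Lemma branches_hom m col (f : X -> 'I_m) q : hom_fib chi col f (@branches m col f q).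
Proof.
move=> j; exists (dl_rep (q j)) => //.
exact: homogeneous_sub_sig (dl_rep_hom (q j)).
Qed.

Definition expand (t : term) : ftree X :=
  subst (branches (ct_q t)) (@rep k _ Nn (nm_rels k) _ _ _ (ct_p t)).

Lemma expand_hom t : @homogeneous k _ Sg _ chi c (expand t).
Proof. by apply: subst_hom (branches_hom _); apply: rep_hom. Qed.

Definition psi_term (t : term) : LieRinehart k X chi c := cls (lr_rels_full k) (Sig := Sg) chi c (expand t).

Definition psi (x : composition (Nm k) Q X chi c) : LieRinehart k X chi c :=
  fglift (psi_term : {classic term} -> _) (quot_repr x).

Lemma psi_term_lin a t t1 t2 : MLR chi c (expand t - (a *: expand t1 + expand t2)) ->
  psi_term t = a *: psi_term t1 + psi_term t2.
Proof.
move=> h; rewrite /psi_term -cls_linear; apply/(cls_eq lr_ideal) => //.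
  exact: expand_hom.
by apply: homogeneous_lin; apply: expand_hom.
Qed.
End CompTerm.
End Psi.
Arguments dl_ideal {k} c [X] chi d f.

Section PsiMap.
Variable k : fieldType.
Local Notation Sg := (lr_sig full).
Local Notation Nn := (lr_sig [:: opm]).
Local Notation ftree X := {freeg (tree lr_op X) / k}.
Local Notation MLR := (sym_ideal_gen (lr_rels_full k) (Sig := Sg)).
Local Notation MN := (sym_ideal_gen (nm_rels k) (Sig := Nn)).
Local Notation Q := (DCom1_Lie k).

Lemma ideal_opp (Sig : signature colour) (M : sym_family k Sig) (X : finType)
  (chi : X -> colour) c f : sym_ideal M -> M X chi c f -> M X chi c (- f).
Proof.
move=> idM Mf; have [M0 ML] := symi_subspace idM chi c.
by rewrite -scaleN1r -[_ *: _]addr0; apply: ML.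
Qed.

Lemma subM_lr (X : finType) (chi : X -> colour) (P : pred X) c (F : ftree {x | P x}) :
  dl_ideal c (chi \o val) c F -> subM MLR chi P c (fgmap (tmap val) F).
Proof. by move=> h; exists F; last exact: dl_ideal_lr h. Qed.

Lemma eq_subM (M : sym_family k Sg) (X : finType) (chi : X -> colour) (P P' : pred X) c c'
  (F : ftree X) : P =1 P' -> c = c' -> subM M chi P c F -> subM M chi P' c' F.
Proof. by move=> /funext -> ->. Qed.

Lemma psi_rel (X : finType) (chi : X -> colour) c r :
  comp_rel (P := Nm k) (Q := Q) r -> fglift (@psi_term k X chi c : {classic _} -> _) r = 0.
Proof.
have L := fglift_linear (@psi_term k X chi c : {classic _} -> _).
have idM := lr_ideal k.
case=> [m col f hf a p1 p2 q|m col f hf p j a q q1 q2 hq hqj|m col f hf p q s hsf];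
  rewrite /comp_gen (linB L) ?(linD L) ?(linZ _ _ L) !liftU !scale1r; apply/eqP;
  rewrite subr_eq0; apply/eqP.
- apply: psi_term_lin; rewrite /expand /=.
  rewrite -(subst_linear (branches q)) -(linB (subst_linear (branches q))).
  rewrite (subst_nm_ideal (col := col) (c := c)); last exact: (@rep_linear k _ Nn _ (nm_ideal k) _ col c a p1 p2).
  by case: (symi_subspace idM chi c).
- apply: psi_term_lin; rewrite /expand /=.
  (* The representatives depend linearly on [q j] only modulo the ideal. The family t replaces the
     branch at j by the exact combination, so that [subst_linr] applies; the difference is left to
     [subst_diff]. *)
  pose t i := if i == j then a *: branches q1 j + branches q2 j else branches q i.
  have tE i : i != j -> t i = branches q1 i /\ t i = branches q2 i.
    by move=> ij; rewrite /t (negbTE ij) /branches; case: (hq i ij) => e1 e2; rewrite -e1 -e2.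
  have tj : t j = a *: branches q1 j + branches q2 j by rewrite /t eqxx.
  rewrite -(subst_linr (rep_hom p) tE tj).
  have bq := branches_hom q; have b1 := branches_hom q1; have b2 := branches_hom q2.
  apply: (subst_diff (f := f)) => // [|i|i]; first exact: rep_hom.
    rewrite /t; case: eqP => [->|_]; last exact: bq.
    have [F1 <- H1] := b1 j; have [F2 <- H2] := b2 j.
    by exists (a *: F1 + F2); [rewrite fgmap_linear|apply: homogeneous_lin].
  rewrite /t; case: (eqVneq i j) => [->|_]; last first.
    by rewrite subrr; apply: (fib0 chi col f idM i).
  rewrite /branches -(fgmap_linear (k := k)) -(linB (fgmap_linear (k := k) _)).
  by apply: subM_lr; rewrite hqj; apply: dl_rep_linear.
set u := CompTerm hf p q; set v := CompTerm _ _ _.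
rewrite -[RHS]add0r -[in RHS](scale0r (psi_term v)).
apply: psi_term_lin; rewrite scale0r add0r /expand /=.
(* The representative of the permuted p is a relabelling of that of p up to the ideal of N_m, which
   substitution kills. The permutation thereby moves from p to the indices of the branches. *)
have := rep_op_map (nm_ideal k) (cbij_perm col s) p.
set p' := rep (op_map _ _) => hp'.
have -> : subst (branches (ct_q v)) p' = subst (branches (ct_q v) \o s) (rep p).
  rewrite -(subst_relabel s); apply/eqP; rewrite -subr_eq0 -(linB (subst_linear _)).
  by apply/eqP; apply: subst_nm_ideal hp'.
have bv := branches_hom (ct_q v).
apply: (subst_diff (f := f)); [exact: idM|exact: rep_hom|exact: branches_hom|move=> j|move=> j].
  by apply: eq_subM (bv (s j)) => [x|] /=; rewrite ?(inj_eq perm_inj) ?permK.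
suff H : forall i : 'I_m, subM MLR chi (fun x => s (f x) == i) (col ((s^-1)%g i))
    (branches q ((s^-1)%g i) - branches (ct_q v) i).
  have := H (s j); rewrite permK; apply: eq_subM => // x.
  by rewrite (inj_eq perm_inj).
move=> i; pose fb := fibre_fun (h := cbij_id chi) (f := f) (g := fun x => s (f x))
  (j := (s^-1)%g i) (l := i) (perm_fibre_eq chi s f i).
have -> : branches q ((s^-1)%g i) = fgmap (tmap val)
    (fgmap (tmap fb) (dl_rep (q ((s^-1)%g i)))) :> ftree X.
  rewrite (fgmap_val_val (h := id)) // fgmap_comp; congr (fgmap _ _); apply: funext => t /=.
  by rewrite (tmap_id (Sig := Sg)).
rewrite /branches -(linB (fgmap_linear (k := k) _)); apply: subM_lr.
rewrite -opprB; apply: ideal_opp (dl_ideal_ideal k _) _.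
exact: dl_rep_map.
Qed.

Lemma psi_pi (X : finType) (chi : X -> colour) c r :
  psi (quot_pi (@comp_rel k _ (Nm k) Q X chi c) r) = fglift (@psi_term k X chi c : {classic _} -> _) r.
Proof.
have L := fglift_linear (@psi_term k X chi c : {classic _} -> _).
apply/eqP; rewrite -subr_eq0 /psi -(linB L); apply/eqP.
have /quot_piP h := quot_reprK (quot_pi (@comp_rel k _ (Nm k) Q X chi c) r).
apply: (h (fun u => fglift (@psi_term k X chi c : {classic _} -> _) u = 0)) => [|u]; last exact: psi_rel.
by split=> [|a u v hu hv]; rewrite ?(lin0 L) // L hu hv scaler0 addr0.
Qed.

Lemma psi_linear (X : finType) (chi : X -> colour) c : linear (@psi k X chi c).
Proof.
move=> a x y; rewrite -[x]quot_reprK -[y]quot_reprK -quot_pi_linear !psi_pi.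
exact: fglift_linear.
Qed.

Lemma psi_gen (X : finType) (chi : X -> colour) c (t : {classic comp_term (Nm k) Q chi c}) :
  psi (quot_pi (@comp_rel k _ (Nm k) Q X chi c) << t >>) = psi_term t.
Proof. by rewrite psi_pi liftU scale1r. Qed.

Lemma psi_map (X Y : finType) (chi : X -> colour) (xi : Y -> colour) c (h : cbij chi xi)
    (x : composition (Nm k) Q X chi c) :
  psi (cmap h x) = cmap h (psi x).
Proof.
move: x; apply: (quot_ext (f := @psi k _ _ _ \o _) (g := op_map h \o @psi k _ _ _)).
- by move=> a u v; rewrite /= comp_map_linear; apply: psi_linear.
- by move=> a u v; rewrite /= (@psi_linear _ chi c); apply: op_map_linear.
move=> t; rewrite /= /comp_map qmap_gen; last exact: comp_map_compat.
rewrite !psi_gen {2}/psi_term op_map_cls; last exact: expand_hom.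
apply/(cls_eq (lr_ideal k)); [exact: expand_hom|exact: homogeneous_relabel (expand_hom t)|].
rewrite /relabel /expand fgmap_subst.
pose fb j := fibre_fun (h := h) (f := ct_f t) (g := fun y => ct_f t (cbij_inv h y))
  (comp_map_fibre h (ct_f t) j).
have E j : fgmap (tmap h) (branches (ct_q t) j) =
    fgmap (tmap val) (fgmap (tmap (fb j)) (dl_rep (ct_q t j))).
  by symmetry; apply: (fgmap_val_val (h := h) (g := fb j)).
apply: (subst_diff (f := fun y => ct_f t (cbij_inv h y)) (lr_ideal k)).
- exact: rep_hom.
- exact: branches_hom.
- move=> j; rewrite E; exists (fgmap (tmap (fb j)) (dl_rep (ct_q t j))) => //.
  apply: homogeneous_sub_sig.
  exact: (homogeneous_relabel (fibre_cbij (comp_map_fibre h (ct_f t) j)) (dl_rep_hom (ct_q t j))).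
move=> j; rewrite E /branches -(linB (fgmap_linear (k := k) _)); apply: subM_lr.
exact: (dl_rep_map (fibre_cbij (comp_map_fibre h (ct_f t) j)) (ct_q t j)).
Qed.
End PsiMap.

Lemma normal_tmap (f : nat -> nat) t :
  {in leaves t &, {homo f : i j / (i < j)%N}} -> normal (tmap f t) = normal t.
Proof.
elim: t => //= g a IHa b IHb H; rewrite -!/(tmap _ _).
have Ha : {in leaves a &, {homo f : i j / (i < j)%N}}.
  by move=> x y xa ya; apply: H; rewrite mem_cat ?xa ?ya.
have Hb : {in leaves b &, {homo f : i j / (i < j)%N}}.
  by move=> x y xb yb; apply: H; rewrite mem_cat ?xb ?yb ?orbT.
rewrite IHa // IHb //; congr (~~ (_ || _) && _); last by case: (b).
case: a {IHa Ha} H => //= h x y H; rewrite -!/(tmap _ _); congr (bad_left g h _).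
have Hy : {in leaves y &, {homo f : i j / (i < j)%N}}.
  by move=> i j iy jy; apply: H; rewrite !mem_cat ?iy ?jy ?orbT.
rewrite !minl_mono //.
have yt : minl y \in (leaves x ++ leaves y) ++ leaves b by rewrite !mem_cat minl_in orbT.
have bt : minl b \in (leaves x ++ leaves y) ++ leaves b by rewrite !mem_cat minl_in orbT.
case: (ltngtP (minl y) (minl b)) => [lt|lt|->]; [exact: H| |exact: ltnn].
by have := H _ _ bt yt lt; lia.
Qed.

(** The map [r] orders the labels. It is needed because normal forms are also taken for branches,
    whose labels form a fibre and not an initial segment. *)
Definition normal_mono (sg : pred sh_op) (X : finType) (r : X -> nat) (chi : X -> colour) c :=
  fun N : tree sh_op X =>
    [&& @monomial _ (shs sg) _ chi c N, shuf (tmap r N) & normal (tmap r N)].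

(** * Bijectivity *)

Section NormalSpan.
Variables (k : fieldType) (s : seq lr_op) (M : sym_family k (lr_sig s)).
Hypothesis idM : sym_ideal M.
Hypothesis M_alpha : alpha \in s -> M (@rel_col _ _ _ (alpha_sym k)) colS (rel_elt (alpha_sym k)).
Hypothesis M_beta : beta \in s -> M (@rel_col _ _ _ (beta_skew k)) colL (rel_elt (beta_skew k)).
Hypothesis rules : has_rules (pull M).
Variables (X : finType) (r : X -> nat) (chi : X -> colour) (c : colour).
Hypothesis r_inj : injective r.

Let A := sort leq [seq r x | x <- enum X].

Lemma rank_bij : exists h : 'I_(size A) -> X,
  bijective h /\ forall i, r (h i) = lab i.
Proof.
have uA : uniq A by rewrite sort_uniq (map_inj_uniq r_inj) enum_uniq.
have H (i : 'I_(size A)) : exists x, r x = lab i.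
  by have := @lab_in A i; rewrite mem_sort => /mapP[x _ ->]; exists x.
have G x : exists i : 'I_(size A), lab i = r x.
  by apply: lab_ex; rewrite mem_sort map_f ?mem_enum.
have [h hE] := choice H; have [h' h'E] := choice G.
exists h; split=> //; exists h' => [i|x]; first by apply: (@lab_inj A uA); rewrite h'E hE.
by apply: r_inj; rewrite hE h'E.
Qed.

(** Replacing labels by their ranks with respect to r and straightening leads to a shuffle monomial,
    which is reduced modulo [pull M]; ranks are increasing, so normality survives the way back. *)
Lemma normal_span (t : tree lr_op X) : @monomial _ (lr_sig s) _ chi c t ->
  exists2 g : {freeg (tree sh_op X) / k},
    all (normal_mono (sg_of s) r chi c) (dom g) &
    M chi c (<< t >> - fgmap (@from_sh X) g).
Proof.
move=> mt; have [h [[hi hK hiK] rh]] := rank_bij.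
pose b := @Cbij _ _ _ (chi \o h) chi h hi hK hiK (fun=> erefl).
have bt : @monomial _ (lr_sig s) _ (chi \o h) c (tmap hi t).
  pose b' := @Cbij _ _ _ chi (chi \o h) hi h hiK hK (fun x => congr1 chi (hiK x)).
  exact: (monomial_tmap b' mt).
have [g ng [_ Mg]] := spanned_mono (pull_ideal idM) rules (sh_tree_monomial bt).
have := straighten idM M_alpha M_beta val bt; rewrite shr_val; set q := rsign _ _ _ => St.
exists (fgmap (tmap h) (q *: g)).
  have nq : all (fun t => sh_monomial (Sig := shs (sg_of s)) (chi \o h) c t && onormal t) (dom (q *: g)).
    by rewrite -[q *: g]addr0; apply: all_dom_lin => //; apply: all_dom0.
  apply: (all_dom_fgmap nq) => N /andP[/andP[mN shN] nN].
  have E : tmap r (tmap h N) = tmap (nth 0%N A) (tmap val N).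
    by rewrite !tmap_tmap; apply: eq_in_tmap => i _ /=; rewrite rh.
  have mono : {in leaves (tmap val N) &, {homo nth 0%N A : i j / (i < j)%N}}.
    have sA : sorted ltn A.
      rewrite ltn_sorted_uniq_leq sort_uniq (map_inj_uniq r_inj) enum_uniq.
      by apply: sort_sorted; apply: leq_total.
    move=> i j; rewrite leaves_tmap' => /mapP[i' _ ->] /mapP[j' _ ->] ij.
    exact: (lab_mono sA ij).
  apply/and3P; split; first exact: (monomial_tmap (Sig := shs (sg_of s)) b mN).
    by rewrite E shuf_tmap // -(@is_shuffle_shuf (shs (sg_of s))).
  by rewrite E normal_tmap.
have [M0 ML] := symi_subspace idM (chi \o h) c.
have := symi_relabel idM b (ML q _ _ Mg St).
rewrite /relabel (linB (fgmap_linear (k := k) _)) fgmapU scalerBr.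
rewrite addrC addrA subrK (linB (fgmap_linear (k := k) _)) fgmapU /=.
rewrite tmap_tmap (tmap_id (Sig := lr_sig s)) //.
rewrite -(linZ _ _ (fgmap_linear (k := k) _)) !fgmap_comp.
have -> // : tmap h \o @from_sh 'I_(size A) = @from_sh X \o tmap h.
by apply: funext => N /=; rewrite from_sh_tmap.
Qed.
End NormalSpan.

Section NormalSpanInstances.
Variable k : fieldType.

Lemma lr_normal_span (X : finType) (r : X -> nat) (chi : X -> colour) c (t : tree lr_op X) :
  injective r -> @monomial _ (lr_sig full) _ chi c t ->
  exists2 g : {freeg (tree sh_op X) / k},
    all (normal_mono predT r chi c) (dom g) &
    sym_ideal_gen (lr_rels_full k) (Sig := lr_sig full) chi c (<< t >> - fgmap (@from_sh X) g).
Proof.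
have R := @sym_gen_rel k _ (lr_sig full) (lr_rels_full k).
rewrite -sg_full => ri; apply: (normal_span (lr_ideal k)) => // [_|_|].
- by apply: (R (alpha_sym k)); left.
- by apply: (R (beta_skew k)); right; left.
apply: (pull_rules (lr_ideal k) R) => //=; by intuition.
Qed.

Lemma dl_normal_span d (X : finType) (r : X -> nat) (chi : X -> colour) c (t : tree lr_op X) :
  injective r -> @monomial _ (lr_sig (dl_ops d)) _ chi c t ->
  exists2 g : {freeg (tree sh_op X) / k},
    all (normal_mono (sg_of (dl_ops d)) r chi c) (dom g) &
    dl_ideal d chi c (<< t >> - fgmap (@from_sh X) g).
Proof.
have id := dl_ideal_ideal k d.
have R := @sym_gen_rel k _ (lr_sig (dl_ops d)) (dl_rels k d).
move=> ri; apply: (normal_span id) => //; case: d id R => id R //.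
- by move=> _; apply: (R (alpha_sym k)); left.
- by move=> _; apply: (R (beta_skew k)); left.
- apply: (pull_rules id R) => //=; by intuition.
- apply: (pull_rules id R) => //=; by intuition.
Qed.
End NormalSpanInstances.

(** * Generators of the composition given by trees *)

Section Generators.
Variable k : fieldType.
Local Notation Sg := (lr_sig full).
Local Notation Nn := (lr_sig [:: opm]).
Local Notation ftree X := {freeg (tree lr_op X) / k}.
Local Notation MLR := (sym_ideal_gen (lr_rels_full k) (Sig := Sg)).
Local Notation MN := (sym_ideal_gen (nm_rels k) (Sig := Nn)).
Local Notation Q := (DCom1_Lie k).
Local Notation nmon := (@monomial _ Nn _).
Local Notation dlmon c := (@monomial _ (lr_sig (dl_ops c)) _).

(** No operation of N_m has output S, so the left input of m is always a leaf. A tree with at least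
    two vertices is therefore m(i, m(j, C)), the relation with C grafted on its last leaf. *)
Lemma nm_big (J : finType) (col : J -> colour) c T : nmon col c T -> (1 < nvertices T)%N ->
  MN col c << T >>.
Proof.
have noS (t : tree lr_op J) : @typed _ Nn _ col colS t -> exists j, t = Leaf j /\ col j = colS.
  case: t => [j /eqP|g a b /and4P[]]; first by exists j.
  by rewrite /= inE => /eqP->.
case: T => [//|g a [z|h b C]] mT; move: (mT) => /andP[/= /and4P[gE tE ta tT'] /forallP hl];
  move: gE; rewrite inE => /eqP gE; subst g; have {ta} [i [ea ci]] := noS a ta; subst a => //.
case/and4P: tT' => hE _ tb tC _; move: hE; rewrite /= inE => /eqP hE; subst h.
have {tb} [j [eb cj]] := noS b tb; subst b; have idN := nm_ideal k.
have <- : colL = c := eqP tE.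
pose P x := (x != i) && (x != j).
have cnt x : ((i == x) + ((j == x) + count_mem x (leaves C)) = 1)%N by apply/eqP/hl.
have [C' eC] : exists C' : tree lr_op {x | P x}, tmap val C' = C.
  apply: tree_sub => x; rewrite -has_pred1 has_count unfold_in /P ![x == _]eq_sym.
  have := cnt x; case: (i == x); case: (j == x); by case: (count_mem x (leaves C)) => [|[]].
have uC : uniq (leaves C).
  apply: count_mem_uniq => x; rewrite -has_pred1 has_count.
  have := cnt x; case: (i == x); case: (j == x); by case: (count_mem x (leaves C)) => [|[]].
have mC : nmon (col \o val) colL C'.
  apply: monomial_sub; rewrite eC // => x /andP[xi xj].
  rewrite -has_pred1 has_count; have := cnt x.
  by rewrite ![_ == x]eq_sym (negbTE xi) (negbTE xj) /=; case: (count_mem x (leaves C)).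
have MR : MN (@rel_col _ _ _ (m_nilpotent k)) colL (rel_elt (m_nilpotent k)).
  by apply: (@sym_gen_rel k _ Nn (nm_rels k) (m_nilpotent k)); left.
(* The third value is the dummy at the leaf on which C is grafted. *)
pose u : 'I_3 -> J := fun3 i j j.
have gr : grafting (@Ordinal 3 2 isT) u (val : {x | P x} -> J).
  apply/forallP => x; apply/eqP.
  rewrite card_sub_eq.
  have -> : #|[pred y : 'I_3 | (y != Ordinal (isT : (2 < 3)%N)) && (u y == x)]| = ((i == x) + (j == x))%N.
    by rewrite -sum1_card big_mkcond !big_ord_recr big_ord0 /= !inE /u /=; do 2!case: eqP.
  have := cnt x; rewrite /P ![x == _]eq_sym; case: (i == x); case: (j == x) => //=; lia.
have gc : graft_colours (@rel_col _ _ _ (m_nilpotent k)) (col \o val) col (@Ordinal 3 2 isT) u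
    (val : {x | P x} -> J).
  by split=> // -[[|[|[|]]] ?] //= ne; case: ne; apply: val_inj.
have hC : @homogeneous k _ Nn _ (col \o val) colL << C' >> by rewrite /homogeneous domU1 /= mC.
have := symi_graftl idN gr gc MR hC.
by rewrite /graft_lin !liftU !scale1r /graft /= eC.
Qed.

Lemma dl_map_cls (X Y : finType) (chi : X -> colour) (psi : Y -> colour) c (h : cbij chi psi)
    (f : ftree X) :
  @homogeneous k _ (lr_sig (dl_ops c)) _ chi c f ->
  cmap h (dl_cls chi c f) = dl_cls psi c (fgmap (tmap h) f) :> Q Y psi c.
Proof. by case: c => hf; [apply: (@op_map_cls k _ dcom_sig)|apply: (@op_map_cls k _ lie_sig)]. Qed.

(* t as a tree with leaves in P, or the junk value 0 if there are others *)
Definition low (X : finType) (P : pred X) (t : tree lr_op X) : ftree {x | P x} :=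
  if pselect (exists t' : tree lr_op {x | P x}, tmap val t' = t) is left e
  then << projT1 (cid e) >> else 0.

Lemma lowK (X : finType) (P : pred X) (t : tree lr_op {x | P x}) : low P (tmap val t) = << t >>.
Proof.
rewrite /low; case: pselect => [e|[]]; last by exists t.
by case: cid => t' /= /(tmap_inj val_inj) ->.
Qed.

Section Component.
Variables (X : finType) (chi : X -> colour) (c : colour).
Local Notation Comp := (composition (Nm k) Q X chi c).

Section Terms.
Variables (m : nat) (col : 'I_m -> colour) (f : X -> 'I_m).
Hypothesis hf : forall j, exists x, f x = j.

Definition term_class (p : Nm k _ col c)
    (q : forall j, Q (fibre f j) (fun x => chi (val x)) (col j)) : Comp :=
  quot_pi _ << (CompTerm hf p q : {classic _}) >>.

Lemma term_class_linl q : linear (fun p => term_class p q).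
Proof.
move=> a p1 p2; rewrite /term_class -quot_pi_linear; apply/quot_piP.
by apply: linspan_sub; apply: comp_rel_linl.
Qed.

Lemma term_class_linr p j a q q1 q2 :
  (forall i, i != j -> q i = q1 i /\ q i = q2 i) -> q j = a *: q1 j + q2 j ->
  term_class p q = a *: term_class p q1 + term_class p q2.
Proof.
move=> h e; rewrite /term_class -quot_pi_linear; apply/quot_piP.
by apply: linspan_sub; apply: comp_rel_linr h e.
Qed.

(** By multilinearity the factors may be taken from spanning sets one at a time; the list r below
    holds the indices of the factors that are still arbitrary. *)
Lemma term_class_span (W : Comp -> Prop) p
    (S : forall j, Q (fibre f j) (fun x => chi (val x)) (col j) -> Prop) :
  subspace W -> (forall j x, linspan (S j) x) ->
  (forall q, (forall j, S j (q j)) -> W (term_class p q)) ->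
  forall q, W (term_class p q).
Proof.
move=> [W0 WL] hS H.
suff G (r : seq 'I_m) q : (forall j, j \notin r -> S j (q j)) -> W (term_class p q).
  by move=> q; apply: (G (enum 'I_m)) => j; rewrite mem_enum.
elim: r q => [|j r IH] q hq; first by apply: H => j; apply: hq.
have wq y : S j y -> W (term_class p (dfwith q y)).
  move=> Sy; apply: IH => i ir; have [ij|ij] := eqVneq i j.
    by move: ir; rewrite ij dfwith_in.
  by rewrite dfwith_out 1?eq_sym //; apply: hq; rewrite inE negb_or ij.
have E a (y1 y2 : Q (fibre f j) (fun x => chi (val x)) (col j)) : term_class p (dfwith q (a *: y1 + y2)) =
    a *: term_class p (dfwith q y1) + term_class p (dfwith q y2) :> Comp.
  apply: (@term_class_linr p j a) => [i ij|]; last by rewrite !dfwith_in.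
  by rewrite !dfwith_out // eq_sym.
have -> : q = dfwith q (q j).
  apply: functional_extensionality_dep => i; have [->|ij] := eqVneq i j.
    by rewrite dfwith_in.
  by rewrite dfwith_out // eq_sym.
apply: (hS j (q j) (fun y => W (term_class p (dfwith q y)))) => //.
split=> [|a u v hu hv]; last by rewrite E; apply: WL.
have := E 1 0 0; rewrite scaler0 addr0 scale1r => e.
have e0 : term_class p (dfwith q (0 : Q (fibre f j) (fun x => chi (val x)) (col j))) = 0.
  have H0 (V : zmodType) (z : V) : z = z + z -> z = 0.
    by move=> ez; rewrite -(subrr z) {2}ez addrK.
  exact: H0 e.
by rewrite e0.
Qed.
End Terms.

(** The branches are trees on all of X, and the value is 0 if f is not surjective. In this form f
    and the branches can be rewritten independently, although the types of the factors depend on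
    f. *)
Definition gen (m : nat) (col : 'I_m -> colour) (f : X -> 'I_m) (T : tree lr_op 'I_m)
    (D : 'I_m -> tree lr_op X) : Comp :=
  if pselect (forall j, exists x, f x = j) is left hf
  then term_class hf (cls (nm_rels k) (Sig := Nn) col c << T >>)
         (fun j => dl_cls (fun x : fibre f j => chi (val x)) (col j) (low _ (D j)))
  else 0.

Section Gen.
Variables (m : nat) (col : 'I_m -> colour) (f : X -> 'I_m) (T : tree lr_op 'I_m).
Variable D' : forall j, tree lr_op (fibre f j).
Hypothesis hf : forall j, exists x, f x = j.
Hypothesis mT : nmon col c T.
Hypothesis mD : forall j, dlmon (col j) (fun x : fibre f j => chi (val x)) (col j) (D' j).
Local Notation D := (fun j => tmap val (D' j)).

Let homU (Sig : signature colour) (Y : finType) (xi : Y -> colour) d (t : tree Sig Y) :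
  monomial xi d t -> homogeneous xi d (<< t >> : {freeg _ / k}).
Proof. by move=> h; rewrite /homogeneous domU1 /= h. Qed.

Lemma genE : gen col f T D = term_class hf (cls (nm_rels k) (Sig := Nn) col c << T >>)
  (fun j => dl_cls (fun x : fibre f j => chi (val x)) (col j) << D' j >>).
Proof.
rewrite /gen; case: pselect => // hf'; rewrite (Prop_irrelevance hf' hf).
by congr term_class; apply: functional_extensionality_dep => j; rewrite lowK.
Qed.

Lemma psi_gen_tree : (nvertices T <= 1)%N ->
  psi (gen col f T D) = cls (lr_rels_full k) (Sig := Sg) chi c << bind T D >>.
Proof.
move=> sm; rewrite genE /term_class psi_gen /psi_term.
have idL := lr_ideal k.
set t := CompTerm _ _ _; have hb := branches_hom (ct_q t).
have hD : hom_fib chi col f (fun j => << D j >> : ftree X).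
  move=> j; exists << D' j >>; first by rewrite fgmapU.
  exact: homogeneous_sub_sig (homU (mD j)).
have eT : subst (fun j => << D j >> : ftree X) << T >> = << bind T D >>.
  rewrite /subst liftU scale1r; have := nm_small mT; rewrite ltnNge sm.
  by case=> // [[i [-> _ _]]|[i [j [-> _ _ _ _]]]] //=; rewrite node2U fgmapU.
have hT : @homogeneous k _ Nn _ col c << T >> by apply: homU.
apply/(cls_eq idL); first exact: expand_hom.
  by rewrite -eT; apply: subst_hom hD.
have -> : expand t = subst (branches (ct_q t)) << T >>.
  apply/eqP; rewrite -subr_eq0 /expand -(linB (subst_linear _)); apply/eqP.
  exact: subst_nm_ideal (rep_cls (nm_ideal k) hT).
rewrite -eT; apply: (subst_diff (f := f) idL hT hb hD) => j.
rewrite /branches /= -[<< tmap _ _ >>](fgmapU k) -(linB (fgmap_linear (k := k) _)).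
by apply: subM_lr; apply: dl_rep_cls; apply: homU.
Qed.

Lemma gen_perm (s : {perm 'I_m}) :
  gen col f T D = gen (fun j => col ((s^-1)%g j)) (fun x => s (f x)) (tmap s T)
                    (fun j => D ((s^-1)%g j)).
Proof.
have hsf j : exists x, s (f x) = j.
  by have [x e] := hf ((s^-1)%g j); exists x; rewrite e permKV.
rewrite genE /gen; case: pselect => // hsf'.
apply/quot_piP; apply: linspan_sub.
have := comp_rel_perm (P := Nm k) hf (cls (nm_rels k) (Sig := Nn) col c << T >>)
  (fun j => dl_cls (fun x : fibre f j => chi (val x)) (col j) << D' j >>) hsf'.
set v := (X in _ - X) => H; set z := (X in _ - X); suff <- : v = z by [].
rewrite /v /z /comp_gen; congr (<< (CompTerm _ _ _ : {classic _}) >>).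
  by rewrite /= op_map_cls ?/relabel ?fgmapU //; apply: homU.
apply: functional_extensionality_dep => j.
rewrite dl_map_cls; last by apply: homU.
rewrite fgmapU -lowK; congr (dl_cls _ _ (low _ _)).
by rewrite tmap_tmap; apply: eq_in_tmap => x _.
Qed.
End Gen.
End Component.
End Generators.

(** * Normal monomials as elements of the composition *)

Section Theta.
Variables (k : fieldType) (n : nat) (chi : 'I_n -> colour).
Local Notation Sg := (lr_sig full).
Local Notation Nn := (lr_sig [:: opm]).
Local Notation Q := (DCom1_Lie k).
Local Notation X := 'I_n.
Local Notation Comp c := (composition (Nm k) Q X chi c).
Local Notation lrcls c := (cls (lr_rels_full k) (Sig := Sg) chi c).
Implicit Types (a b A B D : tree lr_op X) (N : tree sh_op X).

Definition pair2 (T : Type) (x y : T) (j : 'I_2) : T := if j == ord0 then x else y.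

Definition side A (x : X) : 'I_2 := if x \in leaves A then ord0 else ord_max.

Lemma ord2P (j : 'I_2) : (j = ord0) \/ (j = ord_max).
Proof. by case: j => [[|[|]] // ?]; [left|right]; apply: val_inj. Qed.

Section Branches.
Variables (m : nat) (col : 'I_m -> colour) (f : X -> 'I_m) (D : 'I_m -> tree lr_op X).

Definition branching := forall j, [/\ @typed _ (lr_sig (dl_ops (col j))) _ chi (col j) (D j),
  uniq (leaves (D j)) & forall x, (x \in leaves (D j)) = (f x == j)].

Hypothesis br : branching.

Lemma branching_surj j : exists x, f x = j.
Proof.
have [_ _ H] := br j; case E : (leaves (D j)) (size_leaves (D j)) => [//|x s] _.
by exists x; apply/eqP; rewrite -H E inE eqxx.
Qed.

Lemma branching_lift : exists D' : forall j, tree lr_op (fibre f j),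
  (forall j, tmap val (D' j) = D j) /\
  (forall j, @monomial _ (lr_sig (dl_ops (col j))) _ (fun x : fibre f j => chi (val x)) (col j) (D' j)).
Proof.
have H j : exists t : tree lr_op (fibre f j), tmap val t = D j.
  by apply: tree_sub => x; case: (br j) => _ _ ->.
exists (fun j => projT1 (cid (H j))); split=> j; first by case: cid.
case: cid => t /= e; have [ty u cov] := br j.
apply: (@monomial_sub _ (lr_sig (dl_ops (col j))) _ (fun x => f x == j)); rewrite e // => x.
by rewrite cov.
Qed.

Lemma psi_gen_branching c (T : tree lr_op 'I_m) : @monomial _ Nn _ col c T -> (nvertices T <= 1)%N ->
  psi (gen k chi c col f T D) = lrcls c << bind T D >>.
Proof.
move=> mT sm; have [D' [e mD]] := branching_lift.
have -> : D = fun j => tmap val (D' j) by apply: funext => j; rewrite e.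
exact: psi_gen_tree branching_surj mT mD sm.
Qed.

Lemma gen_perm_branching c (T : tree lr_op 'I_m) (s : {perm 'I_m}) : @monomial _ Nn _ col c T ->
  gen k chi c col f T D = gen k chi c (fun j => col ((s^-1)%g j)) (fun x => s (f x)) (tmap s T)
                          (fun j => D ((s^-1)%g j)) :> Comp c.
Proof.
move=> mT; have [D' [e mD]] := branching_lift.
have -> : D = fun j => tmap val (D' j) by apply: funext => j; rewrite e.
exact: gen_perm branching_surj mT mD s.
Qed.
End Branches.

Definition theta1 c A : Comp c := gen k chi c (fun _ : 'I_1 => c) (fun=> ord0) (Leaf ord0) (fun=> A).
Definition theta2 c A B : Comp c :=
  gen k chi c (pair2 colS colL) (side A) (Node opm (Leaf ord0) (Leaf ord_max)) (pair2 A B).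

(* The normal monomials correspond to a basis of the composition: in a normal
   monomial m occurs at most once, and then at the root. *)
Definition theta c N : Comp c :=
  match N with
  | Node sh_m a b => theta2 c (from_sh a) (from_sh b)
  | Node sh_n a b => theta2 c (from_sh b) (from_sh a)
  | _ => theta1 c (from_sh N)
  end.

Lemma monomial_uniq (Sig : signature colour) (t : tree Sig X) c : monomial chi c t ->
  uniq (leaves t) /\ forall x, x \in leaves t.
Proof.
move=> /monomial_leaves p; split; first by rewrite (perm_uniq p) enum_uniq.
by move=> x; rewrite (perm_mem p) mem_enum.
Qed.

Lemma psi_theta1 c A : @monomial _ (lr_sig (dl_ops c)) _ chi c A -> psi (theta1 c A) = lrcls c << A >>.
Proof.
move=> mA; have [uA cA] := monomial_uniq mA.
apply: psi_gen_branching => // [j|].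
  by split=> // [|x]; [case/andP: mA|rewrite cA (ord1 j)].
by apply/andP; split; [rewrite /= eqxx|apply/forallP => j; rewrite (ord1 j)].
Qed.

Lemma branching_pair c A B : @monomial _ Sg _ chi c (Node opm A B) ->
  @typed _ (lr_sig [:: alpha; opd]) _ chi colS A -> @typed _ (lr_sig [:: beta]) _ chi colL B ->
  branching (pair2 colS colL) (side A) (pair2 A B).
Proof.
move=> mAB tA tB; have [/= u cov] := monomial_uniq mAB.
move: u; rewrite cat_uniq => /and3P[uA dis uB] j.
case: (ord2P j) => ->; split=> // x; rewrite /side /pair2 /=; first by case: ifP.
have := cov x; rewrite mem_cat; case: ifP => xA /= => [_|->//].
by apply: contraNF dis => xB; apply/hasP; exists x.
Qed.

Lemma monomial_pair : @monomial _ Nn _ (pair2 colS colL) colL (Node opm (Leaf ord0) (Leaf ord_max)).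
Proof. by apply/andP; split=> //; apply/forallP => j; case: (ord2P j) => ->. Qed.

Lemma psi_theta2 A B : @monomial _ Sg _ chi colL (Node opm A B) ->
  @typed _ (lr_sig [:: alpha; opd]) _ chi colS A -> @typed _ (lr_sig [:: beta]) _ chi colL B ->
  psi (theta2 colL A B) = lrcls colL << Node opm A B >>.
Proof.
move=> mAB tA tB.
exact: (psi_gen_branching (branching_pair mAB tA tB) monomial_pair).
Qed.

Lemma Comb_typed c N s : Comb N s -> @typed _ (shs predT) _ chi c N ->
  @typed _ (shs (sg_of [:: alpha; opd])) _ chi c N.
Proof.
have T N' x w : Tower N' x w -> forall c, @typed _ (shs predT) _ chi c N' ->
    @typed _ (shs (sg_of [:: alpha; opd])) _ chi c N'.
  elim=> [//|a y v l _ IH|a y v l _ IH] d /= /andP[-> /andP[h1 h2]] /=.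
    by rewrite IH.
  by rewrite h1 IH.
move=> C; elim: C c => [t x w /T H c|a b r x w _ IH /T H c /= /and3P[-> ta tb]]; first exact: H.
by rewrite IH // H.
Qed.

Lemma LieWord_typed c N x w : LieWord N x w -> @typed _ (shs predT) _ chi c N ->
  @typed _ (shs (sg_of [:: beta])) _ chi c N.
Proof. by move=> L; elim: L c => //= a y v l _ IH c /and3P[-> /IH -> ->]. Qed.

(** Combs use only alpha and d, Lie words only beta. So the parts of a normal monomial are
    operations of DCom and of Lie, and psi reassembles the tree from them. *)
Lemma psi_theta c N : normal_mono predT val chi c N -> psi (theta c N) = lrcls c << from_sh N >>.
Proof.
move=> /and3P[mN _ nN]; have /andP[tN lN] := mN.
have mF : @monomial _ Sg _ chi c (from_sh N) by rewrite from_sh_monomial sg_full.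
have small : (if N is Node (sh_m | sh_n) _ _ then False else True) ->
    @typed _ (shs (sg_of (dl_ops c))) _ chi c N -> psi (theta c N) = lrcls c << from_sh N >>.
  move=> rN tN'; have -> : theta c N = theta1 c (from_sh N) by case: (N) rN => [|[]].
  by apply: psi_theta1; rewrite from_sh_monomial; apply/andP.
have := normal_shape tN nN; case: c mN tN lN mF small => mN tN lN mF small.
  case=> [[s C] _]; apply: small (Comb_typed C tN).
  by case: (N) tN => [|[]].
case=> [[s [x [w L]]] _]; case: L mN tN lN mF small => [t y v L|a b r y v C L|a b r y v L C] mN tN lN mF small.
- by apply: small (LieWord_typed L tN); case: L.
- move: tN => /= /andP[ta tb]; apply: psi_theta2 => //.
    by rewrite from_sh_typed; apply: Comb_typed C ta.
  by rewrite from_sh_typed; apply: LieWord_typed L tb.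
move: tN => /= /andP[ta tb]; apply: psi_theta2 => //.
  by rewrite from_sh_typed; apply: Comb_typed C tb.
by rewrite from_sh_typed; apply: LieWord_typed L ta.
Qed.
End Theta.

(** * Normal monomials span the composition *)

Section CompSpan.
Variables (k : fieldType) (n : nat) (chi : 'I_n -> colour).
Local Notation Sg := (lr_sig full).
Local Notation Nn := (lr_sig [:: opm]).
Local Notation Q := (DCom1_Lie k).
Local Notation X := 'I_n.
Local Notation Comp c := (composition (Nm k) Q X chi c).
Local Notation MLR := (sym_ideal_gen (lr_rels_full k) (Sig := Sg)).
Local Notation lrcls c := (cls (lr_rels_full k) (Sig := Sg) chi c).
Local Notation nrm c := (normal_mono predT val chi c).

Section Branching.
Variables (m : nat) (col : 'I_m -> colour) (f : X -> 'I_m) (D : 'I_m -> tree lr_op X).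

Lemma gen_theta1 c i : (forall j, j = i) -> col i = c ->
  gen k chi c col f (Leaf i) D = theta1 k chi c (D i).
Proof.
move=> all_i ci.
have m1 : m = 1%N by rewrite -(card_ord m); apply: (@eq_card1 _ i) => j; rewrite !inE [j]all_i eqxx.
subst m; rewrite /theta1; have -> : col = fun _ => c by apply: funext => j; rewrite [j]all_i.
have -> : f = fun=> ord0 by apply: funext => x; rewrite [f x]ord1.
have -> : D = fun=> D i by apply: funext => j; rewrite [j]all_i.
by rewrite [i]ord1.
Qed.

End Branching.

Lemma gen_theta2_ord (col : 'I_2 -> colour) (f : X -> 'I_2) (D : 'I_2 -> tree lr_op X) :
  col ord0 = colS -> col ord_max = colL -> (forall x, (x \in leaves (D ord0)) = (f x == ord0)) ->
  gen k chi colL col f (Node opm (Leaf ord0) (Leaf ord_max)) D =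
  theta2 k chi colL (D ord0) (D ord_max).
Proof.
move=> c0 c1 H; rewrite /theta2.
have -> : side (D ord0) = f.
  by apply: funext => x; rewrite /side H; have [->|->] := ord2P (f x).
have -> : pair2 colS colL = col by apply: funext => j; have [->|->] := ord2P j.
by congr gen; apply: funext => j; have [->|->] := ord2P j.
Qed.

Lemma gen_theta2 m (col : 'I_m -> colour) (f : X -> 'I_m) (D : 'I_m -> tree lr_op X) i j :
  branching chi col f D -> (forall x, ((x == i) + (x == j) = 1)%N) ->
  col i = colS -> col j = colL ->
  gen k chi colL col f (Node opm (Leaf i) (Leaf j)) D = theta2 k chi colL (D i) (D j).
Proof.
move=> br ij ci cj.
(* Each x equals exactly one of i and j; summing over x counts the labels. *)
have m2 : m = 2%N.
  rewrite -(card_ord m) -sum1_card (eq_bigr (fun x => (x == i) + (x == j))%N) => [|x _]; last by rewrite ij.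
  by rewrite big_split /= -!big_mkcond !sum1_card !card1.
subst m; have [ei|ei] := ord2P i; have [ej|ej] := ord2P j; subst i j.
- by have := ij ord0.
- by apply: gen_theta2_ord => // x; have [_ _ ->] := br ord0.
(* The S-input has the second index here: the diagonal action of the transposition brings it to the
   first. *)
- have mT : @monomial _ Nn _ col colL (Node opm (Leaf ord_max) (Leaf ord0)).
    by rewrite /monomial /= ci cj; apply/forallP => x; have [->|->] := ord2P x.
  rewrite (gen_perm_branching k br (tperm ord0 ord_max) mT) /tmap /= tpermL tpermR tpermV.
  rewrite gen_theta2_ord ?tpermL ?tpermR // => x; have [_ _ ->] := br ord_max.
  by rewrite -(inj_eq (@perm_inj _ (tperm ord0 ord_max))) tpermR.
by have := ij ord0.
Qed.

Definition theta_span c (x : Comp c) : Prop :=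
  exists2 g : {freeg (tree sh_op X) / k}, all (nrm c) (dom g) & x = fglift (theta k chi c) g.

Lemma theta_span_subspace c : subspace (@theta_span c).
Proof.
split=> [|a x y [g hg ->] [g' hg' ->]].
  by exists 0; rewrite ?(lin0 (fglift_linear _)) //; apply: all_dom0.
by exists (a *: g + g'); [apply: all_dom_lin|rewrite fglift_linear].
Qed.

Lemma theta_span_theta c N : nrm c N -> theta_span (theta k chi c N).
Proof. by move=> nN; exists << N >>; rewrite ?all_domU // liftU scale1r. Qed.

Lemma typed_predT sg (Y : finType) (xi : Y -> colour) c (N : tree sh_op Y) :
  @typed _ (shs sg) _ xi c N -> @typed _ (shs predT) _ xi c N.
Proof. by elim: N c => //= g a IHa b IHb c /and4P[_ -> /IHa -> /IHb ->]. Qed.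

Lemma monomialP (Sig : signature colour) (Y : finType) (xi : Y -> colour) c (t : tree Sig Y) :
  typed xi c t -> uniq (leaves t) -> (forall x, x \in leaves t) -> monomial xi c t.
Proof.
by move=> ty u cov; apply/andP; split=> //; apply/forallP => x; rewrite count_uniq_mem // cov.
Qed.

(** Over the identity the single branch is itself normal. Over m the result is a node m or n,
    according to which branch has the smaller least label. A bad pattern at this root would require
    m or n at the root of the Lie branch, which has only beta. *)
Lemma theta_span_gen c m (col : 'I_m -> colour) (f : X -> 'I_m) T
    (N : forall j, tree sh_op (fibre f j)) :
  @monomial _ Nn _ col c T -> (nvertices T <= 1)%N ->
  (forall j, normal_mono (sg_of (dl_ops (col j))) (fun x : fibre f j => val (val x))
     (fun x => chi (val x)) (col j) (N j)) ->
  theta_span (gen k chi c col f T (fun j => tmap val (from_sh (N j)))).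
Proof.
move=> mT sm nN; pose N' j : tree sh_op X := tmap val (N j).
have shN j : shuf (tmap val (N' j)) /\ normal (tmap val (N' j)).
  by have /and3P[_] := nN j; rewrite /N' tmap_tmap.
have tyN j : @typed _ (shs (sg_of (dl_ops (col j)))) _ chi (col j) (N' j).
  by have /and3P[/andP[]] := nN j; rewrite (@typed_tmap' _ (shs _) _ _ val chi).
have br : branching chi col f (fun j => from_sh (N' j)).
  move=> j; have p := perm_from_sh (N' j); rewrite from_sh_typed tyN; split=> //.
    rewrite (perm_uniq p) leaves_tmap' (map_inj_uniq val_inj).
    by have /and3P[/monomial_leaves q _ _] := nN j; rewrite (perm_uniq q) enum_uniq.
  move=> x; rewrite (perm_mem p) leaves_tmap'; have /and3P[/monomial_leaves q _ _] := nN j.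
  apply/mapP/idP => [[y _ ->]|fx]; first exact: (valP y).
  by exists (Sub x fx); rewrite ?(perm_mem q) ?mem_enum ?SubK.
have eD : (fun j => tmap val (from_sh (N j))) = fun j => from_sh (N' j).
  by apply: funext => j; rewrite from_sh_tmap.
rewrite eD; case: (nm_small mT) => [|[i [eT all_i ci]]|[i [j [eT ij ci cj ec]]]]; first by rewrite ltnNge sm.
  rewrite eT (gen_theta1 _ _ all_i ci).
  have <- : theta k chi c (N' i) = theta1 k chi c (from_sh (N' i)).
    by have := tyN i; rewrite ci; case: (N' i) => [//|[] a b] /andP[]; case: (c).
  have [sN mN] := shN i; apply: theta_span_theta; rewrite /normal_mono sN mN !andbT.
  have [_ u cov] := br i; have p := perm_from_sh (N' i).
  apply: monomialP; first by rewrite -ci; apply: typed_predT (tyN i).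
    by rewrite -(perm_uniq p).
  by move=> x; rewrite -(perm_mem p) cov [f x]all_i.
subst c; rewrite eT (gen_theta2 br ij ci cj).
have [_ ui covi] := br i; have [_ uj covj] := br j.
have pi := perm_from_sh (N' i); have pj := perm_from_sh (N' j).
rewrite (perm_uniq pi) in ui; rewrite (perm_uniq pj) in uj.
have {}covi x : (x \in leaves (N' i)) = (f x == i) by rewrite -(perm_mem pi).
have {}covj x : (x \in leaves (N' j)) = (f x == j) by rewrite -(perm_mem pj).
have dis x : x \in leaves (N' i) -> x \in leaves (N' j) -> False.
  by rewrite covi covj => e1 e2; have := ij (f x); rewrite e1 e2.
have ti := typed_predT (tyN i); have tj := typed_predT (tyN j); rewrite ci in ti; rewrite cj in tj.
have [si ni] := shN i; have [sj nj] := shN j.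
have rooti : if N' i is Node (sh_alpha | sh_d | sh_e) _ _ then true else if N' i is Leaf _ then true else false.
  by have := tyN i; rewrite ci; case: (N' i) => [//|[] a b] /andP[].
have rootj : if N' j is Node sh_beta _ _ then true else if N' j is Leaf _ then true else false.
  by have := tyN j; rewrite cj; case: (N' j) => [//|[] a b] /andP[].
case: (ltngtP (minl (tmap val (N' i))) (minl (tmap val (N' j)))) => lt.
- apply: (@theta_span_theta colL (Node sh_m (N' i) (N' j))).
  rewrite /normal_mono /= -!/(tmap _ _) lt si sj ni nj !andbT; apply/andP; split.
    apply: monomialP => [|/=|x] /=; first by rewrite ti tj.
      rewrite cat_uniq ui uj andbT; apply/hasPn => x xj; apply/negP => xi; exact: dis xi xj.
    by rewrite mem_cat covi covj; have := ij (f x); case: (f x == i); case: (f x == j).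
  move: rooti rootj; case: (N' i) => [?|[] ? ?]; by case: (N' j) => [?|[] ? ?].
- apply: (@theta_span_theta colL (Node sh_n (N' j) (N' i))).
  rewrite /normal_mono /= -!/(tmap _ _) lt si sj ni nj !andbT; apply/andP; split.
    apply: monomialP => [|/=|x] /=; first by rewrite ti tj.
      rewrite cat_uniq ui uj andbT; apply/hasPn => x xi; apply/negP => xj; exact: dis xi xj.
    by rewrite mem_cat covi covj; have := ij (f x); case: (f x == i); case: (f x == j).
  move: rooti rootj; case: (N' i) => [?|[] ? ?]; by case: (N' j) => [?|[] ? ?].
have := minl_in (tmap val (N' i)); rewrite leaves_tmap' => /mapP[x xi ex].
have := minl_in (tmap val (N' j)); rewrite leaves_tmap' => /mapP[y yj ey].
have exy : x = y by apply: val_inj; rewrite -ex -ey.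
by case: (dis x xi); rewrite exy.
Qed.

Lemma dl_normal_linspan (Y : finType) (r : Y -> nat) (xi : Y -> colour) d (x : Q Y xi d) :
  injective r ->
  linspan (fun y => exists2 N, normal_mono (sg_of (dl_ops d)) r xi d N &
                      y = dl_cls xi d << from_sh N >>) x.
Proof.
move=> ri W subW HW.
have L := @dl_cls_linear k Y xi d.
rewrite -[x]dl_cls_rep; apply: (subspace_free (h := @dl_cls k Y xi d) subW) => // t tx.
have mt := allP (dl_rep_hom x) t tx.
have [g ng Mg] := dl_normal_span k ri mt.
have hg : @homogeneous k _ (lr_sig (dl_ops d)) _ xi d (fgmap (@from_sh Y) g).
  by apply: (all_dom_fgmap ng) => N /and3P[mN _ _]; rewrite from_sh_monomial.
rewrite (dl_cls_eq _ hg Mg); last by rewrite /homogeneous domU1 /= mt.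
apply: (subspace_free (h := @dl_cls k Y xi d \o fgmap (@from_sh Y)) subW) => [a u v|N Ng] /=.
  by rewrite fgmap_linear L.
by rewrite fgmapU; apply: HW; exists N => //; apply: (allP ng).
Qed.

End CompSpan.

Section CompSpanned.
Variables (k : fieldType) (n : nat) (chi : 'I_n -> colour).
Local Notation Sg := (lr_sig full).
Local Notation Nn := (lr_sig [:: opm]).
Local Notation Q := (DCom1_Lie k).
Local Notation X := 'I_n.
Local Notation Comp c := (composition (Nm k) Q X chi c).
Local Notation MLR := (sym_ideal_gen (lr_rels_full k) (Sig := Sg)).
Local Notation lrcls c := (cls (lr_rels_full k) (Sig := Sg) chi c).
Local Notation nrm c := (normal_mono predT val chi c).

(** Trees of N_m with at least two vertices are zero by nilpotency, so p may be the identity or m;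
    by multilinearity the factors may be normal monomials of DCom and Lie. *)
Lemma comp_spanned c (x : Comp c) : theta_span x.
Proof.
have subW := theta_span_subspace k chi c; have [W0 _] := subW.
rewrite -[x]quot_reprK; apply: (subspace_free (h := quot_pi _) subW) => [|t _]; first exact: quot_pi_linear.
case: t => m col f hf p q; rewrite -[quot_pi _ _]/(term_class hf p q).
have Lp := @cls_linear k _ Nn (nm_rels k) _ col c.
rewrite -[p](@cls_rep k _ Nn (nm_rels k)).
apply: (subspace_free (h := fun r => term_class hf (cls (nm_rels k) (Sig := Nn) col c r) q) subW)
  => [a u v|T Tp].
  by rewrite Lp; apply: term_class_linl.
have mT : @monomial _ Nn _ col c T := allP (rep_hom p) T Tp.
have [sm|big] := leqP (nvertices T) 1; last first.
  have -> : cls (nm_rels k) (Sig := Nn) col c << T >> = 0.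
    rewrite -(lin0 Lp); apply/(cls_eq (nm_ideal k)); [|exact: all_dom0|].
      by rewrite /homogeneous domU1 /= mT.
    by rewrite subr0; apply: nm_big.
  by rewrite (lin0 (f := fun p => term_class hf p q)) // => a u v; apply: term_class_linl.
apply: term_class_span (theta_span_subspace k chi c) _ _ q => [j y|q' hq'].
  by apply: (dl_normal_linspan (r := fun x : fibre f j => val (val x))) => a b /val_inj/val_inj.
pose N j := s2val (cid2 (hq' j)).
have nN j : normal_mono (sg_of (dl_ops (col j))) (fun x : fibre f j => val (val x))
    (fun x => chi (val x)) (col j) (N j) by rewrite /N; case: cid2.
have eN j : q' j = dl_cls (fun x : fibre f j => chi (val x)) (col j) << from_sh (N j) >>.
  by rewrite /N; case: cid2.
have := theta_span_gen k mT sm nN.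
rewrite (genE _ _ _ _ _ (fun j => from_sh (N j)) hf) => h.
suff -> : q' = fun j => dl_cls (fun x : fibre f j => chi (val x)) (col j) << from_sh (N j) >> by [].
by apply: functional_extensionality_dep => j; rewrite eN.
Qed.
End CompSpanned.

(** * The comparison map is an isomorphism of collections *)

Section Bijection.
Variable k : fieldType.
Local Notation Sg := (lr_sig full).
Local Notation Q := (DCom1_Lie k).
Local Notation MLR := (sym_ideal_gen (lr_rels_full k) (Sig := Sg)).

Section Ordinal.
Variables (n : nat) (chi : 'I_n -> colour) (c : colour).
Local Notation lrcls := (cls (lr_rels_full k) (Sig := Sg) chi c).
Local Notation nrm := (normal_mono predT val chi c).

Let L := @cls_linear k _ Sg (lr_rels_full k) _ chi c.

Lemma from_sh_normal_hom (g : {freeg (tree sh_op 'I_n) / k}) : all nrm (dom g) ->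
  @homogeneous k _ Sg _ chi c (fgmap (@from_sh _) g).
Proof.
move=> ng; apply: (all_dom_fgmap ng) => N /and3P[mN _ _].
by rewrite (@from_sh_monomial _ _ _ full) sg_full.
Qed.

Lemma psi_theta_lin (g : {freeg (tree sh_op 'I_n) / k}) : all nrm (dom g) ->
  psi (fglift (theta k chi c) g) = lrcls (fgmap (@from_sh _) g).
Proof.
move=> /allP ng; rewrite fgliftE (lin_sum _ _ (@psi_linear k _ chi c)) fgmapE (lin_sum _ _ L).
apply: eq_big_seq => N /ng nN.
by rewrite (linZ _ _ (@psi_linear k _ chi c)) (linZ _ _ L) psi_theta.
Qed.

(** The relations hold for derivations of polynomial rings, so the functional of [detect] vanishes
    on g. Its value there is the coefficient of a monomial chosen from the support of g. *)
Lemma normal_free (g : {freeg (tree sh_op 'I_n) / k}) : all nrm (dom g) ->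
  MLR chi c (fgmap (@from_sh _) g) -> g = 0.
Proof.
move=> ng Mg; apply/eqP; rewrite -dom_eq0; case E : (dom g) => [//|t s].
have tg : t \in dom g by rewrite E inE eqxx.
have sm N : nrm N -> @sh_monomial _ (shs predT) _ chi c N /\ normal (tmap val N).
  by move=> /and3P[mN sN nN]; rewrite /sh_monomial mN (is_shuffle_shuf (Sig := shs predT)).
have [mt nt] := sm t (allP ng t tg).
have [phi [Lphi kill delta]] := detect k mt nt.
have : phi g = 0.
  apply: kill => rS rL p D.
  have /vanishingE[_ /(_ rS rL p D)] := Mg _ (vanishing_ideal
    {mpoly k[#|{: option 'I_n * n.-bseq 'I_n}|]} full) (@vanishing_rels k _).
  move=> <-; move: g {Mg ng E tg}; apply: (freeg_ext (g := fun f => fglift _ (fgmap _ f))) => [a f g|a f g|u].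
  - by rewrite fglift_linear.
  - by rewrite fgmap_linear fglift_linear.
  by rewrite fgmapU !liftU.
have -> : phi g = coeff t g.
  rewrite (freegE g) (lin_sum _ _ Lphi) coeff_sum; apply: eq_big_seq => N Ng.
  have [mN nN] := sm N (allP ng N Ng).
  by rewrite (linZ _ _ Lphi) delta // coeffZ coeffU mul1r.
by move=> c0; move: tg; rewrite mem_dom c0 eqxx.
Qed.

(** An element of the kernel is a combination of the elements [theta] of normal monomials. Its image
    is the same combination of normal monomials, which are independent in Lie-Rinehart. *)
Lemma psi_ord_inj : injective (@psi k _ chi c).
Proof.
move=> x y exy; apply/eqP; rewrite -subr_eq0; have [g ng exg] := comp_spanned (x - y).
have : psi (x - y) = 0 by rewrite (linB (@psi_linear k _ chi c)) exy subrr.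
rewrite exg psi_theta_lin // -(lin0 L) => e.
have Mg : MLR chi c (fgmap (@from_sh _) g - 0).
  by apply/(cls_eq (lr_ideal k)); [apply: from_sh_normal_hom|apply: all_dom0|].
rewrite subr0 in Mg; rewrite (normal_free ng Mg).
by rewrite (lin0 (fglift_linear _)).
Qed.

Lemma psi_ord_surj (y : LieRinehart k _ chi c) : exists x, psi x = y.
Proof.
have H (h : {freeg (tree lr_op 'I_n) / k}) : @homogeneous k _ Sg _ chi c h -> exists x, psi x = lrcls h.
  rewrite /homogeneous {2}(freegE h); elim: (dom h) => [|t s IH] /=.
    by exists 0; rewrite big_nil (lin0 L) (lin0 (@psi_linear k _ chi c)).
  move=> /andP[mt /IH[x ex]].
  have [g ng Mg] := lr_normal_span k (r := val) (@val_inj _ _ _) mt.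
  exists (coeff t h *: fglift (theta k chi c) g + x).
  rewrite (@psi_linear k _ chi c) psi_theta_lin // ex big_cons L; congr (_ *: _ + _).
  symmetry; apply/(cls_eq (lr_ideal k)); [|exact: from_sh_normal_hom|exact: Mg].
  by rewrite /homogeneous domU1 /= mt.
have [x ex] := H (rep y) (rep_hom y).
by exists x; rewrite ex cls_rep.
Qed.
End Ordinal.

Section General.
Variables (X : finType) (chi : X -> colour) (c : colour).

Let h : cbij chi (fun i => chi (enum_val i)) :=
  @Cbij _ _ _ chi (fun i : 'I_#|X| => chi (enum_val i)) enum_rank enum_val
    enum_rankK enum_valK (fun x => congr1 chi (enum_rankK x)).
Let h' : cbij (fun i => chi (enum_val i)) chi :=
  @Cbij _ _ _ (fun i : 'I_#|X| => chi (enum_val i)) chi enum_val enum_rank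
    enum_valK enum_rankK (fun x => erefl).

Let hK (P : collection k colour) (p : P X chi c) : cmap h' (cmap h p) = p.
Proof.
rewrite -(@cmap_comp _ _ P _ _ _ _ _ _ _ h h' (cbij_id chi)); first exact: cmap_id.
by move=> x /=; rewrite enum_rankK.
Qed.

Lemma psi_inj : injective (@psi k X chi c).
Proof.
move=> x y exy; rewrite -[x]hK -[y]hK; congr (cmap h' _).
by apply: psi_ord_inj; rewrite !psi_map exy.
Qed.

Lemma psi_surj (y : LieRinehart k X chi c) : exists x, psi x = y.
Proof.
have [x ex] := psi_ord_surj (cmap h y).
by exists (cmap h' x); rewrite psi_map ex hK.
Qed.
End General.

(** Maps out of the composition are the ones that can be given on generators, so psi points the
    other way. Linearity and naturality of its inverse follow from those of psi by injectivity. *)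
Lemma lr_isomorphic : isomorphic (LieRinehart k) (composition (Nm k) Q).
Proof.
exists (fun X chi c y => projT1 (cid (@psi_surj X chi c y))).
have K X chi c y : psi (projT1 (cid (@psi_surj X chi c y))) = y by case: cid.
split=> [X chi c _ a x y|X chi c _|X Y chi xi c h p _]; last 1 first.
- by apply: psi_inj; rewrite psi_map !K.
- by apply: psi_inj; rewrite (@psi_linear k X chi c) !K.
exists (@psi k X chi c) => [x|x]; first exact: K.
by apply: psi_inj; rewrite K.
Qed.
End Bijection.

Theorem theorem4p12 (k : fieldType) (char0 : [pchar k]%R =i pred0) :
  (exists le : rel (any_tree sh_sig),
     admissible le /\
     exists G : sh_family k sh_sig,
       groebner_basis le (@lr_sh_ideal k) G /\ quadratic G) /\
  isomorphic (LieRinehart k) (composition (Nm k) (DCom1_Lie k)).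
Proof.
split; last exact: lr_isomorphic.
exists sh_le; split; first exact: sh_le_admissible.
exists (@lr_quadratic k); split; [exact: lr_groebner|exact: lr_quadraticP].
Qed.
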